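(* Let $\mathbb H$ be the sub-Finsler Heisenberg group, equipped with a strictly convex and $C^{1,1}$ norm on $\mathbb R^2$ and with a smooth measure $\mathfrak m$. Then the metric measure space $(\mathbb H,\mathsf d_{SF},\mathfrak m)$ does not satisfy the Brunn–Minkowski inequality $\mathsf{BM}(K,N)$, for every $K\in\mathbb R$ and $N\in(1,\infty)$.
   Context: **Sub-Finsler Heisenberg group.** $\mathbb H$ is $\mathbb R^3$ with group law $(x,y,z)\star(x',y',z')=(x+x',y+y',z+z'+\frac12(xy'-x'y))$ and left-invariant vector fields $X_1=\partial_x-\frac y2\partial_z$, $X_2=\partial_y+\frac x2\partial_z$. Given a (symmetric) norm $\|\cdot\|$ on $\mathbb R^2$, an admissible curve is an absolutely continuous $\gamma:[0,1]\to\mathbb H$ with $\dot\gamma(t)=u_1(t)X_1(\gamma(t))+u_2(t)X_2(\gamma(t))$ for a.e. $t$, for some $u=(u_1,u_2)\in L^2([0,1];\mathbb R^2)$; its length is $\int_0^1\|u(t)\|dt$, and $\mathsf d_{SF}(p,q)$ is the infimum of lengths of admissible curves from $p$ to $q$. The norm is strictly convex if $x\mapsto\|x\|^2$ is strictly convex; it is $C^{1,1}$ if it belongs to $C^{1,1}(\mathbb R^2\setminus\{0\})$ (continuously differentiable with locally Lipschitz differential away from $0$). A smooth measure is a measure with smooth positive density with respect to Lebesgue measure. **Brunn–Minkowski inequality.** For a metric measure space $(\mathsf X,\mathsf d,\mathfrak m)$, $\mathrm{Geo}(\mathsf X)$ is the set of curves $\gamma:[0,1]\to\mathsf X$ with $\mathsf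 d(\gamma(s),\gamma(t))=|t-s|\,\mathsf d(\gamma(0),\gamma(1))$. For Borel $A,B\subset\mathsf X$ and $t\in(0,1)$, $M_t(A,B)=\{\gamma(t):\gamma\in\mathrm{Geo}(\mathsf X),\gamma(0)\in A,\gamma(1)\in B\}$. For $K\in\mathbb R$, $N>0$, $t\in[0,1]$, $\theta\ge0$ let $$\sigma^{(t)}_{K,N}(\theta)=\begin{cases}\frac{\sin(t\theta\sqrt{K/N})}{\sin(\theta\sqrt{K/N})}& N\pi^2>K\theta^2>0,\\ t& K\theta^2=0,\\ \frac{\sinh(t\theta\sqrt{-K/N})}{\sinh(\theta\sqrt{-K/N})}& K\theta^2<0,\end{cases}$$ with $\sigma^{(t)}_{K,N}(\theta)=+\infty$ if $K\theta^2\ge N\pi^2$, and for $N>1$ let $\tau^{(t)}_{K,N}(\theta)=t^{1/N}\big[\sigma^{(t)}_{K,N-1}(\theta)\big]^{1-1/N}$. The space satisfies $\mathsf{BM}(K,N)$ if for all nonempty Borel $A,B\subset\mathrm{spt}(\mathfrak m)$ and $t\in(0,1)$, $$\mathfrak m(M_t(A,B))^{\frac1N}\ge\tau^{(1-t)}_{K,N}(\Theta(A,B))\,\mathfrak m(A)^{\frac1N}+\tau^{(t)}_{K,N}(\Theta(A,B))\,\mathfrak m(B)^{\frac1N},$$ where $\Theta(A,B)=\inf_{x\in A,y\in B}\mathsf d(x,y)$ if $K\ge0$ and $\Theta(A,B)=\sup_{x\in A,y\in B}\mathsf d(x,y)$ if $K<0$. *)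

(* Defs.v *)
From HB Require Import structures.
From mathcomp Require Import all_boot all_order all_algebra.
From mathcomp Require Import all_classical all_reals all_analysis.
From mathcomp Require Import ring.
Set Implicit Arguments.
Unset Strict Implicit.
Unset Printing Implicit Defensive.
Import Order.TTheory GRing.Theory Num.Theory.
Import numFieldNormedType.Exports.
Local Open Scope classical_set_scope.
Local Open Scope ring_scope.

(* A point (x, y, z) is [(x, y, z) = ((x, y), z)], so that topology, norm, Borel
   sets and Lebesgue measure are those of the library on products. *)
Notation heis R := (R * R * R)%type.

Section heisenberg.
Context {R : realType}.
Implicit Types p q : heis R.

Definition heis_mul p q : heis R :=
  (p.1.1 + q.1.1, p.1.2 + q.1.2,
   p.2 + q.2 + 2^-1 * (p.1.1 * q.1.2 - q.1.1 * p.1.2)).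

(* Vector fields are given by their coefficients on (d/dx, d/dy, d/dz). *)
Definition X1 p : heis R := (1, 0, - (p.1.2 / 2)).
Definition X2 p : heis R := (0, 1, p.1.1 / 2).

(* X1 and X2 are the left-invariant fields equal to d/dx and d/dy at 0. *)
Lemma heis_mulX1 p (s : R) : heis_mul p (s, 0, 0) = p + s *: X1 p.
Proof.
case: p => [[x y] z]; rewrite /heis_mul /X1 /=.
congr (_, _, _) => /=; rewrite /GRing.scale /=; ring.
Qed.

Lemma heis_mulX2 p (s : R) : heis_mul p (0, s, 0) = p + s *: X2 p.
Proof.
case: p => [[x y] z]; rewrite /heis_mul /X2 /=.
congr (_, _, _) => /=; rewrite /GRing.scale /=; ring.
Qed.

End heisenberg.

Section norms.
Context {R : realType}.
Implicit Types N : R * R -> R.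

Definition is_norm N : Prop :=
  [/\ forall v, N v = 0 -> v = 0,
      forall (a : R) v, N (a *: v) = `|a| * N v
    & forall v w, N (v + w) <= N v + N w].

Definition strictly_convex_norm N : Prop :=
  forall (v w : R * R) (t : R), v != w -> 0 < t < 1 ->
    N (t *: v + (1 - t) *: w) ^+ 2 < t * N v ^+ 2 + (1 - t) * N w ^+ 2.

(* Local Lipschitz continuity of [v |-> 'd N v] is for the operator norm. *)
Definition C11_norm N : Prop :=
  forall x : R * R, x != 0 ->
    [/\ differentiable N x,
        forall h, {for x, continuous (fun y => 'd N y h)}
      & exists2 U : set (R * R), nbhs x U & exists k : R,
          forall y z h, U y -> U z ->
            `|'d N y h - 'd N z h| <= k * `|y - z| * `|h| ].

End norms.

Section sub_finsler_distance.
Context {R : realType}.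

Definition abs_continuous (V : normedModType R) (a b : R) (f : R -> V) : Prop :=
  forall e : R, 0 < e -> exists2 d : R, 0 < d &
    forall (n : nat) (s t : 'I_n -> R),
      (forall i, a <= s i <= t i /\ t i <= b) ->
      trivIset setT (fun i => `]s i, t i[%classic) ->
      \sum_(i < n) (t i - s i) < d ->
      \sum_(i < n) `|f (t i) - f (s i)| < e.

(* Curves on [0,1] are represented by functions on R whose values outside [0,1]
   are irrelevant; at the end points, a null set, two-sided derivatives may
   fail to exist. *)
Definition admissible (g : R -> heis R) (u : R -> R * R) : Prop :=
  [/\ abs_continuous 0 1 g,
      measurable_fun (`[0, 1]%classic : set R) u,
      (\int[lebesgue_measure]_(t in `[0%R, 1%R])
         ((u t).1 ^+ 2 + (u t).2 ^+ 2)%:E < +oo)%E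
    & {ae lebesgue_measure, forall t : R, 0 <= t <= 1 ->
         is_derive t 1 g ((u t).1 *: X1 (g t) + (u t).2 *: X2 (g t))}].

Definition sf_length (N : R * R -> R) (u : R -> R * R) : \bar R :=
  \int[lebesgue_measure]_(t in `[0%R, 1%R]) (N (u t))%:E.

Definition sf_dist (N : R * R -> R) (p q : heis R) : \bar R :=
  ereal_inf [set l | exists g u,
    [/\ admissible g u, g 0 = p, g 1 = q & l = sf_length N u]].

End sub_finsler_distance.

Section smooth_measure.
Context {R : realType}.

(* C^oo: all iterated directional derivatives are differentiable everywhere. *)
Definition smooth (V W : normedModType R) (f : V -> W) : Prop :=
  forall (s : seq V) (x : V),
    differentiable (foldr (fun v (g : V -> W) => 'D_v g) f s) x.

Definition lebesgue3 : set (heis R) -> \bar R :=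
  ((lebesgue_measure \x lebesgue_measure) \x lebesgue_measure)%E.

Definition smooth_measure (m : set (heis R) -> \bar R) : Prop :=
  exists rho : heis R -> R,
    [/\ smooth rho, forall x, 0 < rho x
      & forall A, measurable A -> m A = (\int[lebesgue3]_(x in A) (rho x)%:E)%E].

End smooth_measure.

Section distortion_coefficients.
Context {R : realType}.
Implicit Types K N t x : R.

Definition sinh x : R := (expR x - expR (- x)) / 2.

(* The argument theta may be +oo, since it will be the supremum of a distance.
   The value there is the limit for theta -> +oo. *)
Definition sigma K N t (theta : \bar R) : \bar R :=
  match theta with
  | r%:E =>
      if N * pi ^+ 2 <= K * r ^+ 2 then +oo%E
      else if K * r ^+ 2 == 0 then t%:E
      else if 0 < K * r ^+ 2 then
        (sin (t * r * Num.sqrt (K / N)) / sin (r * Num.sqrt (K / N)))%:E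
      else
        (sinh (t * r * Num.sqrt (- K / N)) / sinh (r * Num.sqrt (- K / N)))%:E
  | _ =>
      if 0 < K then +oo%E
      else if K == 0 then t%:E
      else if t < 1 then 0%E else 1%E
  end.

Definition tau K N t (theta : \bar R) : \bar R :=
  ((t `^ N^-1)%:E * sigma K (N - 1) t theta `^ (1 - N^-1))%E.

End distortion_coefficients.

Section brunn_minkowski.
Context {R : realType} (disp : measure_display) (T : measurableType disp).
Variables (d : T -> T -> \bar R) (m : {measure set T -> \bar R}).

Definition geodesic (g : R -> T) : Prop :=
  forall s t : R, 0 <= s <= 1 -> 0 <= t <= 1 ->
    d (g s) (g t) = (`|t - s|%R%:E * d (g 0%R) (g 1%R))%E.

Definition midpoints (t : R) (A B : set T) : set T :=
  [set x | exists g, [/\ geodesic g, A (g 0), B (g 1) & x = g t]].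

Definition spt : set T :=
  [set x | forall r : R, 0 < r -> (0 < (m^*)%mu [set y | (d x y < r%:E)%E])%E].

Definition Theta (K : R) (A B : set T) : \bar R :=
  let D := [set d x y | x in A & y in B] in
  if 0 <= K then ereal_inf D else ereal_sup D.

(* The measurable sets of [T] play the role of the Borel sets of [d]. The set
   [midpoints t A B] need not be Borel, hence the outer measure [m^*], which
   agrees with [m] on measurable sets. Products follow the convention
   0 * +oo = 0 of the library. *)
Definition BM (K N : R) : Prop :=
  forall (A B : set T) (t : R),
    measurable A -> measurable B -> A !=set0 -> B !=set0 ->
    A `<=` spt -> B `<=` spt -> 0 < t < 1 ->
    (tau K N (1 - t)%R (Theta K A B) * m A `^ N^-1
       + tau K N t (Theta K A B) * m B `^ N^-1
     <= (m^*)%mu (midpoints t A B) `^ N^-1)%E.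

End brunn_minkowski.

(* Main.v *)
(* The norm being C^{1,1} and not affine on segments, its derivative along a line has a positive
   supremal slope, and near a pair of points almost attaining it the norm is, at one small scale
   [rho], a parabola up to an arbitrarily small fraction of [rho^2]. In coordinates [x, y] adapted
   to that direction, with [w] the area variable, the distance between points near the ends of a
   horizontal segment is then [X + kap * (action of the optimal parabola)] up to a small error:
   running along the parabola bounds it from above, and a quadratic calibration bounds it from
   below, since an absolutely continuous function along an admissible curve grows at most by the
   integral of its derivative. Comparing many calibrations confines the midpoints of two
   parallelepipeds of volume [32 r^3] around the ends to a box of volume [125/8 r^3], although
   Brunn-Minkowski with dimension [N] would require almost [32 r^3]. Dilating to a small scale makes
   the curvature coefficients tend to [1/2] and the density of the measure almost constant. *)
Require Import Defs.
From HB Require Import structures.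
From mathcomp Require Import all_boot all_order all_algebra.
From mathcomp Require Import all_classical all_reals all_analysis.
From mathcomp Require Import ring lra measurable_realfun.
Import Order.TTheory GRing.Theory Num.Theory.
Import numFieldNormedType.Exports.
Local Open Scope classical_set_scope.
Local Open Scope ring_scope.

(** If the norm were exactly [x + kap y^2 / (2 x)], geodesics from [x = -1] to [x = 1] would be
    parabolas, passing over [x = 0] at [y = - ((ya - 3 wa) + (yb + 3 wb)) / 4] and
    [w = ((yb + 2 wb) - (ya - 2 wa)) / 4]. The midpoint is then half the sum of an affine image of
    each end, and each affine map has a determinant of modulus 1/4. Bounding exactly these forms,
    [y - 3 w], [y - 2 w] at the source and [y + 3 w], [y + 2 w] at the target, makes both images the
    same cube of volume [8 r^3], a quarter of the volume of each box. All errors have to fit into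
    this factor 4. The obstacle is that a C^{1,1} norm need not have a second derivative at the
    chosen point: the parabola fits at one scale [rho] only, and its relative error is not known to
    improve at smaller scales. So the error is fixed in advance, [r] is a fixed fraction of [rho],
    and all constants are explicit. The smallness needed for [K] and for the measure has to come
    from the dilations, under which the distance scales exactly. *)

(** * Real induction and the growth of absolutely continuous functions *)

(** Real induction. A step straddling the supremum of the good points carries [P] from a good point
    just below it to the supremum and past it, so it plays the part of both the closed and the open
    step. *)
Lemma straddle_induction (R : realType) (P : R -> Prop) (a b : R) :
  a <= b -> P a ->
  (forall c, a <= c <= b -> exists2 eta, 0 < eta &
     forall s t, a <= s <= c -> c <= t <= b -> c - eta < s -> t < c + eta ->
       P s -> P t) ->
  P b.
Proof.
move=> ab Pa step.
pose S := [set t | a <= t <= b /\ P t].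
have Sa : S a by rewrite /S/= lexx ab.
have hS : has_sup S.
  by split; [exists a | exists b => t [/andP[]]].
have acb : a <= sup S <= b.
  rewrite (ub_le_sup (proj2 hS) Sa)/=.
  by apply: ge_sup; [exists a | move=> t [/andP[]]].
have [eta eta0 hc] := step _ acb.
have [s [/andP[as_ sb] Ps] cs] := sup_adherent eta0 hS.
have sc : s <= sup S by apply: ub_le_sup; [case: hS | split; rewrite ?as_].
have [bc|bc] := ltP b (sup S + eta).
  by apply: (hc s) => //; rewrite ?as_ ?sc// lexx andbT; case/andP: acb.
have /andP[ac cb] := acb.
have : P (sup S + eta / 2).
  apply: (hc s) => //; rewrite ?as_ ?sc//; last lra.
  by apply/andP; split; lra.
move=> Pt; have : sup S + eta / 2 <= sup S.
  apply: ub_le_sup; first by case: hS.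
  by split=> //; apply/andP; split; lra.
by move=> ?; exfalso; lra.
Qed.

Section ac.
Context {R : realType}.
Notation mu := (@lebesgue_measure R).

(** With [H] the integral of [h], the derivative of [phi - H] is at most 0 off a null set [E]. Real
    induction bounds the increment: near a point off [E] the excess slope is at most [e' / 2]; near
    a point of [E] the interval is stored. Absolute continuity pays for all stored intervals at
    once, since they lie in an open set of measure less than [d]. *)
Lemma ac_increment_le (phi h : R -> R) (T0 T : R) :
  0 <= T0 -> T0 <= T -> T <= 1 -> abs_continuous 0 1 phi -> (forall t, 0 <= h t) ->
  mu.-integrable `[0, 1] (EFin \o h) ->
  {ae mu, forall t : R, 0 <= t <= 1 -> derivable phi t 1 /\ 'D_1 phi t <= h t} ->
  ((phi T - phi T0)%:E <= \int[mu]_(t in `[0%R, 1%R]) (h t)%:E)%E.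
Proof.
move=> T00 T0T T1 acphi h0 ih dphi.
pose f := h \_ `[0, 1].
have f0 t : 0 <= f t by rewrite /f patchE; case: ifP.
have if_ : mu.-integrable setT (EFin \o f).
  by rewrite /f -restrict_EFin; apply/integrable_restrict => //=; rewrite setTI.
have iS (A : set R) : measurable A -> mu.-integrable A (EFin \o f).
  by move=> mA; apply: integrableS if_.
have locf : locally_integrable setT f.
  split => //.
  - by case/integrableP: if_ => /measurable_EFinP.
  - exact: openT.
  - move=> K _ cK; have /integrableP[_] := iS _ (compact_measurable cK).
    by [].
pose H x := (\int[mu]_(t in `]-oo, x]) f t)%R.
have := @FTC1Ny R f (fun y => iS _ (measurable_itv _)) locf.
move=> /= dH.
have HE a b : a <= b -> H b - H a = (\int[mu]_(t in `]a, b]) f t)%R.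
  by move=> ab; rewrite /H Rintegral_itvB ?bnd_simp//; exact: iS.
have Hmon a b : a <= b -> H a <= H b.
  by move=> ab; rewrite -subr_ge0 HE//; apply: Rintegral_ge0.
have HT : ((H T - H T0)%:E <= \int[mu]_(t in `[0%R, 1%R]) (h t)%:E)%E.
  rewrite HE// /Rintegral fineK; last by apply: integrable_fin_num => //; exact: iS.
  rewrite (_ : (\int[mu]_(t in `[0%R, 1%R]) (h t)%:E)%E =
    (\int[mu]_(t in setT) (f t)%:E)%E); last first.
    by rewrite integral_mkcond restrict_EFin.
  by apply: ge0_subset_integral => //= [|t _]; [case/integrableP: if_ | rewrite lee_fin].
apply: le_trans HT; rewrite lee_fin.
have [E [mE E0 sE]] : mu.-negligible [set t : R | ~ (0 <= t <= 1 ->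
   derivable (phi \- H) t 1 /\ 'D_1 (phi \- H) t <= 0)].
  have : {ae mu, forall t : R, 0 <= t <= 1 ->
     derivable (phi \- H) t 1 /\ 'D_1 (phi \- H) t <= 0}.
    move: dphi dH; apply: (@filterS2 _ _ (ae_filter_ringOfSetsType mu)) => t + [dHt DHt] t01.
    move=> /(_ t01)[dp Dp].
    split; first exact: derivableB.
    rewrite deriveB// subr_le0 (le_trans Dp)//.
    rewrite -derive1E DHt /f patchE mem_set//.
  by [].
apply/ler_addgt0Pl => e' e'0.
have e20 : 0 < e' / 2 by lra.
have [d d0 hd] := acphi _ e20.
have [|O [oO EO mO]] := lebesgue_regularity_outer mE _ d0.
  by apply: (@le_lt_trans _ _ 0%E); [rewrite le_eqVlt; apply/orP; left; apply/eqP; exact: E0 | exact: ltry].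
have mO' : (mu O < d%:E)%E.
  apply: le_lt_trans mO.
  have : (mu O <= mu (O `\` E) + mu E)%E; last first.
    by move/le_trans; apply; rewrite [X in (_ + X)%E](_ : _ = 0%E) ?adde0//; exact: E0.
  apply: (@le_trans _ _ (mu ((O `\` E) `|` E))); last first.
    by apply: measureU2 => //; apply: measurableD => //; exact: open_measurable.
  apply: le_measure; rewrite ?inE.
  - exact: open_measurable.
  - apply: measurableU => //.
    by apply: measurableD => //; exact: open_measurable.
  - by move=> x Ox; have [|] := pselect (E x); [right|left].
(* The intervals stored up to [t]. Their total length is compared with [O] cut at [t], so that the
   bound survives the addition of one more interval. *)
pose fam t n (u v : nat -> R) := [/\ forall i, (i < n)%N -> T0 <= u i <= v i /\ v i <= t,
   forall i j, (i < j < n)%N -> v i <= u j,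
   ((\sum_(i < n) (v i - u i))%:E <= mu (O `&` `[T0, t]))%E
 & phi t - phi T0 <= H t - H T0 + e' / 2 * (t - T0) + \sum_(i < n) `|phi (v i) - phi (u i)|].
have [n [u [v [uv vu len inc]]]] : exists n u v, fam T n u v.
  apply: (@straddle_induction _ (fun t => exists n u v, fam t n u v) T0 T) => //.
    exists 0%N, (fun=> 0), (fun=> 0).
    by split=> [i|i j||]; rewrite ?ltn0 ?andbF ?big_ord0//; lra.
  move=> c /andP[Tc cT].
  have [Ec|nEc] := pselect (E c).
    have /open_nbhs_nbhs : open_nbhs c O by split=> //; exact: EO.
    move=> /nbhs_ballP[eta /= eta0 bO].
    exists eta => // s t /andP[Ts sc] /andP[ct tT] es et [n [u [v [uv vu len inc]]]].
    exists n.+1, (fun i => if (i < n)%N then u i else s), (fun i => if (i < n)%N then v i else t).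
    split.
    - move=> i; rewrite ltnS leq_eqVlt => /predU1P[->|ni].
        by rewrite ltnn; split=> //; apply/andP; split => //; lra.
      by rewrite ni; have [uvi vs] := uv _ ni; split => //; lra.
    - move=> i j /andP[ij]; rewrite ltnS leq_eqVlt => /predU1P[jn|nj].
        by subst j; rewrite ij ltnn; case: (uv _ ij).
      by rewrite (ltn_trans ij nj) nj vu// ij.
    - rewrite big_ord_recr /= ltnn.
      under eq_bigr do rewrite ltn_ord.
      rewrite EFinD.
      have -> : ((t - s)%:E = mu `]s, t])%E.
        rewrite lebesgue_measure_itv/= lte_fin; case: ltP => //= ts.
        by rewrite (_ : t = s) ?subrr//; lra.
      apply: le_trans (leeD2r _ len) _.
      rewrite -measureU//=; last 2 first.
        by apply: measurableI => //; exact: open_measurable.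
        apply/seteqP; split => // x /=; rewrite !in_itv/=.
        by move=> [[_ /andP[_ xs]] /andP[sx _]]; lra.
      apply: le_measure; rewrite ?inE.
      + apply: measurableU => //; apply: measurableI => //; exact: open_measurable.
      + apply: measurableI => //; exact: open_measurable.
      + move=> x /=; rewrite !in_itv/= => -[[Ox /andP[Tx xs]]|/andP[sx xt]].
          by split => //; apply/andP; split; lra.
        split; last by apply/andP; split; lra.
        by apply: bO; rewrite /ball/= ltr_norml; apply/andP; split; lra.
    - rewrite big_ord_recr /= ltnn.
      under eq_bigr do rewrite ltn_ord.
      have := ler_norm (phi t - phi s).
      have := Hmon _ _ (le_trans sc ct).
      have : 0 <= e' / 2 * (t - s) by rewrite mulr_ge0//; lra.
      lra.
  have /contrapT/(_ _)[|dpsi Dpsi] : ~ ~ (0 <= c <= 1 ->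
     derivable (phi \- H) c 1 /\ 'D_1 (phi \- H) c <= 0).
    by move=> abs; apply: nEc; apply: sE.
    by apply/andP; split; lra.
  pose psi := phi \- H.
  have [eta eta0 hpsi] : exists2 eta, 0 < eta & forall x, `|x - c| < eta ->
     `|psi x - psi c - 'D_1 psi c * (x - c)| <= e' / 2 * `|x - c|.
    have /cvgrPdist_le/(_ _ e20)/nbhs_ballP[eta /= eta0 heta] :
      h^-1 *: (psi (h *: 1 + c) - psi c) @[h --> 0^'] --> 'D_1 psi c by exact: dpsi.
    exists eta => // x xc; have [->|xc0] := eqVneq x c.
      by rewrite !subrr normr0 !mulr0 subrr normr0.
    have xc0' : x - c != 0 by rewrite subr_eq0.
    have := heta (x - c); rewrite /ball/= sub0r normrN => /(_ xc xc0').
    rewrite [(_ *: 1)%R]mulr1 subrK => hh.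
    rewrite -[X in `|X|](mulfVK xc0') normrM ler_wpM2r//.
    rewrite mulrBl mulfK// -normrN opprB; apply: le_trans hh.
    by rewrite /GRing.scale/= [X in _ <= `|_ - X|]mulrC.
  exists eta => // s t /andP[Ts sc] /andP[ct tT] es et [n [u [v [uv vu len inc]]]].
  exists n, u, v; split => //.
  - by move=> i /uv[? ?]; split => //; lra.
  - apply: le_trans len _; apply: le_measure; rewrite ?inE.
    + by apply: measurableI => //; exact: open_measurable.
    + by apply: measurableI => //; exact: open_measurable.
    + move=> x /=; rewrite !in_itv/= => -[Ox /andP[Tx xs]].
      by split => //; apply/andP; split; lra.
  - have hs : `|s - c| < eta by rewrite ltr_norml; apply/andP; split; lra.
    have ht : `|t - c| < eta by rewrite ltr_norml; apply/andP; split; lra.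
    have := hpsi _ hs; rewrite (ler0_norm (_ : s - c <= 0)); last lra.
    have := hpsi _ ht; rewrite (ger0_norm (_ : 0 <= t - c)); last lra.
    rewrite !ler_norml => /andP[_ h1] /andP[h2 _].
    have : 'D_1 psi c * (t - c) <= 0 by rewrite mulr_le0_ge0//; lra.
    have : 0 <= 'D_1 psi c * (s - c) by rewrite mulr_le0//; lra.
    move: h1 h2; rewrite /psi /=; move: inc; lra.
have hsum : \sum_(i < n) `|phi (v i) - phi (u i)| < e' / 2.
  apply: (hd n (fun i => u i) (fun i => v i)).
  - by move=> i; have [/andP[? ?] ?] := uv _ (ltn_ord i); split; [apply/andP; split|]; lra.
  - apply/trivIsetP => i j _ _; wlog ij : i j / (i < j)%N.
      move=> hw ij; have [ij'|ji|/val_inj ij'] := ltngtP i j.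
      + exact: hw.
      + by rewrite setIC hw// eq_sym.
      + by rewrite ij' eqxx in ij.
    move=> _; have := vu i j; rewrite ij ltn_ord => /(_ isT) vuij.
    apply/seteqP; split => // x /=; rewrite !in_itv/=.
    by move=> [/andP[_ ?] /andP[? _]]; lra.
  - rewrite -lte_fin; apply: le_lt_trans mO'; apply: le_trans len _.
    apply: le_measure; rewrite ?inE.
    + by apply: measurableI => //; exact: open_measurable.
    + exact: open_measurable.
    + by move=> x [].
have : e' / 2 * (T - T0) <= e' / 2 by rewrite ler_piMr//; lra.
move: inc hsum => /=; lra.
Qed.
End ac.

Set Implicit Arguments.
Unset Strict Implicit.

(** * Functions with Lipschitz derivative that are almost quadratic at one scale *)

Section osculation.
Context {R : realType}.

Lemma mean_value_bound (g dg : R -> R) (q C : R) :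
  (forall s : R, `|s| <= q -> is_derive s 1 g (dg s)) ->
  (forall s : R, `|s| <= q -> `|dg s| <= C) -> g 0 = 0 ->
  forall s : R, `|s| <= q -> `|g s| <= C * `|s|.
Proof.
move=> gdg dgC g0 s sq.
have [s0|s0] := leP 0 s.
  have seg (r : R) : 0 <= r -> r <= s -> `|r| <= q.
    by move=> r0 rs; rewrite ger0_norm// (le_trans rs)// (le_trans (ler_norm _)).
  have [r||r] := @MVT_segment _ g dg 0 s s0.
  - by rewrite in_itv/= => /andP[r0 rs]; apply: gdg; apply: seg; exact: ltW.
  - apply: derivable_within_continuous => r; rewrite in_itv/= => /andP[r0 rs].
    exact: (@ex_derive _ _ _ _ _ _ _ (gdg _ (seg _ r0 rs))).
  rewrite in_itv/= => /andP[r0 rs]; rewrite g0 !subr0 => ->.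
  by rewrite normrM ler_wpM2r//; apply/dgC/seg.
have seg (r : R) : s <= r -> r <= 0 -> `|r| <= q.
  move=> sr r0; rewrite ler0_norm//; apply: le_trans sq.
  by rewrite ler0_norm ?lerN2// ltW.
have [r||r] := @MVT_segment _ g dg s 0 (ltW s0).
- by rewrite in_itv/= => /andP[r0 rs]; apply: gdg; apply: seg; exact: ltW.
- apply: derivable_within_continuous => r; rewrite in_itv/= => /andP[r0 rs].
  exact: (@ex_derive _ _ _ _ _ _ _ (gdg _ (seg _ r0 rs))).
rewrite in_itv/= => /andP[r0 rs]; rewrite g0 !sub0r => /(congr1 Num.norm).
by rewrite normrN normrM normrN => ->; rewrite ler_wpM2r//; apply/dgC/seg.
Qed.

(* A slope of [D] that nearly attains the supremum of all slopes forces [D] to be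
   nearly affine between the two points: no slope on either side can exceed the
   supremum. *)
Lemma almost_quadratic (f D : R -> R) (delta L0 eps eta : R) :
  (forall s : R, `|s| <= delta -> is_derive s 1 f (D s)) ->
  (forall s t, - delta <= s -> s <= t -> t <= delta -> D t - D s <= L0 * (t - s)) ->
  (exists s t, [/\ - delta <= s, s < t, t <= delta & D s < D t]) ->
  0 < eps -> 0 < eta ->
  exists c L q, [/\ 0 < L <= L0, 0 < q <= eta, `|c| <= delta &
    forall s, `|s| <= q ->
      `|f (c + s) - f c - D c * s - L * s ^+ 2 / 2| <= eps * L * q ^+ 2].
Proof.
move=> df Dlip [s0 [t0 [ds0 st0 td0 Dst0]]] eps0 eta0.
(* Only slopes over pairs at distance at most [eta] compete, so that the nearly optimal pair gives a
   scale [q <= eta]. *)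
pose S := [set a : R | exists s t, [/\ - delta <= s, s < t, t <= delta, t - s <= eta
   & a = (D t - D s) / (t - s)]].
(* If [D] increased over no short pair, real induction would give [D t0 <= D s0]. *)
have [s1 [t1 [ds1 st1 td1 ste1 Dst1]]] : exists s t,
    [/\ - delta <= s, s < t, t <= delta, t - s <= eta & D s < D t].
  apply: contrapT => abs.
  suff : D t0 <= D s0 by rewrite leNgt Dst0.
  apply: (@straddle_induction _ (fun t => D t <= D s0) s0 t0) => //; first exact: ltW.
  move=> c /andP[sc ct]; exists (eta / 2); first lra.
  move=> s t /andP[s0s sc'] /andP[ct' tt0] cs tc Ds.
  rewrite leNgt; apply/negP => Dt; apply: abs; exists s, t.
  have sDt : D s < D t by apply: le_lt_trans Dt.
  split => //; [lra| |lra|lra].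
  by rewrite lt_neqAle (le_trans sc' ct') andbT; apply: contraTneq sDt => ->; rewrite ltxx.
have SL0 : ubound S L0.
  move=> _ [s [t [ds st td _ ->]]].
  by rewrite ler_pdivrMr ?subr_gt0// Dlip// ltW.
have hS : has_sup S.
  by split; [exists ((D t1 - D s1) / (t1 - s1)), s1, t1 | exists L0].
pose L := sup S.
have DL s t : - delta <= s -> s <= t -> t <= delta -> t - s <= eta -> D t - D s <= L * (t - s).
  move=> ds; rewrite le_eqVlt => /predU1P[->|st] td ste; first by rewrite !subrr mulr0.
  rewrite -ler_pdivrMr ?subr_gt0//; apply: ub_le_sup; first by case: hS.
  by exists s, t.
have L_gt0 : 0 < L.
  have := DL _ _ ds1 (ltW st1) td1 ste1.
  have := Dst1; rewrite -subr_gt0 => h1 h2.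
  by have := lt_le_trans h1 h2; rewrite pmulr_lgt0// subr_gt0.
have LL0 : L <= L0 by apply: ge_sup => //; case: hS.
have eL : 0 < eps / 2 * L by rewrite mulr_gt0//; lra.
have [_ [x [y [dx xy yd xye ->]]]] := sup_adherent eL hS.
rewrite ltr_pdivlMr ?subr_gt0// -/L => Dxy.
pose c := (x + y) / 2; pose q := (y - x) / 2.
exists c, L, q; split.
- by rewrite L_gt0.
- by rewrite /q; apply/andP; split; lra.
- by rewrite /c ler_norml; apply/andP; split; lra.
have hD s : `|s| <= q -> `|D (c + s) - D c - L * s| <= eps * L * q.
  rewrite /q ler_norml => /andP[h1 h2].
  have a1 : D y - D x > L * (y - x) - eps * L * q by move: Dxy; rewrite /q; lra.
  have xc : x <= c by rewrite /c; clear -xy; lra.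
  have cy : c <= y by rewrite /c; clear -xy; lra.
  have xcs : x <= c + s by rewrite /c; clear -h1; lra.
  have csy : c + s <= y by rewrite /c; clear -h2; lra.
  have dc : - delta <= c := le_trans dx xc.
  have cd : c <= delta := le_trans cy yd.
  have le_eta (a b : R) : x <= a -> b <= y -> b - a <= eta.
    by clear -xye => ? ?; lra.
  have h4 := DL _ _ dx xcs (le_trans csy yd) (le_eta _ _ (lexx x) csy).
  have h5 := DL _ _ (le_trans dx xcs) csy yd (le_eta _ _ xcs (lexx y)).
  have h6 := DL _ _ dx xc cd (le_eta _ _ (lexx x) cy).
  have h7 := DL _ _ dc cy yd (le_eta _ _ xc (lexx y)).
  have h9 : 0 <= eps * L * (y - x) by rewrite !mulr_ge0 ?ltW// subr_gt0.
  have [s0'|s0'] := leP 0 s.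
    have h8 : D (c + s) - D c <= L * (c + s - c).
      by apply: DL => //; [rewrite lerDl | exact: le_trans yd | exact: le_eta].
    move: a1 h4 h5 h6 h7 h8 h9; rewrite ler_norml /c /q; clear => *.
    by apply/andP; split; lra.
  have h8 : D c - D (c + s) <= L * (c - (c + s)).
    by apply: DL => //; [exact: le_trans xcs | rewrite gerDl ltW | exact: le_eta].
  move: a1 h4 h5 h6 h7 h8 h9; rewrite ler_norml /c /q; clear => *.
  by apply/andP; split; lra.
have q0 : 0 < q by rewrite /q; lra.
pose g (s : R) := f (c + s) - f c - D c * s - L * s ^+ 2 / 2.
have dg (s : R) : `|s| <= q -> is_derive s 1 g (D (c + s) - D c - L * s).
  move=> sq.
  have dfs : is_derive (c + s) 1 f (D (c + s)).
    apply: df; move: sq; rewrite /c /q !ler_norml => /andP[? ?]; apply/andP; split; lra.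
  have dc : is_derive s 1 (fun s : R => c + s) 1.
    rewrite (_ : (fun s : R => c + s) = shift c); last by apply/funext => z /=; rewrite addrC.
    exact: is_derive_shift.
  have dfc : is_derive s 1 (fun s : R => f (c + s)) (D (c + s) * 1) by exact: is_derive1_comp.
  rewrite /g; apply: is_derive_eq.
  rewrite /GRing.scale/=; lra.
have g0 : g 0 = 0 by rewrite /g addr0 subrr mulr0 expr0n mulr0 mul0r !subr0.
have gq := mean_value_bound dg hD g0.
move=> s sq; apply: le_trans (gq _ sq) _.
rewrite (_ : eps * L * q ^+ 2 = eps * L * q * q); last by ring.
by rewrite ler_wpM2l// mulr_ge0 ?(ltW q0)// mulr_ge0// ltW.
Qed.

End osculation.

(** * A frame in which the norm osculates a parabola *)

Section norm.
Context {R : realType}.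
Variables (N : R * R -> R) (hN : is_norm N).

Lemma nrmZ a v : N (a *: v) = `|a| * N v. Proof. by case: hN. Qed.
Lemma nrmD v w : N (v + w) <= N v + N w. Proof. by case: hN. Qed.
Lemma nrm0 : N 0 = 0. Proof. by rewrite -(scale0r 0) nrmZ normr0 mul0r. Qed.
Lemma nrmN v : N (- v) = N v. Proof. by rewrite -scaleN1r nrmZ normrN1 mul1r. Qed.
Lemma nrm_ge0 v : 0 <= N v.
Proof. by have := nrmD v (- v); rewrite subrr nrm0 nrmN; lra. Qed.
Lemma nrm_gt0 v : v != 0 -> 0 < N v.
Proof.
move=> v0; rewrite lt_neqAle nrm_ge0 andbT eq_sym; apply: contraNneq v0 => Nv.
by apply/eqP; case: hN => + _ _; apply.
Qed.
Lemma nrm_sub v w : N v - N w <= N (v + w).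
Proof. by have := nrmD (v + w) (- w); rewrite addrK nrmN lerBlDr. Qed.

Lemma nrm_convex (v w : R * R) (t : R) : 0 <= t <= 1 ->
  N (v + t *: w) <= (1 - t) * N v + t * N (v + w).
Proof.
move=> /andP[t0 t1].
have -> : v + t *: w = (1 - t) *: v + t *: (v + w).
  by rewrite scalerDr addrA -scalerDl subrK scale1r.
by apply: le_trans (nrmD _ _) _; rewrite !nrmZ !ger0_norm ?subr_ge0.
Qed.

Lemma nrm_diff_le (x h : R * R) : differentiable N x -> N x + 'd N x h <= N (x + h).
Proof.
move=> dN; rewrite -lerBrDl.
have dh : t^-1 *: (N (t *: h + x) - N x) @[t --> 0^'] --> 'd N x h.
  by rewrite -deriveE//; exact: (diff_derivable dN).
apply/ler_addgt0Pl => a a0.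
have /cvgrPdist_le/(_ _ a0)/nbhs_ballP[eta /= eta0 heta] := dh.
pose t := Num.min (eta / 2) 1.
have t0 : 0 < t by rewrite lt_min ltr01 andbT; lra.
have t1 : t <= 1 by rewrite ge_min lexx orbT.
have te : t < eta by rewrite gt_min; apply/orP; left; lra.
have := heta t; rewrite /ball/= sub0r normrN (gtr0_norm t0) => /(_ te (lt0r_neq0 t0)).
rewrite ler_norml => /andP[_]; rewrite lerBlDr => /le_trans; apply; rewrite lerD2l.
rewrite (addrC (t *: h)) [_ *: _]mulrC ler_pdivrMr//.
have := @nrm_convex x h t; rewrite t1 (ltW t0) => /(_ isT); lra.
Qed.

(** Strict convexity at the unit vectors along [v] and [w], with weights proportional to [N v] and
    [N w]: the combination is [(v + w) / (N v + N w)]. *)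
Lemma nrm_strict_triangle (v w : R * R) : strictly_convex_norm N ->
  v != 0 -> w != 0 -> (N v)^-1 *: v != (N w)^-1 *: w -> N (v + w) < N v + N w.
Proof.
move=> sc v0 w0 vw.
have Nv := nrm_gt0 v0; have Nw := nrm_gt0 w0.
have NN : 0 < N v + N w by lra.
pose t := N v / (N v + N w).
have t01 : 0 < t < 1 by rewrite /t divr_gt0//= ltr_pdivrMr//; lra.
have := sc _ _ t vw t01; rewrite !nrmZ !gtr0_norm ?invr_gt0// !mulVf ?gt_eqF//.
have -> : t *: ((N v)^-1 *: v) + (1 - t) *: ((N w)^-1 *: w) = (N v + N w)^-1 *: (v + w).
  rewrite !scalerA scalerDr; congr (_ *: _ + _ *: _); rewrite /t; field; lra.
rewrite nrmZ gtr0_norm ?invr_gt0// expr1n !mulr1 subrKC.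
rewrite -[X in _ < X -> _](expr1n _ 2) ltr_pXn2r// ?nnegrE ?mulr_ge0 ?nrm_ge0// ?invr_ge0 ?ltW//.
by rewrite mulrC ltr_pdivrMr// mul1r.
Qed.

(* The projective change of parameter [s = w n^2 / (1 - w n m)] carries the tangent
   line [n + m s] to a constant. *)
Lemma osculation_normalize (v0 v1 : R * R) (c n m L q eps tgt : R) :
  v0 = (0, 1) -> v1 = (-1, 0) -> n = N (v0 + c *: v1) -> 0 < n -> 0 < L -> 0 < q ->
  (forall s : R, n + m * s <= N (v0 + (c + s) *: v1)) ->
  (forall s : R, `|s| <= q ->
    `|N (v0 + (c + s) *: v1) - n - m * s - L * s ^+ 2 / 2| <= eps / 12 * L * q ^+ 2) ->
  0 < eps -> tgt <= eps / 2 -> tgt <= 1 / 2 -> q * (`|m| / (2 * n)) <= tgt ->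
  exists (e k : R * R),
  [/\ e.1 * k.2 - e.2 * k.1 = 1, e.2 != 0, N e = 1, (forall w : R, 1 <= N (e + w *: k))
    & forall w : R, `|w| <= q / (2 * n ^+ 2) ->
      `|N (e + w *: k) - 1 - L * n ^+ 3 * w ^+ 2 / 2|
         <= eps * (L * n ^+ 3) * (q / (2 * n ^+ 2)) ^+ 2].
Proof.
move=> v0E v1E; subst v0 v1 => nE n_gt0 L_gt0 q0 ftan hq eps0 te th mq.
pose v0 : R * R := (0, 1); pose v1 : R * R := (-1, 0).
(* [e] is the unit vector at the contact point and [k] spans the tangent line there: subtracting
   [m *: e] turns the support line [n + m s] into the constant 1, and the factors [n] give
   [e x k = 1]. *)
pose e := n^-1 *: (v0 + c *: v1); pose k := n *: (v1 - m *: e).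
(* In the parameter [w] the curvature becomes [L n^3]; the 2 in [rho] keeps [s] within [q], as
   [1 - w n m >= 1 / 2]. *)
pose kap := L * n ^+ 3; pose rho := q / (2 * n ^+ 2).
have n2 : 0 < n ^+ 2 by rewrite exprn_gt0.
have n_neq0 : n != 0 by rewrite gt_eqF.
have rho_gt0 : 0 < rho by rewrite divr_gt0// mulr_gt0.
have kap0 : 0 < kap by rewrite mulr_gt0 ?exprn_gt0.
have Fe w : 0 < 1 - w * n * m ->
  N (e + w *: k) = (1 - w * n * m) / n * N (v0 + (c + w * n ^+ 2 / (1 - w * n * m)) *: v1).
  move=> J0; have J1 : 0 <= (1 - w * n * m) / n by rewrite divr_ge0 ?ltW.
  rewrite -[X in X * _](ger0_norm J1) -nrmZ; congr N.
  have J2 : 1 - w * n * m != 0 by rewrite gt_eqF.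
  by rewrite /e /k; congr (_, _); rewrite /= /GRing.scale/=; field; rewrite ?J2 ?n_neq0.
have Ne : N e = 1 by rewrite /e nrmZ gtr0_norm ?invr_gt0// -nE mulVf.
exists e, k; split => //.
- by rewrite /k /e /= /GRing.scale/=; field.
- by rewrite /e /= /GRing.scale/= mulr0 addr0 mulr1 invr_neq0.
- move=> w.
  have F1 z : 0 < 1 - z * n * m -> 1 <= N (e + z *: k).
    move=> J0; rewrite Fe//.
    have hh := ftan (z * n ^+ 2 / (1 - z * n * m)).
    have J1 : 0 <= (1 - z * n * m) / n by rewrite divr_ge0 ?ltW.
    have := ler_wpM2l J1 hh; apply: le_trans.
    rewrite le_eqVlt; apply/orP; left; apply/eqP; field; rewrite n_neq0 ?andbT//.
    by rewrite gt_eqF.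
  (* For a general [w] the bound is known at [t w]; convexity on the segment from [e], where
     [N e = 1], carries it out to [w]. *)
  pose t := (1 + `|w * n * m|)^-1.
  have t0 : 0 < t by rewrite invr_gt0 ltr_pwDl.
  have t1 : t <= 1 by rewrite invf_le1 ?lerDl// ltr_pwDl.
  have Jt : 0 < 1 - t * w * n * m.
    rewrite (_ : t * w * n * m = w * n * m / (1 + `|w * n * m|)); last by rewrite /t; ring.
    rewrite subr_gt0 ltr_pdivrMr ?ltr_pwDl// mul1r.
    by apply: le_lt_trans (ler_norm _) _; rewrite ltrDr.
  have := F1 _ Jt; rewrite -scalerA.
  have := @nrm_convex e (w *: k) t; rewrite (ltW t0) t1 Ne => /(_ isT) h1 h2.
  rewrite -(ler_pM2l t0); move: h1 h2.
  by move: (N _) (N _) => a b; clear; lra.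
move=> w wr; have J2 : `|w * n * m| <= tgt.
  apply: le_trans mq; rewrite !normrM (gtr0_norm n_gt0).
  apply: (@le_trans _ _ (rho * n * `|m|)).
    by rewrite ler_wpM2r// ler_pM2r.
  by rewrite /rho le_eqVlt; apply/orP; left; apply/eqP; field.
set J := 1 - w * n * m.
have [J0 J32 J12] : [/\ 0 < J, J <= 3 / 2 & 1 / 2 <= J].
  by move: J2 th; rewrite ler_norml /J; clear => /andP[? ?] ?; split; lra.
have J_neq0 : J != 0 by rewrite gt_eqF.
rewrite Fe// -/J.
set s := w * n ^+ 2 / J.
have sq : `|s| <= q.
  rewrite /s 2!normrM normfV (gtr0_norm J0) ler_pdivrMr// (gtr0_norm n2).
  apply: (@le_trans _ _ (rho * n ^+ 2)); first by rewrite ler_pM2r.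
  have -> : rho * n ^+ 2 = q * (1 / 2) by rewrite /rho; field.
  by rewrite ler_pM2l.
have := hq _ sq; set E := (X in `|X|) => hE; rewrite -/kap -/rho.
(* The first term is the distortion of the parameter, the second the osculation error. The 12
   absorbs [J <= 3 / 2] and [q^2 = 4 n^4 rho^2], so that each term takes half of [eps]. *)
have -> : J / n * N (v0 + (c + s) *: v1) - 1 - kap * w ^+ 2 / 2 =
   kap * w ^+ 2 / 2 * ((1 - J) / J) + J / n * E.
  rewrite /E /s /kap; move: (N _) J_neq0; rewrite /J => F J_neq0.
  by field; rewrite n_neq0 J_neq0.
have Jn : 0 <= J / n by rewrite divr_ge0 ?ltW.
have w2 : w ^+ 2 <= rho ^+ 2.
  by rewrite -(real_normK (num_real w)) ler_pXn2r ?nnegrE ?normr_ge0 ?(ltW rho_gt0).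
have JJ : `|(1 - J) / J| <= eps.
  rewrite normrM normfV (gtr0_norm J0) ler_pdivrMr//.
  have -> : `|1 - J| = `|w * n * m| by rewrite /J opprB addrC subrK.
  apply: le_trans J2 _; apply: le_trans te _.
  by rewrite ler_pM2l//; move: J12; rewrite mul1r.
have t1 : `|kap * w ^+ 2 / 2 * ((1 - J) / J)| <= kap * rho ^+ 2 / 2 * eps.
  rewrite normrM ler_pM// ger0_norm.
    by rewrite ler_pM2r// ler_pM2l.
  by rewrite divr_ge0// mulr_ge0 ?sqr_ge0// ltW.
have t2 : `|J / n * E| <= kap * rho ^+ 2 / 2 * eps.
  rewrite normrM (ger0_norm Jn).
  apply: (@le_trans _ _ (3 / 2 / n * (eps / 12 * L * q ^+ 2))).
    by rewrite ler_pM// ler_pM2r ?invr_gt0.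
  rewrite le_eqVlt; apply/orP; left; apply/eqP.
  have -> : q = rho * (2 * n ^+ 2) by rewrite /rho divfK// gt_eqF// mulr_gt0.
  by rewrite /kap; field.
apply: le_trans (ler_normD _ _) _; apply: le_trans (lerD t1 t2) _.
by rewrite le_eqVlt; apply/orP; left; apply/eqP; field.
Qed.

(** The line of points [(-s, 1)] avoids the origin. Along it the Lipschitz differential bounds the
    slopes, and strict convexity makes one of them positive. The conclusion [e.2 != 0] serves to
    factor the frame into shears. *)
Lemma norm_osculation (eps rho0 : R) : strictly_convex_norm N -> C11_norm N ->
  0 < eps -> 0 < rho0 ->
  exists (e k : R * R) (kap rho : R),
  [/\ e.1 * k.2 - e.2 * k.1 = 1 /\ e.2 != 0, 0 < kap, 0 < rho <= rho0 /\ kap * rho <= rho0,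
      N e = 1 /\ (forall w : R, 1 <= N (e + w *: k))
    & forall w : R, `|w| <= rho -> `|N (e + w *: k) - 1 - kap * w ^+ 2 / 2| <= eps * kap * rho ^+ 2].
Proof.
move=> sc c11 eps0 rho00.
pose v0 : R * R := (0, 1); pose v1 : R * R := (-1, 0).
have v00 : v0 != 0 by apply/eqP => -[/eqP]; rewrite oner_eq0.
have v10 : v1 != 0 by apply/eqP => -[/eqP]; rewrite oppr_eq0 oner_eq0.
pose f s := N (v0 + s *: v1); pose D s := 'd N (v0 + s *: v1) v1.
have vs0 s : v0 + s *: v1 != 0.
  by apply/eqP => -[_ /eqP]; rewrite [X in 1 + X]mulr0 addr0 oner_eq0.
have dN s : differentiable N (v0 + s *: v1) by have [] := c11 _ (vs0 s).
have df (s : R) : is_derive s 1 f (D s).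
  have E : (fun h : R => h^-1 *: (f (h *: 1 + s) - f s)) =
           (fun h : R => h^-1 *: (N (h *: v1 + (v0 + s *: v1)) - N (v0 + s *: v1))).
    apply/funext => h; congr (_ *: (N _ - _)).
    by rewrite [(_ *: 1)%R]mulr1 scalerDl addrCA.
  split; first by rewrite /derivable /= E; apply: diff_derivable.
  by rewrite /derive /= E /D -deriveE.
have ftan (c s : R) : f c + D c * s <= f (c + s).
  have := nrm_diff_le (s *: v1) (dN c); rewrite linearZ/= => h.
  by rewrite (mulrC (D c)) /f scalerDl addrA.
have Dle c : `|D c| <= N v1.
  have fle (s : R) : f (c + s) - f c <= `|s| * N v1.
    by rewrite lerBlDl /f scalerDl addrA -nrmZ nrmD.
  rewrite ler_norml; have := ftan c 1; have := ftan c (-1).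
  have := fle 1; have := fle (-1); rewrite normrN1 normr1 => *; apply/andP; split; lra.
have [_ _ [U Uv0 [k0 klip]]] := c11 _ v00.
have N1 := nrm_gt0 v10; have N0 := nrm_gt0 v00.
have [dU dU0 hU] : exists2 d : R, 0 < d & forall s, `|s| < d -> U (v0 + s *: v1).
  have /nbhs_ballP[d /= d0 hd] := Uv0.
  exists (d / `|v1|); first by rewrite divr_gt0 ?normr_gt0.
  move=> s sd; apply: hd; rewrite -ball_normE /ball_/= opprD addNKr normrN normrZ.
  by rewrite -ltr_pdivlMr ?normr_gt0.
(* Besides the Lipschitz bound, this range keeps [f] between [N v0 / 2] and [2 N v0], so that [n] is
   bounded both ways before the contact point is chosen. *)
pose delta := Num.min (dU / 2) (N v0 / (2 * N v1)).
have delta0 : 0 < delta by rewrite lt_min !divr_gt0// mulr_gt0.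
have deltaU : delta < dU by rewrite gt_min; apply/orP; left; lra.
have deltaN : delta * N v1 <= N v0 / 2.
  rewrite -ler_pdivlMr// ge_min; apply/orP; right.
  by rewrite [leRHS](_ : _ = N v0 / (2 * N v1))//; field; lra.
pose L0 := `|k0| * `|v1| ^+ 2.
have Dlip (s t : R) : - delta <= s -> s <= t -> t <= delta -> D t - D s <= L0 * (t - s).
  move=> ds st td.
  have Us : U (v0 + s *: v1) by apply: hU; rewrite ltr_norml; apply/andP; split; lra.
  have Ut : U (v0 + t *: v1) by apply: hU; rewrite ltr_norml; apply/andP; split; lra.
  have h : `|D t - D s| <= k0 * `|(v0 + t *: v1) - (v0 + s *: v1)| * `|v1| := klip _ _ v1 Ut Us.
  apply: le_trans (ler_norm _) _; apply: le_trans h _.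
  rewrite opprD addrACA subrr add0r -scalerBl normrZ.
  rewrite (ger0_norm (_ : 0 <= t - s)) ?subr_ge0//.
  rewrite (_ : L0 * (t - s) = `|k0| * ((t - s) * `|v1|) * `|v1|); last by rewrite /L0; ring.
  by rewrite !ler_wpM2r ?normr_ge0// ?mulr_ge0 ?normr_ge0 ?subr_ge0// ler_norm.
clearbody D.
(* The strict triangle inequality at [v0 + delta v1] and [v0 - delta v1] puts [f 0] below the mean
   of [f delta] and [f (- delta)]; the mean value theorem on each half gives the two derivatives. *)
have Dinc : exists s t : R, [/\ - delta <= s, s < t, t <= delta & D s < D t].
  have hlt : f 0 + f 0 < f delta + f (- delta).
    have := @nrm_strict_triangle (v0 + delta *: v1) (v0 + (- delta) *: v1) sc (vs0 _) (vs0 _).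
    rewrite addrACA -scalerDl subrr scale0r addr0 /f scale0r addr0.
    have -> : v0 + v0 = 2 *: v0 by rewrite scaler_nat mulr2n.
    rewrite nrmZ normr_nat mulr_natl mulr2n; apply.
    apply/eqP => -[]; rewrite /= !add0r => E _.
    have h1 (z : R) : 0 < (N (v0 + z *: v1))^-1 * delta.
      by rewrite mulr_gt0// invr_gt0 nrm_gt0.
    by have := h1 delta; have := h1 (- delta); move: E; rewrite /GRing.scale/=; clear; lra.
  have cf a b : {within `[a, b], continuous f}.
    by apply: derivable_within_continuous => r _; apply: ex_derive.
  have [t] := @MVT _ f D 0 delta delta0 (fun x _ => df x) (cf _ _).
  have Nd0 : - delta < 0 by rewrite oppr_lt0.
  have [s] := @MVT _ f D (- delta) 0 Nd0 (fun x _ => df x) (cf _ _).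
  rewrite !in_itv/= !subr0 sub0r opprK => /andP[s1 s2] fs /andP[t1 t2] ft.
  exists s, t; split; [exact: ltW | exact: lt_trans t1 | exact: ltW |].
  have h : f 0 - f (- delta) < f delta - f 0.
    by move: hlt; move: (f 0) (f delta) (f (- delta)) => ? ? ?; clear; lra.
  by move: h; rewrite fs ft ltr_pM2r.
pose n0 := N v0 / 2; pose M := 2 * N v0.
(* [C] majorises the three ratios through which [q] enters the smallness conditions, so that
   [q <= tgt / C] ensures them uniformly in the contact point. *)
pose C := (2 * n0 ^+ 2)^-1 + L0 * (M / 2) + N v1 / (2 * n0) + 1.
pose tgt := Num.min rho0 (Num.min (eps / 2) (1 / 2)).
have n00 : 0 < n0 by rewrite /n0; lra.
have L00 : 0 <= L0 by rewrite mulr_ge0 ?sqr_ge0.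
have tgt0 : 0 < tgt by rewrite !lt_min rho00/=; apply/andP; split; lra.
have [tr te th] : [/\ tgt <= rho0, tgt <= eps / 2 & tgt <= 1 / 2].
  by rewrite /tgt !ge_min !lexx !orbT.
have C1 : 0 <= (2 * n0 ^+ 2)^-1 by rewrite invr_ge0 mulr_ge0 ?sqr_ge0.
have C2 : 0 <= L0 * (M / 2) by rewrite mulr_ge0// divr_ge0// mulr_ge0// ltW.
have C3 : 0 <= N v1 / (2 * n0) by rewrite divr_ge0 ?mulr_ge0 ?ltW.
have [CC1 CC2 CC3 C0] : [/\ (2 * n0 ^+ 2)^-1 <= C, L0 * (M / 2) <= C,
    N v1 / (2 * n0) <= C & 1 <= C].
  by move: C1 C2 C3; rewrite /C; move: (_^-1) (_ * _) (_ / _) => a b d; clear; split; lra.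
have eta0 : 0 < tgt / C by rewrite divr_gt0// (lt_le_trans ltr01).
have etaC x : 0 <= x -> x <= C -> tgt / C * x <= tgt.
  move=> x0 xC; have CC : 0 < C by exact: lt_le_trans C0.
  by rewrite mulrAC ler_pdivrMr// ler_wpM2l// ltW.
have eps12 : 0 < eps / 12 by rewrite divr_gt0.
have [c [L [q [/andP[L_gt0 LL0] /andP[q0 qeta] cd hq]]]] :=
  almost_quadratic (fun s _ => df s) Dlip Dinc eps12 eta0.
pose n := f c; pose m := D c.
have [nn0 nM] : n0 <= n /\ n <= M.
  have cN : `|c| * N v1 <= N v0 / 2 by apply: le_trans deltaN; rewrite ler_wpM2r// ltW.
  rewrite /n /f /n0 /M; split.
    apply: le_trans (nrm_sub _ _); rewrite nrmZ; move: cN; clear.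
    by move: (N v0) (`|c| * _) => ? ?; lra.
  apply: le_trans (nrmD _ _) _; rewrite nrmZ; move: cN N0; clear.
  by move: (N v0) (`|c| * _) => ? ?; lra.
have n_gt0 : 0 < n by lra.
have mN : `|m| <= N v1 := Dle c.
have [h1 [h2 h3]] : q / (2 * n ^+ 2) <= rho0 /\
    (L * n ^+ 3 * (q / (2 * n ^+ 2)) <= rho0 /\ q * (`|m| / (2 * n)) <= tgt).
  have h1 : q / (2 * n ^+ 2) <= tgt / C * (2 * n0 ^+ 2)^-1.
    apply: ler_pM => //; [exact: ltW | by rewrite invr_ge0 mulr_ge0 ?sqr_ge0 |].
    rewrite lef_pV2 ?posrE ?mulr_gt0 ?exprn_gt0// ler_pM2l//.
    by rewrite ler_pXn2r ?nnegrE// ltW.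
  have h2 : L * n ^+ 3 * (q / (2 * n ^+ 2)) <= tgt / C * (L0 * (M / 2)).
    have -> : L * n ^+ 3 * (q / (2 * n ^+ 2)) = q * (L * (n / 2)).
      by field; rewrite gt_eqF.
    apply: ler_pM => //; [exact: ltW|by rewrite mulr_ge0// ?divr_ge0// ltW|].
    by apply: ler_pM => //; [exact: ltW|by rewrite divr_ge0// ltW|rewrite ler_pM2r].
  have h3 : q * (`|m| / (2 * n)) <= tgt / C * (N v1 / (2 * n0)).
    apply: ler_pM => //; [exact: ltW|by rewrite divr_ge0// mulr_ge0// ltW|].
    apply: ler_pM => //; first by rewrite invr_ge0 mulr_ge0// ltW.
    by rewrite lef_pV2 ?posrE ?mulr_gt0// ler_pM2l.
  split; last split.
  - by apply: le_trans h1 _; apply: le_trans tr; apply: etaC.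
  - by apply: le_trans h2 _; apply: le_trans tr; apply: etaC.
  - by apply: le_trans h3 _; apply: etaC.
have [e [k [ek e2 Ne F1 F2]]] := osculation_normalize (erefl v0) (erefl v1) (erefl n) n_gt0
  L_gt0 q0 (ftan c) hq eps0 te th h3.
exists e, k, (L * n ^+ 3), (q / (2 * n ^+ 2)); split => //.
- by rewrite mulr_gt0 ?exprn_gt0.
- by split => //; rewrite h1 divr_gt0// mulr_gt0 ?exprn_gt0.
Qed.

End norm.

(* Coordinates of a point adapted to a basis [(e, k)] with [e x k = 1]. In terms of
   them [X1] and [X2] read [d_x - y d_w] and [d_y]. *)
Section coordinates.
Context {R : realType}.
Implicit Types (e k v : R * R) (p : heis R).

Definition cx k v : R := v.1 * k.2 - v.2 * k.1.
Definition cy e v : R := e.1 * v.2 - e.2 * v.1.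
Definition cw e k p : R := p.2 - cx k p.1 * cy e p.1 / 2.

Lemma cxcyE e k v : e.1 * k.2 - e.2 * k.1 = 1 -> v = cx k v *: e + cy e v *: k.
Proof.
move=> ek; case: v => a b; rewrite /cx /cy; congr (_, _); rewrite /= /GRing.scale/=.
  by rewrite -[LHS]mulr1 -ek; ring.
by rewrite -[LHS]mulr1 -ek; ring.
Qed.

Lemma cx_comb e k (x y : R) : e.1 * k.2 - e.2 * k.1 = 1 -> cx k (x *: e + y *: k) = x.
Proof. by move=> ek; rewrite /cx /= /GRing.scale/= -[RHS]mulr1 -ek; ring. Qed.

Lemma cy_comb e k (x y : R) : e.1 * k.2 - e.2 * k.1 = 1 -> cy e (x *: e + y *: k) = y.
Proof. by move=> ek; rewrite /cy /= /GRing.scale/= -[RHS]mulr1 -ek; ring. Qed.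

End coordinates.

(** * Measurability of the norm *)

Section meas.
Context {R : realType}.

Lemma measurable_inv : measurable_fun setT (fun x : R => x^-1).
Proof.
rewrite (_ : setT = [set 0 : R] `|` ~` [set 0]); last first.
  by apply/seteqP; split => x // _; have [|] := pselect (x = 0); [left|right].
have m0 : measurable [set 0 : R] by exact: measurable_set1.
apply/measurable_funU => //; first exact: measurableC.
split; first exact: measurable_fun_set1.
apply: open_continuous_measurable_fun.
  rewrite (_ : ~` [set 0] = `]-oo, (0 : R)[ `|` `](0 : R), +oo[).
    by apply: openU; apply: interval_open.
  apply/seteqP; split => x /=; rewrite !in_itv/= andbT.
    by move=> /eqP; rewrite neq_lt => /orP[]; [left|right].
  by move=> + x0; rewrite x0 ltxx => -[].
move=> x /set_mem/eqP x0; exact: inv_continuous.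
Qed.

Variables (N : R * R -> R) (hN : is_norm N).

(** By homogeneity [N (a, b) = |a| N (1, b / a)] for nonzero [a], which reduces measurability on the
    product to the continuity of a function of one variable. *)
Lemma measurable_nrm : measurable_fun setT N.
Proof.
have cf : continuous (fun w : R => N (1, w)).
  move=> w; apply/cvgrPdist_le => a a0.
  have N1 := nrm_ge0 hN (0, 1).
  have C0 : 0 < N (0, 1) + 1 by lra.
  near=> z.
  have zw : `|w - z| <= a / (N (0, 1) + 1).
    by near: z; apply: cvgr_dist_le => //; rewrite divr_gt0.
  have h (x y : R) : N (1, x) - N (1, y) <= `|x - y| * N (0, 1).
    rewrite lerBlDl; apply: le_trans (_ : N ((1, y) + (x - y) *: (0, 1)) <= _).
      rewrite le_eqVlt; apply/orP; left; apply/eqP; congr N.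
      by congr (_, _); rewrite /= /GRing.scale/= ?mulr0 ?mulr1 ?addr0 ?subrKC.
    by rewrite -(nrmZ hN); exact: (nrmD hN).
  have := h w z; have := h z w; rewrite (distrC z w).
  have : `|w - z| * N (0, 1) <= a.
    move: zw; rewrite ler_pdivlMr// mulrDr mulr1; have := normr_ge0 (w - z); lra.
  by move=> *; rewrite ler_norml; apply/andP; split; lra.
pose n0 (v : R * R) := if v.1 == 0 then `|v.2| * N (0, 1) else `|v.1| * N (1, v.2 * v.1^-1).
have -> : N = n0.
  apply/funext => -[a b]; rewrite /n0 /=; case: eqP => [->|/eqP a0]; rewrite -(nrmZ hN).
    by congr N; congr (_, _); rewrite /= /GRing.scale/= ?mulr0 ?mulr1.
  congr N; congr (_, _); rewrite /= /GRing.scale/= ?mulr1//.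
  by rewrite mulrCA mulfV ?mulr1.
have mi : measurable_fun setT (fun v : R * R => v.2 * v.1^-1).
  apply: measurable_funM; first exact: measurable_snd.
  by apply: (measurableT_comp measurable_inv); exact: measurable_fst.
have mn : measurable_fun setT (fun x : R => `|x|) by exact: normr_measurable.
apply: measurable_fun_ifT.
- by apply: measurable_fun_eqr; [exact: measurable_fst|exact: measurable_cst].
- apply: measurable_funM; last exact: measurable_cst.
  by apply: (measurableT_comp mn); exact: measurable_snd.
- apply: measurable_funM.
    by apply: (measurableT_comp mn); exact: measurable_fst.
  have mc : measurable_fun setT (fun w : R => N (1, w)) by exact: continuous_measurable_fun.
  exact: (measurableT_comp mc mi).
Unshelve. all: by end_near.
Qed.

End meas.

(** * Functions that are Lipschitz along an absolutely continuous curve *)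

Section lip_along.
Context {R : realType} {V : normedModType R}.
Variable G : R -> V.

(* Boundedness is built in so that products stay in the class. *)
Definition lip_along (phi : R -> R) := exists2 C : R, 0 <= C &
  forall s t : R, 0 <= s <= 1 -> 0 <= t <= 1 ->
    `|phi t - phi s| <= C * `|G t - G s| /\ `|phi t| <= C.

Lemma lip_along_cst (c : R) : lip_along (fun=> c).
Proof.
exists `|c| => // s t _ _; split=> //; by rewrite subrr normr0 mulr_ge0.
Qed.

Lemma lip_alongD (f g : R -> R) :
  lip_along f -> lip_along g -> lip_along (fun t => f t + g t).
Proof.
move=> [C C0 hC] [D D0 hD]; exists (C + D); first exact: addr_ge0.
move=> s t s1 t1; have [h1 h2] := hC _ _ s1 t1; have [h3 h4] := hD _ _ s1 t1; split.
  by rewrite opprD addrACA mulrDl; apply: le_trans (ler_normD _ _) _; exact: lerD.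
by apply: le_trans (ler_normD _ _) _; exact: lerD.
Qed.

Lemma lip_alongM (f g : R -> R) :
  lip_along f -> lip_along g -> lip_along (fun t => f t * g t).
Proof.
move=> [C C0 hC] [D D0 hD]; exists (2 * C * D); first by rewrite !mulr_ge0.
move=> s t s1 t1; have [h1 h2] := hC _ _ s1 t1; have [h3 h4] := hD _ _ s1 t1.
have [_ h5] := hC _ _ s1 s1.
have CD := mulr_ge0 C0 D0; split; last first.
  by rewrite normrM; apply: le_trans (ler_pM _ _ h2 h4) _ => //; lra.
have -> : f t * g t - f s * g s = (f t - f s) * g t + f s * (g t - g s) by ring.
apply: le_trans (ler_normD _ _) _; rewrite !normrM.
have := ler_pM (normr_ge0 _) (normr_ge0 _) h1 h4.
have := ler_pM (normr_ge0 _) (normr_ge0 _) h5 h3.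
by nra.
Qed.

Lemma lip_alongN (f : R -> R) : lip_along f -> lip_along (fun t => - f t).
Proof.
move=> [C C0 hC]; exists C => // s t s1 t1; have [h1 h2] := hC _ _ s1 t1.
by rewrite -opprD !normrN.
Qed.

Lemma lip_alongX (f : R -> R) n : lip_along f -> lip_along (fun t => f t ^+ n).
Proof.
move=> lf; elim: n => [|n IH]; first exact: lip_along_cst.
by under eq_fun do rewrite exprS; exact: lip_alongM.
Qed.

Lemma lip_along_ac (phi : R -> R) :
  abs_continuous 0 1 G -> lip_along phi -> abs_continuous 0 1 phi.
Proof.
move=> acG [C C0 hC] e e0.
have C1 : 0 < C + 1 by lra.
have [d d0 hd] := acG _ (divr_gt0 e0 C1).
exists d => // n s t st tri lenst.
have := hd n s t st tri lenst; rewrite ltr_pdivlMr// mulr_suml; apply: le_lt_trans.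
apply: ler_sum => i _; have [/andP[h1 h2] h3] := st i.
have [||h4 _] := hC (s i) (t i); try by apply/andP; split; lra.
by apply: le_trans h4 _; rewrite mulrC ler_wpM2l//; lra.
Qed.

(** Real induction chains time steps shorter than [d], over each of which the curve moves by less
    than 1. The bound puts the coordinates of a curve in the class [lip_along]. *)
Lemma ac_bounded : abs_continuous 0 1 G ->
  exists M : R, forall t : R, 0 <= t <= 1 -> `|G t| <= M.
Proof.
move=> acG; have [d d0 hd] := acG 1 ltr01.
have step (s t : R) : 0 <= s -> s <= t -> t <= 1 -> t - s < d -> `|G t - G s| < 1.
  move=> s0 st t1 std.
  have := hd 1%N (fun=> s) (fun=> t); rewrite !big_ord1; apply=> //.
    by move=> _; split => //; apply/andP.
  by apply/trivIsetP => i j _ _; rewrite (ord1 i) (ord1 j) eqxx.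
apply: (@straddle_induction _ (fun b => exists M : R, forall t : R, 0 <= t <= b -> `|G t| <= M) 0 1) => //.
  by exists `|G 0| => t t0; rewrite (_ : t = 0)//; lra.
move=> c c01; exists (d / 2); first lra.
move=> s t /andP[s0 sc] /andP[ct t1] cs tc [M hM].
exists (Num.max M (`|G s| + 1)) => r /andP[r0 rt]; rewrite le_max.
have [rs|sr] := leP r s; first by rewrite hM// r0.
apply/orP; right; rewrite -lerBlDl; apply: le_trans (ler_norm _) _.
apply: le_trans (ler_dist_dist _ _) _.
by apply/ltW/step; lra.
Qed.

End lip_along.

(** * Calibrations and the confinement of midpoints *)

Section calibration.
Context {R : realType}.
Implicit Types H L x y w u ya wa yb wb : R.

(* The calibration attached to the extremals [y' = H + L x]: if the norm osculates the
   parabola [x + kap y^2 / (2 x)] up to [E], then [(1 - E) x + kap * qf H L x y w] grows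
   along any curve no faster than its length. *)
Definition qf H L x y w :=
  - (H ^+ 2 * x + H * L * x ^+ 2 + L ^+ 2 * x ^+ 3 / 3) / 2 + (H + L * x) * y + L * w.

Lemma normM_le (a b A B : R) : `|a| <= A -> `|b| <= B -> `|a * b| <= A * B.
Proof. by move=> h1 h2; rewrite normrM ler_pM. Qed.

Lemma normD_le (a b A B : R) : `|a| <= A -> `|b| <= B -> `|a + b| <= A + B.
Proof. by move=> h1 h2; rewrite (le_trans (ler_normD _ _))// lerD. Qed.

Lemma qf_scale (r H L x y w : R) : qf (r * H) (r * L) x (r * y) (r * w) = r ^+ 2 * qf H L x y w.
Proof. by rewrite /qf; field. Qed.

Lemma qf_opp H L x y w : qf H L (- x) y w = - qf H (- L) x (- y) w.
Proof. by rewrite /qf; field. Qed.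

(** Moves an end of the segment to exactly [x = 1]. In the rescaled boxes [|y| <= 10], and the
    optimal parabola has [|H| <= 10] and [|L| <= 18]; 11 and 19 leave room to vary both. *)
Lemma qf_near1 H L u y w : `|H| <= 11 -> `|L| <= 19 -> `|y| <= 10 -> `|u| <= 1 / 10 ->
  `|qf H L (1 + u) y w - qf H L 1 y w| <= 800 * `|u|.
Proof.
move=> h l hy hu.
have -> : qf H L (1 + u) y w - qf H L 1 y w =
   (- (H * H + H * L * (2 + u) + L * L * (1 + u + u * u / 3)) / 2 + L * y) * u.
  by rewrite /qf; field.
rewrite normrM ler_wpM2r//.
have b1 := normM_le h h; have b2 := normM_le h l; have b3 := normM_le l l.
have b4 := normM_le l hy; have b5 := normM_le hu hu.
have b6 : `|2 + u| <= 21 / 10 by move: hu; rewrite !ler_norml; clear => /andP[? ?]; apply/andP; split; lra.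
have b7 : `|1 + u + u * u / 3| <= 12 / 10.
  by move: hu b5; rewrite !ler_norml; clear => /andP[? ?] /andP[? ?]; apply/andP; split; lra.
have b8 := normM_le b2 b6; have b9 := normM_le b3 b7.
move: b1 b4 b8 b9; rewrite !ler_norml; clear => /andP[? ?] /andP[? ?] /andP[? ?] /andP[? ?].
by apply/andP; split; lra.
Qed.

Lemma qf_nearN1 H L u y w : `|H| <= 11 -> `|L| <= 19 -> `|y| <= 10 -> `|u| <= 1 / 10 ->
  `|qf H L (- 1 + u) y w - qf H L (- 1) y w| <= 800 * `|u|.
Proof.
move=> h l hy hu.
have -> : -1 + u = - (1 + - u) by ring.
rewrite !qf_opp -opprD normrN; have := @qf_near1 H (- L) (- u) (- y) w.
by rewrite !normrN; apply.
Qed.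

Lemma kinetic_near (X dy s dw r : R) : 0 < r <= 1 / 1000 -> `|X - 2| <= 2 * r ->
  `|dy| <= 20 -> `|s + dw| <= 12 -> `|dw| <= 8 ->
  (dy ^+ 2 + (3 * s + 6 * dw / X) ^+ 2 / 3) / (2 * X)
    <= (dy ^+ 2 + (3 * (s + dw)) ^+ 2 / 3) / 4 + 600 * r.
Proof.
move=> /andP[r0 r1] hX hdy hs hdw.
have X1 : 19 / 10 <= X by move: hX r1; rewrite ler_norml; clear => /andP[? ?] ?; lra.
have X0 : 0 < X by apply: lt_le_trans X1; lra.
pose z := X^-1 - 1 / 2.
have hz : `|z| <= 6 / 10 * r.
  have -> : z = (2 - X) / (2 * X) by rewrite /z; field; rewrite gt_eqF.
  rewrite normrM normfV (gtr0_norm (_ : 0 < 2 * X)) ?mulr_gt0// ler_pdivrMr ?mulr_gt0//.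
  rewrite distrC; apply: le_trans hX _.
  by have := ler_wpM2l (ltW r0) X1; move: r0; clear; lra.
have -> : (dy ^+ 2 + (3 * s + 6 * dw / X) ^+ 2 / 3) / (2 * X) =
   (dy * dy + (3 * (s + dw) + 6 * (dw * z)) * (3 * (s + dw) + 6 * (dw * z)) / 3) * (1 / 4 + z / 2).
  by rewrite /z; field; rewrite gt_eqF.
have -> : (3 * (s + dw)) ^+ 2 = 9 * ((s + dw) * (s + dw)) by ring.
set g := s + dw in hs *; clearbody g.
have b1 := normM_le hdy hdy; have b2 := normM_le hs hs.
have b3 := normM_le hdw hz.
have b4 := normM_le hs b3; have b5 := normM_le b3 b3.
have b6 : `|dy * dy + (3 * g + 6 * (dw * z)) * (3 * g + 6 * (dw * z)) / 3| <= 1000.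
  have -> : dy * dy + (3 * g + 6 * (dw * z)) * (3 * g + 6 * (dw * z)) / 3 =
    dy * dy + 3 * (g * g) + 12 * (g * (dw * z)) + 12 * (dw * z * (dw * z)) by field.
  have b7 : 8 * (6 / 10 * r) * (8 * (6 / 10 * r)) <= 8 * (6 / 10 * r).
    by rewrite -[leRHS]mulr1 ler_wpM2l//; move: r0 r1; clear; lra.
  move: b1 b2 b4 b5 b7 r1; rewrite !ler_norml; clear.
  by move=> /andP[? ?] /andP[? ?] /andP[? ?] /andP[? ?] ? ?; apply/andP; split; lra.
have b8 := normM_le b6 hz.
have b7 : 8 * (6 / 10 * r) * (8 * (6 / 10 * r)) <= 8 * (6 / 10 * r).
  by rewrite -[leRHS]mulr1 ler_wpM2l//; move: r0 r1; clear; lra.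
move: b8 b4 b5 b7 r0; rewrite !ler_norml; clear.
by move=> /andP[? ?] /andP[? ?] /andP[? ?] ? ?; lra.
Qed.

(* The minimum of [int y'^2 / 2] over the graphs on an interval of length [X] with the
   prescribed variations of [y] and of [w = - int y]; it is attained by a parabola. *)
Definition kinetic ya wa yb wb (X : R) : R :=
  ((yb - ya) ^+ 2 + (3 * (ya + yb) + 6 * (wb - wa) / X) ^+ 2 / 3) / (2 * X).

(** With [g2 = y - 2 w] and [g3 = y - 3 w] one has [y = 3 g2 - 2 g3], [w = g2 - g3] and
    [y - w = 2 g2 - g3], which gives the five constants; at the target [w] changes sign. *)
Lemma endpoint_bounds ya wa yb wb :
  `|ya - 3 * wa| <= 2 -> `|ya - 2 * wa| <= 2 -> `|yb + 3 * wb| <= 2 -> `|yb + 2 * wb| <= 2 ->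
  [/\ `|ya| <= 10, `|yb| <= 10, `|yb - ya| <= 20, `|ya + yb + (wb - wa)| <= 12
    & `|wb - wa| <= 8].
Proof.
rewrite !ler_norml => /andP[? ?] /andP[? ?] /andP[? ?] /andP[? ?].
by split; apply/andP; split; lra.
Qed.

Lemma kinetic_le_main (r u v : R) ya wa yb wb : 0 < r <= 1 / 1000 / 100 ->
  `|u| <= r -> `|v| <= r ->
  `|ya - 3 * wa| <= 2 -> `|ya - 2 * wa| <= 2 -> `|yb + 3 * wb| <= 2 -> `|yb + 2 * wb| <= 2 ->
  kinetic ya wa yb wb (2 + u - v)
    <= ((yb - ya) ^+ 2 + (3 * (ya + yb + (wb - wa))) ^+ 2 / 3) / 4 + 600 * r.
Proof.
move=> r01 ur vr a3 a2 b3 b2; have [_ _ h1 h2 h3] := endpoint_bounds a3 a2 b3 b2.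
apply: kinetic_near => //.
  by move: r01; clear => /andP[? ?]; apply/andP; split; lra.
by move: ur vr; rewrite !ler_norml; clear => /andP[? ?] /andP[? ?]; apply/andP; split; lra.
Qed.

(** Let [H + L x] be the slope of the optimal parabola. The first half is calibrated with
    [(H + th, L + ph)], the second with [(H - th, L - ph)]. For [ph = 0] the two bounds add up to
    the minimal action plus [2 th] times the deviation of [y] from the parabola, minus [th^2]. As
    the sum cannot exceed the action by more than the error, the two signs of [th] bound the
    deviation; [ph] does the same for [w]. *)
Lemma midpoint_scaled (r u v s ya wa yb wb y w : R) :
  0 < r <= 1 / 1000 / 100 -> `|u| <= r -> `|v| <= r -> `|s| <= 5 / 4 * r ->
  `|ya - 3 * wa| <= 2 -> `|ya - 2 * wa| <= 2 -> `|yb + 3 * wb| <= 2 -> `|yb + 2 * wb| <= 2 ->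
  (forall H1 L1 H2 L2, `|H1| <= 11 -> `|L1| <= 19 -> `|H2| <= 11 -> `|L2| <= 19 ->
    qf H1 L1 s y w - qf H1 L1 (-1 + v) ya wa + (qf H2 L2 (1 + u) yb wb - qf H2 L2 s y w)
      <= kinetic ya wa yb wb (2 + u - v) + 1 / 50) ->
  `|y| <= 5 / 4 /\ `|w| <= 5 / 4.
Proof.
move=> r01 ur vr sr a3 a2 b3 b2 key.
have [hya hyb hdy hs hdw] := endpoint_bounds a3 a2 b3 b2.
have kin := kinetic_le_main r01 ur vr a3 a2 b3 b2.
set dy := yb - ya in hdy kin; set dw := wb - wa in hs hdw kin.
set main := (_ / 4) in kin.
have [r0 r1] := andP r01.
have uv10 (z : R) : `|z| <= r -> `|z| <= 1 / 10 by move: r1; clear; lra.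
pose H := dy / 2; pose L := 3 / 2 * (ya + yb + dw).
have hH : `|H| <= 10 by move: hdy; rewrite /H !ler_norml; clear => /andP[? ?]; apply/andP; split; lra.
have hL : `|L| <= 18 by move: hs; rewrite /L !ler_norml; clear => /andP[? ?]; apply/andP; split; lra.
(* 2200 is 600 for the action over an interval of length [2 + u - v] instead of 2, and 800 for each
   of the two moved ends. *)
have gen (th ph : R) : `|th| <= 1 / 4 -> `|ph| <= 1 / 4 ->
   qf (H + th) (L + ph) s y w - qf (H - th) (L - ph) s y w +
   (qf (H - th) (L - ph) 1 yb wb - qf (H + th) (L + ph) (-1) ya wa) <= main + 1 / 50 + 2200 * r.
  move=> hth hph.
  have c1 : `|H + th| <= 11.
    by move: hH hth; rewrite !ler_norml; clear => /andP[? ?] /andP[? ?]; apply/andP; split; lra.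
  have c2 : `|H - th| <= 11.
    by move: hH hth; rewrite !ler_norml; clear => /andP[? ?] /andP[? ?]; apply/andP; split; lra.
  have c3 : `|L + ph| <= 19.
    by move: hL hph; rewrite !ler_norml; clear => /andP[? ?] /andP[? ?]; apply/andP; split; lra.
  have c4 : `|L - ph| <= 19.
    by move: hL hph; rewrite !ler_norml; clear => /andP[? ?] /andP[? ?]; apply/andP; split; lra.
  have := key _ _ _ _ c1 c3 c2 c4; have := kin.
  have := qf_near1 wb c2 c4 hyb (uv10 _ ur); have := qf_nearN1 wa c1 c3 hya (uv10 _ vr).
  move: (qf _ _ _ _ _) (qf _ _ _ _ _) (qf _ _ _ _ _) (qf _ _ _ _ _) (qf _ _ _ _ _) (qf _ _ _ _ _).
  move: ur vr r0 => ur' vr' r0' q1 q2 q3 q4 q5 q6.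
  rewrite !ler_norml => /andP[n1 n2] /andP[n3 n4]; move: n1 n2 n3 n4 ur' vr' r0'.
  by move: (main) (kinetic _ _ _ _ _) (`|u|) (`|v|) => M K U V; clear; lra.
have Hs := normM_le hH sr; have ss := normM_le sr sr; have Lss := normM_le hL ss.
have Hss := normM_le hH ss; have sss := normM_le sr ss; have Lsss := normM_le hL sss.
have rr : r * r <= r * (1 / 1000 / 100) by rewrite ler_pM2l//; move: r1; clear; lra.
have rrr : r * (r * r) <= r * (1 / 1000 / 100).
  apply: le_trans (_ : r * (1 * r) <= _); last by rewrite mul1r.
  by rewrite ler_pM2l// ler_pM2r//; move: r1; clear; lra.
(* On the exact parabola the value is at most 1. Taking [th] equal to [1 / 4] and [- (1 / 4)] adds
   [|th| / 2] and the error divided by [2 |th|], in all less than [1 / 4]. *)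
have hy : `|y| <= 5 / 4.
  have g0 : `|0 : R| <= 1 / 4 by rewrite normr0; clear; lra.
  have id1 (th : R) : qf (H + th) (L + 0) s y w - qf (H - th) (L - 0) s y w +
     (qf (H - th) (L - 0) 1 yb wb - qf (H + th) (L + 0) (-1) ya wa) =
     main + 2 * th * (y - H * s - L * (s * s) / 2) - th ^+ 2
       + th * (1 / 4 * (ya - 3 * wa) + 1 / 4 * (yb + 3 * wb)) * 2.
    by rewrite /qf /main /H /L /dy /dw; field.
  have p1 : `|1 / 4 : R| <= 1 / 4 by rewrite ger0_norm//; clear; lra.
  have p2 : `|- (1 / 4) : R| <= 1 / 4 by rewrite normrN.
  have := gen _ _ p1 g0; rewrite id1; have := gen _ _ p2 g0; rewrite id1.
  move: Hs Lss a3 b3 rr r1 r0; rewrite !ler_norml.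
  move: (main) (H * s) (L * (s * s)) => M A B; clear.
  move=> /andP[? ?] /andP[? ?] /andP[? ?] /andP[? ?] ? ? ? ? ?.
  by apply/andP; split; lra.
split => //.
have g0 : `|0 : R| <= 1 / 4 by rewrite normr0; clear; lra.
have id1 (ph : R) : qf (H + 0) (L + ph) s y w - qf (H - 0) (L - ph) s y w +
   (qf (H - 0) (L - ph) 1 yb wb - qf (H + 0) (L + ph) (-1) ya wa) =
   main + 2 * ph * (w + s * y - H * (s * s) / 2 - L * (s * (s * s)) / 3) - ph ^+ 2 / 3
     - ph * (1 / 2 * (yb + 2 * wb) - 1 / 2 * (ya - 2 * wa)).
  by rewrite /qf /main /H /L /dy /dw; field.
have p1 : `|1 / 4 : R| <= 1 / 4 by rewrite ger0_norm//; clear; lra.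
have p2 : `|- (1 / 4) : R| <= 1 / 4 by rewrite normrN.
have sy := normM_le sr hy.
have := gen _ _ g0 p1; rewrite id1; have := gen _ _ g0 p2; rewrite id1.
move: Hss Lsss sy a2 b2 rr rrr r1 r0; rewrite !ler_norml.
move: (main) (H * (s * s)) (L * (s * (s * s))) (s * y) => M A B C; clear.
move=> /andP[? ?] /andP[? ?] /andP[? ?] /andP[? ?] /andP[? ?] ? ? ? ? ? ?.
by apply/andP; split; lra.
Qed.

End calibration.

(** * Midpoints at the scale of the boxes *)

Section midpoint.
Context {R : realType}.

(** The lengths of order 1 cancel: [U] and the sum of the two calibrations both contain [X], up to
    [2 X E], which is at most [kap r^2 / 50]. What remains, divided by [kap r^2], is
    [midpoint_scaled]. The bound on [xp] is derived before that, from the halved distances alone,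
    since the calibrations are available only for [xp] near 0. *)
Lemma midpoint_box (r kap E xa ya wa xb yb wb xp yp wp : R) :
  0 < r <= 1 / 1000 / 100 -> 0 < kap -> kap * r <= 1 / 1000 / 100 ->
  0 <= E <= kap * r ^+ 2 / 250 ->
  `|xa + 1| <= r -> `|ya - 3 * wa| <= 2 * r -> `|ya - 2 * wa| <= 2 * r ->
  `|xb - 1| <= r -> `|yb + 3 * wb| <= 2 * r -> `|yb + 2 * wb| <= 2 * r ->
  let X := xb - xa in
  let U := X * (1 + E) + kap * kinetic ya wa yb wb X in
  xp - xa <= U / 2 -> xb - xp <= U / 2 ->
  (`|xp| <= 2 * r -> forall H L, `|H| <= 11 * r -> `|L| <= 19 * r ->
     (1 - E) * (xp - xa) + kap * (qf H L xp yp wp - qf H L xa ya wa) <= U / 2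
  /\ (1 - E) * (xb - xp) + kap * (qf H L xb yb wb - qf H L xp yp wp) <= U / 2) ->
  [/\ `|xp| <= 5 / 4 * r, `|yp| <= 5 / 4 * r & `|wp| <= 5 / 4 * r].
Proof.
move=> r01 kap0 kr /andP[E0 hE] hxa ha3 ha2 hxb hb3 hb2 X U d1 d2 hF.
have [r0 r1] := andP r01; have r_neq0 : r != 0 by rewrite gt_eqF.
pose v := xa + 1; pose u := xb - 1.
have XE : X = 2 + u - v by rewrite /X /u /v; ring.
have X12 : 1 <= X <= 3.
  by move: hxa hxb r1; rewrite /X !ler_norml; clear => /andP[? ?] /andP[? ?] ?; apply/andP; split; lra.
have X_neq0 : X != 0 by rewrite gt_eqF//; case/andP: X12 => ? _; apply: lt_le_trans ltr01 _.
have sc (z c : R) : `|z| <= c * r -> `|z / r| <= c.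
  by move=> zc; rewrite normrM normfV (gtr0_norm r0) ler_pdivrMr.
have a3 : `|ya / r - 3 * (wa / r)| <= 2 by apply: le_trans (sc _ _ ha3); rewrite mulrA -mulrBl.
have a2 : `|ya / r - 2 * (wa / r)| <= 2 by apply: le_trans (sc _ _ ha2); rewrite mulrA -mulrBl.
have b3 : `|yb / r + 3 * (wb / r)| <= 2 by apply: le_trans (sc _ _ hb3); rewrite mulrA -mulrDl.
have b2 : `|yb / r + 2 * (wb / r)| <= 2 by apply: le_trans (sc _ _ hb2); rewrite mulrA -mulrDl.
pose Kin := kinetic (ya / r) (wa / r) (yb / r) (wb / r) (2 + u - v).
have UE : U = X * (1 + E) + kap * r ^+ 2 * Kin.
  by rewrite /U /Kin /kinetic -XE; field; rewrite ?r_neq0 ?X_neq0.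
have K0 : Kin <= 300.
  apply: le_trans (kinetic_le_main r01 hxb hxa a3 a2 b3 b2) _.
  have [_ _ h1 h2 _] := endpoint_bounds a3 a2 b3 b2.
  have := normM_le h1 h1; have := normM_le h2 h2; move: r1; rewrite !expr2 !ler_norml.
  by move: (_ - ya / r) (ya / r + _ + _) => A B; clear => ? /andP[? ?] /andP[? ?]; lra.
have kr0 : 0 <= kap * r ^+ 2 by rewrite mulr_ge0 ?sqr_ge0 ?ltW.
have kr2 : kap * r ^+ 2 <= r * (1 / 1000 / 100).
  by rewrite expr2 mulrA mulrC ler_pM2l.
have kK : kap * r ^+ 2 * Kin <= r * (1 / 1000 / 100) * 300.
  apply: le_trans (ler_wpM2l kr0 K0) _; rewrite ler_wpM2r//.
have XEr : X * E <= 3 * (r * (1 / 1000 / 100)).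
  apply: ler_pM => //; [by case/andP: X12 => ? _; apply: le_trans ler01 _|by case/andP: X12|].
  by move: hE kr2 kr0; clear; lra.
have hx : `|xp| <= 5 / 4 * r.
  move: d1 d2 hxa hxb; rewrite UE mulrDr mulr1 !ler_norml /X; move: kK XEr r0.
  move: (kap * _ * _) (X * E) => A B; rewrite /X; clear => ? ? ? ? ? /andP[? ?] /andP[? ?].
  by apply/andP; split; lra.
have hx2 : `|xp| <= 2 * r by apply: le_trans hx _; move: r0; clear; lra.
have hs := hF hx2.
suff [hy hw] : `|yp / r| <= 5 / 4 /\ `|wp / r| <= 5 / 4.
  split => //.
    by move: hy; rewrite normrM normfV (gtr0_norm r0) ler_pdivrMr.
  by move: hw; rewrite normrM normfV (gtr0_norm r0) ler_pdivrMr.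
apply: (@midpoint_scaled _ r u v xp (ya / r) (wa / r) (yb / r) (wb / r)) => //.
move=> H1 L1 H2 L2 h1 l1 h2 l2; rewrite -/Kin.
have sc' (z c : R) : `|z| <= c -> `|r * z| <= c * r.
  by move=> zc; rewrite normrM (gtr0_norm r0) mulrC ler_wpM2r// ltW.
have [k1 _] := hs _ _ (sc' _ _ h1) (sc' _ _ l1).
have [_ k2] := hs _ _ (sc' _ _ h2) (sc' _ _ l2).
have rK z : r * (z / r) = z by rewrite mulrCA mulfV ?mulr1.
have qs H L x y w : qf (r * H) (r * L) x y w = r ^+ 2 * qf H L x (y / r) (w / r).
  by rewrite -qf_scale !rK.
have vE : -1 + v = xa by rewrite /v; ring.
have uE : 1 + u = xb by rewrite /u; ring.
move: k1 k2; rewrite !qs vE uE UE.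
move: (qf H1 L1 xp _ _) (qf H1 L1 xa _ _) (qf H2 L2 xp _ _) (qf H2 L2 xb _ _) => q1 q2 q3 q4 k1 k2.
have kr3 : 0 < kap * r ^+ 2 by rewrite mulr_gt0 ?exprn_gt0.
rewrite -(ler_pM2l kr3).
have XE2 : 2 * (X * E) <= kap * r ^+ 2 * (1 / 50).
  have : X * E <= (201 / 100) * (kap * r ^+ 2 / 250).
    apply: ler_pM => //; first by case/andP: X12 => ? _; apply: le_trans ler01 _.
    by move: hxa hxb r1; rewrite /X !ler_norml; clear => /andP[? ?] /andP[? ?] ?; lra.
  by move: kr0; clear; lra.
move: k1 k2 XE2; rewrite !mulrBr -!mulrA; move: (r ^+ 2 * q1) (r ^+ 2 * q2) (r ^+ 2 * q3) (r ^+ 2 * q4) (r ^+ 2 * Kin).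
move=> A B C D F; rewrite /X; clear; lra.
Qed.

End midpoint.

(** * Linear forms lying below the norm *)

Section dual.
Context {R : realType}.
Implicit Types (N : R * R -> R) (e k : R * R) (kap rho eps m w : R).

Definition osculates N e k kap rho eps :=
  [/\ e.1 * k.2 - e.2 * k.1 = 1, 0 < kap, 0 < rho <= 1 /\ kap * rho <= 1, 0 <= eps <= 1 / 8
    & [/\ N e = 1, forall w : R, 1 <= N (e + w *: k)
      & forall w : R, `|w| <= rho ->
          `|N (e + w *: k) - 1 - kap * w ^+ 2 / 2| <= eps * kap * rho ^+ 2]].

Lemma osc_E_ge0 N e k kap rho eps : osculates N e k kap rho eps -> 0 <= eps * kap * rho ^+ 2.
Proof. move=> hO; by case: hO => _ k0 _ /andP[e0 _] _; rewrite mulr_ge0 ?sqr_ge0// mulr_ge0// ltW. Qed.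

Lemma osc_small N e k kap rho eps m : osculates N e k kap rho eps -> `|m| <= rho / 4 -> 0 <= kap * m ^+ 2 / 2 + (eps * kap * rho ^+ 2) <= 1.
Proof.
move=> hO; have E0 := osc_E_ge0 hO.
case: hO => _ k0 [/andP[r0 r1] kr] /andP[e0 e1] _ hm.
apply/andP; split; first by rewrite addr_ge0// divr_ge0// mulr_ge0 ?sqr_ge0 ?ltW.
have m2 : m ^+ 2 <= rho ^+ 2 / 16.
  have := normM_le hm hm; rewrite -expr2 => /(le_trans (ler_norm _)) h.
  by apply: le_trans h _; rewrite le_eqVlt; apply/orP; left; apply/eqP; field.
have kr2 : kap * rho ^+ 2 <= 1.
  rewrite expr2 mulrA; apply: le_trans r1; rewrite -[leRHS]mul1r ler_wpM2r//.
  exact: ltW.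
have km : kap * m ^+ 2 <= kap * rho ^+ 2 / 16 by rewrite -mulrA ler_pM2l.
have Ek : (eps * kap * rho ^+ 2) <= 1 / 8 * (kap * rho ^+ 2).
  by rewrite -mulrA ler_wpM2r// mulr_ge0 ?sqr_ge0 ?ltW.
by move: kr2 km Ek; move: ((eps * kap * rho ^+ 2)) (kap * rho ^+ 2) (kap * m ^+ 2) => C A B; clear; lra.
Qed.

(** Up to [|w| = rho] this is the tangent at [m] to the parabola lowered by the error. Beyond,
    convexity from [w = 0] makes [N - 1] at least [3 / 8 kap rho |w|], which exceeds the
    [kap rho |w| / 4] that the linear term can reach. *)
Lemma osc_support N e k kap rho eps m w : is_norm N -> osculates N e k kap rho eps -> `|m| <= rho / 4 ->
  1 - (kap * m ^+ 2 / 2 + (eps * kap * rho ^+ 2)) + kap * m * w <= N (e + w *: k).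
Proof.
move=> hN hO hm; have := osc_small hO hm; have E0 := osc_E_ge0 hO; move=> /andP[s0 s1].
case: hO => _ k0 [/andP[r0 r1] kr] /andP[e0 e1] [Ne N1 Nq].
have [wr|wr] := leP `|w| rho.
  have := Nq _ wr; rewrite ler_norml => /andP[h _].
  have : 0 <= kap * (w - m) ^+ 2 / 2 by rewrite divr_ge0// mulr_ge0 ?sqr_ge0 ?ltW.
  rewrite sqrrB; move: h; rewrite [w ^+ 2]expr2 [m ^+ 2]expr2.
  by move: (N _) (eps * kap * rho ^+ 2) => F E'; clear; lra.
have w0 : 0 < `|w| by apply: lt_trans wr.
pose t := rho / `|w|.
have t01 : 0 <= t <= 1 by apply/andP; split; [rewrite divr_ge0// ltW | rewrite ler_pdivrMr// mul1r ltW].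
have := nrm_convex hN e (w *: k) t01; rewrite Ne mulr1 scalerA.
have tw : `|t * w| = rho by rewrite normrM /t gtr0_norm ?divr_gt0// divfK ?gt_eqF.
have := Nq (t * w); rewrite tw lexx => /(_ isT); rewrite ler_norml => /andP[h _].
have tw2 : (t * w) ^+ 2 = rho ^+ 2 by rewrite -(real_normK (num_real _)) tw.
move: h; rewrite tw2 => h1 h2.
have h3 : kap * rho ^+ 2 * (3 / 8) <= t * (N (e + w *: k) - 1).
  have Ek : (eps * kap * rho ^+ 2) <= 1 / 8 * (kap * rho ^+ 2).
    by rewrite -mulrA ler_wpM2r// mulr_ge0 ?sqr_ge0 ?ltW.
  move: h1 h2 Ek; move: (N _) (N _) (eps * kap * rho ^+ 2) (kap * _) => F G E' A; clear; lra.
have h4 : kap * (rho * `|w|) * (3 / 8) <= N (e + w *: k) - 1.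
  have t0 : 0 < t by rewrite divr_gt0.
  rewrite -(ler_pM2l t0); apply: le_trans h3.
  by rewrite /t le_eqVlt; apply/orP; left; apply/eqP; field; rewrite gt_eqF.
have h5 : kap * (m * w) <= kap * (rho * `|w| / 4).
  rewrite ler_pM2l//; apply: le_trans (ler_norm _) _; rewrite normrM.
  by apply: le_trans (ler_wpM2r (ltW w0) hm) _; rewrite mulrAC.
have h6 : 0 <= kap * (rho * `|w|) by rewrite !mulr_ge0// ltW.
move: h4 h5 h6 s0; move: (N _) (kap * m ^+ 2 / 2 + (eps * kap * rho ^+ 2)) => F S.
by move: (m * w) (rho * `|w|) (mulrA kap m w) => A B <-; clear; lra.
Qed.

Lemma osc_cx N e k kap rho eps (u : R * R) : is_norm N -> osculates N e k kap rho eps -> `|cx k u| <= N u.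
Proof.
move=> hN; case=> ek _ _ _ [_ N1 _].
have [x0|x0] := eqVneq (cx k u) 0; first by rewrite x0 normr0 nrm_ge0.
rewrite [in leRHS](cxcyE u ek).
have -> : cx k u *: e + cy e u *: k = cx k u *: (e + (cy e u / cx k u) *: k).
  by rewrite scalerDr scalerA mulrCA mulfV// mulr1.
by rewrite nrmZ// ler_peMr.
Qed.

Lemma osc_dual_pos N e k kap rho eps m (x y : R) : is_norm N -> osculates N e k kap rho eps -> `|m| <= rho / 4 -> 0 < x ->
  (1 - (kap * m ^+ 2 / 2 + (eps * kap * rho ^+ 2))) * x + kap * m * y <= N (x *: e + y *: k).
Proof.
move=> hN hO hm x0.
have -> : x *: e + y *: k = x *: (e + (y / x) *: k).
  by rewrite scalerDr scalerA mulrCA mulfV ?mulr1// gt_eqF.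
rewrite nrmZ// gtr0_norm//; have := ler_wpM2l (ltW x0) (osc_support (y / x) hN hO hm).
apply: le_trans; rewrite le_eqVlt; apply/orP; left; apply/eqP; field.
by rewrite gt_eqF.
Qed.

(** For [cx k u > 0] this is [osc_support] and homogeneity. Otherwise, with [x], [y] the coordinates
    of [u], the support line of slope [2 m] gives [2 kap m y <= N (y k)] in the limit of small
    positive first coordinate; averaging [N u >= N (y k) - |x|] and [N u >= |x|] yields half of it.
    The doubled slope explains [rho / 8]. *)
Lemma osc_dual N e k kap rho eps m (u : R * R) : is_norm N -> osculates N e k kap rho eps -> `|m| <= rho / 8 ->
  (1 - (kap * m ^+ 2 / 2 + (eps * kap * rho ^+ 2))) * cx k u + kap * m * cy e u <= N u.
Proof.
move=> hN hO hm; case: (hO) => ek k0 [/andP[r0 r1] kr] _ [Ne _ _].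
have hm4 : `|m| <= rho / 4 by apply: le_trans hm _; move: r0; clear; lra.
rewrite [in leRHS](cxcyE u ek); move: (cx k u) (cy e u) => x y.
have [x0|x0] := ltP 0 x; first exact: osc_dual_pos.
have hm2 : `|2 * m| <= rho / 4.
  rewrite normrM normr_nat (_ : rho / 4 = 2 * (rho / 8)); last by field.
  by rewrite ler_pM2l.
have yk : 2 * (kap * m * y) <= N (y *: k).
  apply/ler_addgt0Pl => s s0.
  have := osc_dual_pos y hN hO hm2 s0; have /andP[_] := osc_small hO hm2.
  move: (kap * (2 * m) ^+ 2 / 2 + (eps * kap * rho ^+ 2)) => S S1.
  have := nrmD hN (s *: e) (y *: k); rewrite (nrmZ hN s e) Ne mulr1 (gtr0_norm s0).
  have : 0 <= (1 - S) * s by rewrite mulr_ge0 ?subr_ge0// ltW.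
  by move: (N _) (N _) => F G; clear; lra.
have := nrm_sub hN (y *: k) (x *: e); rewrite [N (x *: e)]nrmZ// Ne mulr1 ler0_norm// (addrC (y *: k)).
have := osc_cx (x *: e + y *: k) hN hO; rewrite cx_comb// ler0_norm//.
have /andP[_] := osc_small hO hm4.
move: (kap * m ^+ 2 / 2 + (eps * kap * rho ^+ 2)) => S S1.
have : (1 - S) * x <= 0 by rewrite mulr_ge0_le0 ?subr_ge0.
move: yk.
by move: (N (y *: k)) (N _) (kap * m * y) => F G A; clear; lra.
Qed.

End dual.

(** * Derivatives of curves in products *)

Section derivatives.
Context {R : realType}.

Lemma is_derive1_cvgP (V : normedModType R) (f : R -> V) (t : R) (a : V) :
  is_derive t 1 f a <-> h^-1 *: (f (h *: 1 + t) - f t) @[h --> 0^'] --> a.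
Proof.
split=> [[df <-]|cf]; first exact: df.
by apply: DeriveDef; [exact: cvgP cf | exact: cvg_lim cf].
Qed.

Lemma is_derive_pair1 (V W : normedModType R) (f : R -> V) (g : R -> W) (t : R) a b :
  is_derive t 1 f a -> is_derive t 1 g b -> is_derive t 1 (fun s => (f s, g s)) (a, b).
Proof. by move=> /is_derive1_cvgP df /is_derive1_cvgP dg; apply/is_derive1_cvgP/cvg_pair. Qed.

Lemma is_derive_fst1 (V W : normedModType R) (g : R -> V * W) (t : R) a :
  is_derive t 1 g a -> is_derive t 1 (fun s => (g s).1) a.1.
Proof.
move=> /is_derive1_cvgP dg; apply/is_derive1_cvgP.
exact: (cvg_comp _ _ dg (@cvg_fst _ _ _ _ _)).
Qed.

Lemma is_derive_snd1 (V W : normedModType R) (g : R -> V * W) (t : R) a :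
  is_derive t 1 g a -> is_derive t 1 (fun s => (g s).2) a.2.
Proof.
move=> /is_derive1_cvgP dg; apply/is_derive1_cvgP.
exact: (cvg_comp _ _ dg (@cvg_snd _ _ _ _ _)).
Qed.

Lemma integral01_FTC (F f : R -> R) : (forall t : R, is_derive t 1 F (f t)) -> continuous f ->
  (\int[lebesgue_measure]_(t in `[0%R, 1%R]) (f t)%:E)%E = (F 1 - F 0)%:E.
Proof.
move=> dF cf.
have cF : continuous F.
  by move=> t; apply: differentiable_continuous; apply/derivable1_diffP; exact: ex_derive.
rewrite (@continuous_FTC2 _ f F) ?EFinB//.
- by apply: continuous_subspaceT => ? ; exact: cf.
- by split; [move=> x _; exact: ex_derive|apply: cvg_at_right_filter; exact: cF|apply: cvg_at_left_filter; exact: cF].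
- by move=> t _; rewrite derive1E; exact: derive_val.
Qed.

End derivatives.

(** * Upper bound for the distance: lifting a parabola *)

Section parabola.
Context {R : realType}.
Notation mu := (@lebesgue_measure R).

Lemma lip_along_id : lip_along (fun t : R => t : R^o) (fun t : R => t).
Proof.
exists 1 => // s t /andP[s0 s1] /andP[t0 t1]; split; first by rewrite mul1r.
by rewrite ger0_norm.
Qed.

Lemma lip_ac (V : normedModType R) (f : R -> V) (C : R) : 0 <= C ->
  (forall s t : R, 0 <= s <= 1 -> 0 <= t <= 1 -> `|f t - f s| <= C * `|t - s|) ->
  abs_continuous 0 1 f.
Proof.
move=> C0 hC a a0; have C1 : 0 < C + 1 by rewrite ltr_wpDl.
exists (a / (C + 1)); first by rewrite divr_gt0.
move=> n s t st _; rewrite ltr_pdivlMr// mulr_suml; apply: le_lt_trans.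
apply: ler_sum => i _; have [/andP[h1 h2] h3] := st i.
have s01 : 0 <= s i <= 1 by rewrite h1 (le_trans h2).
have t01 : 0 <= t i <= 1 by rewrite h3 (le_trans h1).
apply: le_trans (hC _ _ s01 t01) _; rewrite (ger0_norm (_ : 0 <= t i - s i)) ?subr_ge0//.
by rewrite mulrC ler_wpM2l ?subr_ge0// lerDl.
Qed.

Variables (N : R * R -> R) (e k : R * R).
Hypotheses (hN : is_norm N) (ek : e.1 * k.2 - e.2 * k.1 = 1).

(** The curve is affine in [x] and quadratic in [y], and its lift obeys [w' = - y x']; the two
    hypotheses say that it ends at [b]. *)
Lemma sf_dist_le_parabola (a b : heis R) (be ga : R) :
  be + ga = cy e b.1 - cy e a.1 ->
  cw e k b = cw e k a - (cx k b.1 - cx k a.1) * (cy e a.1 + be / 2 + ga / 3) ->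
  (sf_dist N a b <= \int[mu]_(t in `[0%R, 1%R])
     (N ((cx k b.1 - cx k a.1) *: e + (be + 2 * ga * t) *: k))%:E)%E.
Proof.
move=> hy hw; set X := cx k b.1 - cx k a.1.
pose x (t : R) := cx k a.1 + X * t.
pose y (t : R) := cy e a.1 + be * t + ga * t ^+ 2.
pose z (t : R) := cw e k a - X * (cy e a.1 * t + be * t ^+ 2 / 2 + ga * t ^+ 3 / 3) + x t * y t / 2.
pose g t : heis R := (x t * e.1 + y t * k.1, x t * e.2 + y t * k.2, z t).
pose u t : R * R := X *: e + (be + 2 * ga * t) *: k.
have g1 : g 1 = b.
  have yb : y 1 = cy e b.1 by rewrite /y expr1n !mulr1 -addrA hy; ring.
  have xb : x 1 = cx k b.1 by rewrite /x /X; ring.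
  have zb : z 1 = b.2.
    rewrite /z xb yb !expr1n !mulr1 (_ : b.2 = cw e k b + cx k b.1 * cy e b.1 / 2).
      by rewrite hw.
    by rewrite /cw subrK.
  have E := cxcyE b.1 ek; rewrite /g xb yb zb.
  by rewrite [RHS]surjective_pairing [in RHS]E.
have g0 : g 0 = a.
  have ya : y 0 = cy e a.1 by rewrite /y; ring.
  have xa : x 0 = cx k a.1 by rewrite /x; ring.
  have za : z 0 = a.2.
    by rewrite /z xa ya !expr0n /= !mulr0 !mul0r !addr0 mulr0 subr0 /cw subrK.
  have E := cxcyE a.1 ek; rewrite /g xa ya za.
  by rewrite [RHS]surjective_pairing [in RHS]E.
apply: ereal_inf_lbound; exists g, u; split => //.
have lid := lip_along_id.
have lc c := @lip_along_cst R R^o (fun t : R => t : R^o) c.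
have lx : lip_along (fun t : R => t : R^o) x by apply: lip_alongD => //; exact: lip_alongM.
have ly : lip_along (fun t : R => t : R^o) y.
  apply: lip_alongD; first by apply: lip_alongD => //; exact: lip_alongM.
  by apply: lip_alongM => //; exact: lip_alongX.
have lz : lip_along (fun t : R => t : R^o) z.
  apply: lip_alongD; last by do 2 ! apply: lip_alongM => //.
  apply: lip_alongD => //; apply: lip_alongN; apply: lip_alongM => //.
  apply: lip_alongD; last by do 2 ! apply: lip_alongM => //; exact: lip_alongX.
  apply: lip_alongD; first exact: lip_alongM.
  by do 2 ! apply: lip_alongM => //; exact: lip_alongX.
have dx (t : R) : is_derive t 1 x X.
  by rewrite /x; apply: is_derive_eq; rewrite /GRing.scale/=; ring.
have dy (t : R) : is_derive t 1 y (be + 2 * ga * t).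
  by rewrite /y; apply: is_derive_eq; rewrite /GRing.scale/= ?expr1; ring.
have u12 t : ((u t).1, (u t).2) = (X * e.1 + (be + 2 * ga * t) * k.1, X * e.2 + (be + 2 * ga * t) * k.2) by [].
have cu1 : continuous (fun t => (u t).1).
  by move=> t; apply: cvgD; [exact: cvg_cst|apply: cvgM; [apply: cvgD; [exact: cvg_cst|apply: cvgM; [exact: cvg_cst|exact: cvg_id]]|exact: cvg_cst]].
have cu2 : continuous (fun t => (u t).2).
  by move=> t; apply: cvgD; [exact: cvg_cst|apply: cvgM; [apply: cvgD; [exact: cvg_cst|apply: cvgM; [exact: cvg_cst|exact: cvg_id]]|exact: cvg_cst]].
split.
- have [C1 C10 h1] : lip_along (fun t : R => t : R^o) (fun t => (g t).1.1).
    by apply: lip_alongD; apply: lip_alongM.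
  have [C2 C20 h2] : lip_along (fun t : R => t : R^o) (fun t => (g t).1.2).
    by apply: lip_alongD; apply: lip_alongM.
  have [C3 C30 h3] := lz.
  have C12 := addr_ge0 C10 C20; apply: (@lip_ac _ _ (C1 + C2 + C3)) => [|s t s1 t1].
    exact: addr_ge0.
  have [k1 _] := h1 _ _ s1 t1; have [k2 _] := h2 _ _ s1 t1; have [k3 _] := h3 _ _ s1 t1.
  have d0 : 0 <= `|t - s| by [].
  rewrite !prod_normE /= !ge_max.
  rewrite (le_trans k1) ?(le_trans k2) ?(le_trans k3)//= ler_wpM2r//.
  + by rewrite lerDr.
  + by rewrite -addrA addrCA lerDl addr_ge0.
  + by rewrite -addrA lerDl addr_ge0.
- apply: (measurable_funS measurableT) => //.
  by apply: measurable_fun_pair; apply: continuous_measurable_fun.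
- have : mu.-integrable `[0%R, 1%R] (EFin \o (fun t => (u t).1 ^+ 2 + (u t).2 ^+ 2)).
    apply: continuous_compact_integrable; first exact: segment_compact.
    apply: continuous_subspaceT => t.
    apply: (cvgD (f := fun t => (u t).1 ^+ 2) (g := fun t => (u t).2 ^+ 2)).
      exact: (cvgM (cu1 t) (cu1 t)).
    exact: (cvgM (cu2 t) (cu2 t)).
  move=> /integrableP[_]; apply: le_lt_trans.
  apply: ge0_le_integral => //.
  + by move=> t _; rewrite lee_fin addr_ge0// sqr_ge0.
  + apply/measurable_EFinP; apply: (measurable_funS measurableT) => //.
    by apply: measurable_funD; apply: measurable_funX; apply: continuous_measurable_fun.
  + apply/measurable_EFinP/measurableT_comp => //; apply: (measurable_funS measurableT) => //.
    by apply: measurable_funD; apply: measurable_funX; apply: continuous_measurable_fun.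
  + by move=> t _; rewrite /= lee_fin ler_norm.
- apply: aeW => t _.
  have dz : is_derive t 1 z (- X * y t + (X * y t + x t * (be + 2 * ga * t)) / 2).
    by rewrite /z; apply: is_derive_eq; rewrite /y /GRing.scale/= ?expr1; field.
  have E : (u t).1 *: X1 (g t) + (u t).2 *: X2 (g t) =
    (X * e.1 + (be + 2 * ga * t) * k.1, X * e.2 + (be + 2 * ga * t) * k.2,
      - X * y t + (X * y t + x t * (be + 2 * ga * t)) / 2).
    rewrite /u /g /X1 /X2 /=; congr (_, _, _); rewrite /= /GRing.scale/=; first by ring.
      by ring.
    rewrite (_ : - X * y t + (X * y t + x t * (be + 2 * ga * t)) / 2 =
      (x t * (be + 2 * ga * t) - X * y t) / 2 * (e.1 * k.2 - e.2 * k.1)).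
      by field.
    by rewrite ek; field.
  rewrite E; apply: is_derive_pair1 => //; apply: is_derive_pair1.
    by apply: is_derive_eq; rewrite /GRing.scale/=; ring.
  by apply: is_derive_eq; rewrite /GRing.scale/=; ring.
Qed.

End parabola.

(** * Upper bound for the distance: the length of the parabola *)

Section upper.
Context {R : realType}.
Notation mu := (@lebesgue_measure R).
Implicit Types (N : R * R -> R) (e k : R * R) (a b p q : heis R).

Lemma measurable_nrm_line N e k (X be ga : R) : is_norm N ->
  measurable_fun setT (fun t : R => N (X *: e + (be + ga * t) *: k)).
Proof.
move=> hN; apply: (measurableT_comp (measurable_nrm hN)).
have ml (c d : R) : measurable_fun setT (fun t : R => c + (be + ga * t) * d).
  apply: measurable_funD; first exact: measurable_cst.
  apply: measurable_funM; last exact: measurable_cst.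
  apply: measurable_funD; first exact: measurable_cst.
  by apply: measurable_funM; [exact: measurable_cst|exact: measurable_id].
exact: (measurable_fun_pair (ml (X * e.1) k.1) (ml (X * e.2) k.2)).
Qed.

Lemma integral_nrm_line_le N e k (X be ga : R) (F f : R -> R) : is_norm N ->
  (forall t : R, is_derive t 1 F (f t)) -> continuous f ->
  (forall t : R, 0 <= t <= 1 -> N (X *: e + (be + ga * t) *: k) <= f t) ->
  (\int[mu]_(t in `[0%R, 1%R]) (N (X *: e + (be + ga * t) *: k))%:E <= (F 1 - F 0)%:E)%E.
Proof.
move=> hN dF cf h; rewrite -(integral01_FTC dF cf); apply: ge0_le_integral => //.
- by move=> t _; rewrite lee_fin nrm_ge0.
- apply/measurable_EFinP; apply: measurable_funTS; exact: measurable_nrm_line.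
- by apply/measurable_EFinP; apply: measurable_funTS; exact: continuous_measurable_fun.
Qed.

Lemma norm_affine_le (be ga t : R) : 0 <= t <= 1 -> `|be + ga * t| <= `|be| + `|ga|.
Proof.
move=> /andP[t0 t1]; apply: le_trans (ler_normD _ _) _; rewrite lerD2l normrM ler_piMr//.
by rewrite ger0_norm.
Qed.

Lemma is_derive_cubic (c0 c1 c2 c3 : R) (t : R) :
  is_derive t 1 (fun t : R => c1 * t + c2 * t ^+ 2 + c3 * t ^+ 3)
    (c1 + 2 * c2 * t + 3 * c3 * t ^+ 2).
Proof. by apply: is_derive_eq; rewrite /GRing.scale/= ?expr1; ring. Qed.

Lemma continuous_quadratic (c1 c2 c3 : R) :
  continuous (fun t : R => c1 + 2 * c2 * t + 3 * c3 * t ^+ 2).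
Proof.
move=> t; apply: differentiable_continuous; apply/derivable1_diffP; exact: ex_derive.
Qed.

Lemma parabola_cond N e k a b : is_norm N -> e.1 * k.2 - e.2 * k.1 = 1 ->
  let X := cx k b.1 - cx k a.1 in
  let ga := 3 * (cy e a.1 + cy e b.1) + 6 * (cw e k b - cw e k a) / X in
  let be := cy e b.1 - cy e a.1 - ga in
  X != 0 ->
  (sf_dist N a b <= \int[mu]_(t in `[0%R, 1%R]) (N (X *: e + (be + 2 * ga * t) *: k))%:E)%E.
Proof.
move=> hN ek X ga be X0; apply: sf_dist_le_parabola => //; first by rewrite /be subrK.
rewrite /be /ga -/X; move: (X) X0 (cy e a.1) (cy e b.1) (cw e k a) (cw e k b) => x x0 y1 y2 w1 w2.
by field.
Qed.

(** The last hypothesis keeps the slope [y' / x'] within [rho], where the parabola fits the norm.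
    There the speed is at most a quadratic polynomial in [t], whose integral is the bound. *)
Lemma sf_dist_le_quad N e k (kap rho eps : R) a b : is_norm N -> osculates N e k kap rho eps ->
  let X := cx k b.1 - cx k a.1 in
  let ga := 3 * (cy e a.1 + cy e b.1) + 6 * (cw e k b - cw e k a) / X in
  0 < X -> `|cy e b.1 - cy e a.1| + 3 * `|ga| <= X * rho ->
  (sf_dist N a b <= (X * (1 + eps * kap * rho ^+ 2) +
     kap * kinetic (cy e a.1) (cw e k a) (cy e b.1) (cw e k b) X)%:E)%E.
Proof.
move=> hN hO X ga X0 hr; case: (hO) => ek k0 _ _ [Ne _ Nq].
have X_neq0 : X != 0 by rewrite gt_eqF.
apply: le_trans (parabola_cond hN ek X_neq0) _; rewrite -/X -/ga.
set dy := cy e b.1 - cy e a.1; set be := dy - ga; set E := eps * kap * rho ^+ 2.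
pose c := kap / (2 * X).
pose F (t : R) := (X * (1 + E) + c * be ^+ 2) * t + (2 * c * be * ga) * t ^+ 2
   + (4 / 3 * c * ga ^+ 2) * t ^+ 3.
have -> : X * (1 + E) + kap * kinetic (cy e a.1) (cw e k a) (cy e b.1) (cw e k b) X = F 1 - F 0.
  rewrite /F /kinetic -/ga -/dy /c /be; move: (ga) (dy) (E) => g d E'.
  by field.
apply: (integral_nrm_line_le hN (is_derive_cubic 0 _ _ _) (@continuous_quadratic _ _ _)).
move=> t t01; set v := be + 2 * ga * t.
have vX : `|v / X| <= rho.
  rewrite normrM normfV (gtr0_norm X0) ler_pdivrMr// mulrC; apply: le_trans hr.
  apply: le_trans (norm_affine_le _ _ t01) _; rewrite normrM normr_nat.
  have := ler_normB dy ga; rewrite -/be -/dy.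
  by move: (`|be|) (`|ga|) (`|dy|) => B G D; clear; lra.
have -> : X *: e + v *: k = X *: (e + (v / X) *: k).
  by rewrite scalerDr scalerA mulrCA mulfV ?mulr1.
rewrite nrmZ// gtr0_norm//.
have := Nq _ vX; rewrite -/E ler_norml => /andP[_ h].
have h2 : N (e + (v / X) *: k) <= 1 + kap * (v / X) ^+ 2 / 2 + E.
  by move: h; move: (N _) (kap * _) => A B; clear; lra.
apply: le_trans (ler_wpM2l (ltW X0) h2) _.
rewrite le_eqVlt; apply/orP; left; apply/eqP.
rewrite /c /v; move: (be) (ga) (E) => b' g E'; by field.
Qed.

(** The triangle inequality alone bounds the speed. This serves to find sets of positive measure
    inside every ball. *)
Lemma sf_dist_le_crude N e k a b : is_norm N -> e.1 * k.2 - e.2 * k.1 = 1 -> N e = 1 ->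
  let X := cx k b.1 - cx k a.1 in
  let ga := 3 * (cy e a.1 + cy e b.1) + 6 * (cw e k b - cw e k a) / X in
  0 < X ->
  (sf_dist N a b <= (X + (`|cy e b.1 - cy e a.1| + 3 * `|ga|) * N k)%:E)%E.
Proof.
move=> hN ek Ne X ga X0.
have X_neq0 : X != 0 by rewrite gt_eqF.
apply: le_trans (parabola_cond hN ek X_neq0) _; rewrite -/X -/ga.
set dy := cy e b.1 - cy e a.1; set be := dy - ga; set M := X + _.
pose F (t : R) := M * t + 0 * t ^+ 2 + 0 * t ^+ 3.
have -> : M = F 1 - F 0 by rewrite /F; move: (M) => m; ring.
apply: (integral_nrm_line_le hN (is_derive_cubic 0 _ _ _) (@continuous_quadratic _ _ _)).
move=> t t01; rewrite !mulr0 !mul0r !addr0; apply: le_trans (nrmD hN _ _) _.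
rewrite !nrmZ// Ne mulr1 gtr0_norm// lerD2l ler_wpM2r ?nrm_ge0//.
apply: le_trans (norm_affine_le _ _ t01) _; rewrite normrM normr_nat.
have := ler_normB dy ga; rewrite -/be -/dy.
by move: (`|be|) (`|ga|) (`|dy|) => B G D; clear; lra.
Qed.

End upper.

(** * Lower bound for the distance: calibrating all curves *)

Section lower.
Context {R : realType}.
Notation mu := (@lebesgue_measure R).
Implicit Types (N : R * R -> R) (e k : R * R) (a b p q : heis R).

Lemma curve_derive e k (g : R -> heis R) (u : R * R) (t : R) : e.1 * k.2 - e.2 * k.1 = 1 ->
  is_derive t 1 g (u.1 *: X1 (g t) + u.2 *: X2 (g t)) ->
  [/\ is_derive t 1 (fun s => cx k (g s).1) (cx k u),
      is_derive t 1 (fun s => cy e (g s).1) (cy e u)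
    & is_derive t 1 (fun s => cw e k (g s)) (- cy e (g t).1 * cx k u)].
Proof.
move=> ek dg.
have d1 := is_derive_fst1 (is_derive_fst1 dg).
have d2 := is_derive_snd1 (is_derive_fst1 dg).
have d3 := is_derive_snd1 dg.
have dx : is_derive t 1 (fun s => cx k (g s).1) (cx k u).
  by rewrite /cx; apply: is_derive_eq; rewrite /= /GRing.scale/=; ring.
have dy : is_derive t 1 (fun s => cy e (g s).1) (cy e u).
  by rewrite /cy; apply: is_derive_eq; rewrite /= /GRing.scale/=; ring.
split => //; rewrite /cw; apply: is_derive_eq; rewrite /= /GRing.scale/=.
rewrite (_ : u.1 * - ((g t).1.2 / 2) + u.2 * ((g t).1.1 / 2) =
  ((g t).1.1 * u.2 - (g t).1.2 * u.1) / 2 * (e.1 * k.2 - e.2 * k.1)); last by rewrite ek; field.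
by rewrite /cx /cy; field.
Qed.

Lemma lip_along_coords e k (g : R -> heis R) : abs_continuous 0 1 g ->
  [/\ lip_along g (fun s => cx k (g s).1), lip_along g (fun s => cy e (g s).1)
    & lip_along g (fun s => cw e k (g s))].
Proof.
move=> acg; have [M hM] := ac_bounded acg.
have comp (f : heis R -> R) : (forall p q, f p - f q = f (p - q)) ->
    (forall p, `|f p| <= `|p|) -> lip_along g (fun s => f (g s)).
  move=> fB f1; exists (Num.max M 1); first by rewrite le_max ler01 orbT.
  move=> s t s01 t01; split; last by rewrite le_max (le_trans (f1 _) (hM _ t01)).
  by rewrite fB; apply: le_trans (f1 _) _; rewrite ler_peMl// le_max lexx orbT.
have l1 : lip_along g (fun s => (g s).1.1).
  by apply: (comp (fun p => p.1.1)) => // p; rewrite !prod_normE/= !le_max lexx.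
have l2 : lip_along g (fun s => (g s).1.2).
  by apply: (comp (fun p => p.1.2)) => // p; rewrite !prod_normE/= !le_max lexx orbT.
have l3 : lip_along g (fun s => (g s).2).
  by apply: (comp (fun p => p.2)) => // p; rewrite !prod_normE/= !le_max lexx orbT.
have lc c := @lip_along_cst R _ g c.
have lx : lip_along g (fun s => cx k (g s).1).
  by apply: lip_alongD; [|apply: lip_alongN]; apply: lip_alongM.
have ly : lip_along g (fun s => cy e (g s).1).
  by apply: lip_alongD; [|apply: lip_alongN]; apply: lip_alongM.
split => //; apply: lip_alongD => //; apply: lip_alongN.
by do 2 ! apply: lip_alongM => //.
Qed.

Lemma curve_increment N (g : R -> heis R) (u : R -> R * R) (phi : R -> R) (s t : R) :
  is_norm N -> admissible g u -> lip_along g phi ->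
  (forall r : R, 0 <= r <= 1 -> is_derive r 1 g ((u r).1 *: X1 (g r) + (u r).2 *: X2 (g r)) ->
     derivable phi r 1 /\ 'D_1 phi r <= N (u r)) ->
  0 <= s -> s <= t -> t <= 1 ->
  ((phi t - phi s)%:E <= sf_length N u)%E.
Proof.
move=> hN [acg mu' _ dg] lphi dphi s0 st t1; rewrite /sf_length.
have mNu : measurable_fun (`[0%R, 1%R]%classic : set R) (fun t => N (u t)).
  exact: (measurableT_comp (measurable_nrm hN)).
have [fin|inf] := ltP (\int[mu]_(t in `[0%R, 1%R]) (N (u t))%:E)%E +oo%E; last first.
  by move: inf; rewrite leye_eq => /eqP ->; rewrite leey.
apply: ac_increment_le => //.
- exact: lip_along_ac acg lphi.
- by move=> r; exact: nrm_ge0.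
- apply/integrableP; split; first exact/measurable_EFinP.
  apply: le_lt_trans fin; rewrite le_eqVlt; apply/orP; left; apply/eqP.
  by apply: eq_integral => r _; rewrite /= ger0_norm// nrm_ge0.
- move: dg; apply: filterS; first exact: (ae_filter_ringOfSetsType mu).
  by move=> r h r01; apply: dphi => //; exact: h.
Qed.

Lemma cx_increment N e k kap rho eps (g : R -> heis R) (u : R -> R * R) (s t : R) :
  is_norm N -> osculates N e k kap rho eps -> admissible g u ->
  0 <= s -> s <= t -> t <= 1 ->
  ((`|cx k (g t).1 - cx k (g s).1|)%:E <= sf_length N u)%E.
Proof.
move=> hN hO adm s0 st t1; case: (hO) => ek _ _ _ _; case: (adm) => acg _ _ _.
have [lx _ _] := lip_along_coords e k acg.
have h1 : ((cx k (g t).1 - cx k (g s).1)%:E <= sf_length N u)%E.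
  apply: (curve_increment (phi := fun s => cx k (g s).1) hN adm lx) => // r r01 dr.
  have [dx _ _] := curve_derive ek dr; split; first exact: ex_derive.
  by rewrite derive_val; apply: le_trans (ler_norm _) (osc_cx _ hN hO).
have h2 : ((- cx k (g t).1 - - cx k (g s).1)%:E <= sf_length N u)%E.
  apply: (curve_increment (phi := fun s => - cx k (g s).1) hN adm (lip_alongN lx)) => // r r01 dr.
  have [dx _ _] := curve_derive ek dr; split; first exact: ex_derive.
  rewrite derive_val; apply: le_trans (ler_norm _) _; rewrite normrN; exact: (osc_cx _ hN hO).
have [xp|xn] := leP 0 (cx k (g t).1 - cx k (g s).1); first by rewrite ger0_norm.
by rewrite (ler0_norm (ltW xn)) opprD.
Qed.

Lemma cx_le_sf_dist N e k kap rho eps p q :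
  is_norm N -> osculates N e k kap rho eps ->
  ((`|cx k q.1 - cx k p.1|)%:E <= sf_dist N p q)%E.
Proof.
move=> hN hO; apply: le_ereal_inf_tmp => _ [g [u [adm <- <- ->]]].
exact: (cx_increment hN hO adm).
Qed.

(** Along a curve the calibration has as derivative the linear form of [osc_dual] with
    [m = H + L x], which is controlled for [|m| <= rho / 8]. A curve of length less than [3 / 2]
    from a point with [|x| <= 6 / 5] keeps [|x| <= 3], hence the condition on [|H| + 3 |L|]. *)
Lemma sf_dist_calibration N e k (kap rho eps H L : R) p q :
  is_norm N -> osculates N e k kap rho eps ->
  `|H| + 3 * `|L| <= rho / 8 -> `|cx k p.1| <= 6 / 5 -> (sf_dist N p q < (3 / 2)%:E)%E ->
  (((1 - eps * kap * rho ^+ 2) * (cx k q.1 - cx k p.1)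
    + kap * (qf H L (cx k q.1) (cy e q.1) (cw e k q)
             - qf H L (cx k p.1) (cy e p.1) (cw e k p)))%:E <= sf_dist N p q)%E.
Proof.
move=> hN hO HL xp dlt; case: (hO) => ek _ _ _ _.
set E := eps * kap * rho ^+ 2.
rewrite leNgt; apply/negP => abs.
(* If the bound failed, some curve would be shorter than both the bound and [3 / 2]. *)
have : (sf_dist N p q < Order.min (3 / 2)%:E (((1 - E) * (cx k q.1 - cx k p.1)
    + kap * (qf H L (cx k q.1) (cy e q.1) (cw e k q)
             - qf H L (cx k p.1) (cy e p.1) (cw e k p)))%:E))%E.
  by rewrite lt_min dlt abs.
move=> /ereal_inf_lt[_ [g [u [adm g0 g1 ->]]]]; rewrite lt_min => /andP[l1].
apply/negP; rewrite -leNgt; case: (adm) => acg _ _ _.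
have [lx ly lw] := lip_along_coords e k acg.
pose phi s := (1 - E) * cx k (g s).1 + kap * qf H L (cx k (g s).1) (cy e (g s).1) (cw e k (g s)).
have lc c := @lip_along_cst R _ g c.
have lphi : lip_along g phi.
  rewrite /phi /qf; apply: lip_alongD; first exact: lip_alongM.
  apply: lip_alongM => //; apply: lip_alongD; last exact: lip_alongM.
  apply: lip_alongD; last first.
    by apply: lip_alongM => //; apply: lip_alongD => //; exact: lip_alongM.
  apply: lip_alongM => //; apply: lip_alongN; apply: lip_alongD.
    apply: lip_alongD; first exact: lip_alongM.
    by apply: lip_alongM => //; exact: lip_alongX.
  by do 2 ! apply: lip_alongM => //; exact: lip_alongX.
have -> : (1 - E) * (cx k q.1 - cx k p.1) + kap * (qf H L (cx k q.1) (cy e q.1) (cw e k q)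
             - qf H L (cx k p.1) (cy e p.1) (cw e k p)) = phi 1 - phi 0.
  by rewrite /phi g0 g1; move: (qf _ _ _ _ _) (qf _ _ _ _ _) => A B; ring.
apply: (@curve_increment _ g u phi 0 1 hN adm lphi _ (lexx 0) ler01 (lexx 1)) => r r01 dr.
have [dx dy dw] := curve_derive ek dr.
have [r0 r1] := andP r01.
have := cx_increment hN hO adm (lexx 0) r0 r1; rewrite g0 => /le_lt_trans /(_ l1).
rewrite lte_fin => x1.
have x3 : `|cx k (g r).1| <= 3.
  rewrite -[X in `|X|](subrK (cx k p.1)); apply: le_trans (ler_normD _ _) _.
  by move: x1 xp; move: (`|_|) (`|_|) => A B; clear; lra.
set x := cx k (g r).1 in x3 *; set y := cy e (g r).1.
have dphi : is_derive r 1 phi ((1 - (kap * (H + L * x) ^+ 2 / 2 + E)) * cx k (u r)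
    + kap * (H + L * x) * cy e (u r)).
  rewrite /phi /qf; apply: is_derive_eq; rewrite /GRing.scale/= -/x -/y ?expr1.
  by field.
split; first exact: ex_derive.
rewrite derive_val; apply: (osc_dual _ hN hO).
apply: le_trans HL; apply: le_trans (ler_normD _ _) _; rewrite lerD2l normrM mulrC.
by rewrite ler_wpM2r.
Qed.

End lower.

(** * Invariance of Lebesgue measure under shears *)

Section shear.
Context {R : realType}.
Notation mu := (@lebesgue_measure R).

Lemma lebesgue_measure_shift (c : R) (A : set R) : measurable A ->
  mu ((fun x => x + c) @^-1` A) = mu A.
Proof.
move=> mA.
have mf : measurable_fun setT (fun x : R => x + c).
  by apply: measurable_funD; [exact: measurable_id|exact: measurable_cst].
have mf' : @measurable_fun _ _ (measurableTypeR R) (measurableTypeR R) setT (fun x : R => x + c).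
  exact: mf.
have H (X : set R) : ocitv X -> mu X = pushforward mu (fun x => x + c) X.
  move=> /ocitvP[->|[[a b] /= ab ->]]; first by rewrite /pushforward preimage_set0 !measure0.
  rewrite /pushforward /=.
  rewrite (_ : _ @^-1` _ = `]a - c, b - c]%classic); last first.
    by apply/seteqP; split => x /=; rewrite !in_itv/= ltrBlDr lerBrDr.
  rewrite !lebesgue_measure_itv/= !lte_fin ltrD2r ab.
  by rewrite -!EFinB; congr EFin; ring.
symmetry; exact: (@lebesgue_measure_unique R
  (measure_function_pushforward__canonical__measure_function_Measure _ mf') H A mA).
Qed.

Section prod.
Context d (T : measurableType d) (m : {sigma_finite_measure set T -> \bar R}).

Lemma shear_snd (f : T -> R) (A : set (T * R)) : measurable A ->
  (m \x mu)%E ((fun p => (p.1, p.2 + f p.1)) @^-1` A) = (m \x mu)%E A.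
Proof.
move=> mA; apply: eq_integral => x _ /=.
rewrite -[RHS](lebesgue_measure_shift (f x)); last exact: measurable_xsection.
by congr (mu _); apply/seteqP; split => y; rewrite /xsection/= !inE.
Qed.

Lemma product_measure12 (A : set (T * R)) : measurable A -> (m \x mu)%E A = (m \x^ mu)%E A.
Proof.
move=> mA; apply: (@product_measure_unique _ _ _ _ _ m mu
  (lebesgue_integral_fubini_product_measure2__canonical__measure_function_Measure m mu)) => //.
by move=> B C mB mC; rewrite /= product_measure2E.
Qed.

Lemma shear_fst (g : T -> R -> T) (A : set (T * R)) :
  measurable_fun setT (fun p : T * R => (g p.1 p.2, p.2)) ->
  (forall z B, measurable B -> m ((g^~ z) @^-1` B) = m B) ->
  measurable A ->
  (m \x mu)%E ((fun p => (g p.1 p.2, p.2)) @^-1` A) = (m \x mu)%E A.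
Proof.
move=> mg hg mA; rewrite !product_measure12//; last first.
  by rewrite -[X in measurable X]setTI; exact: mg.
apply: eq_integral => z _ /=.
rewrite -[RHS](hg z); last exact: measurable_ysection.
by congr (m _); apply/seteqP; split => y; rewrite /ysection/= !inE.
Qed.
End prod.

End shear.

(** * Volume of boxes in adapted coordinates *)

Section lebesgue3.
Context {R : realType}.
Notation mu := (@lebesgue_measure R).

(** Naming the planar measure lets it carry a sigma-finite structure, so that the shear lemmas apply
    to its product with a line. *)
Definition plane : set (measurableTypeR R * measurableTypeR R)%type -> \bar R := (mu \x mu)%E.

HB.instance Definition _ := Measure.copy plane (mu \x mu)%E.

Lemma plane_sigma_finite : sigma_finite setT plane.
Proof.
have /sigma_finiteP[F [TF ndF Foo]] := sigma_finiteT mu.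
exists (fun n => F n `*` F n).
  apply/seteqP; split => // -[x y] _.
  have [n _ Fx] : (\bigcup_i F i) x by rewrite -TF.
  have [k _ Fy] : (\bigcup_i F i) y by rewrite -TF.
  exists (maxn n k) => //; split => /=.
    by move: x Fx; exact/subsetPset/ndF/leq_maxl.
  by move: y Fy; exact/subsetPset/ndF/leq_maxr.
move=> n; have [mF Fn] := Foo n; split; first exact: measurableX.
by rewrite /plane product_measure1E// lte_mul_pinfty// ge0_fin_numE.
Qed.

HB.instance Definition _ := Measure_isSigmaFinite.Build _ _ _ plane plane_sigma_finite.

Lemma measurable_11 : measurable_fun setT (fun p : heis R => p.1.1).
Proof. exact: (measurableT_comp measurable_fst measurable_fst). Qed.
Lemma measurable_12 : measurable_fun setT (fun p : heis R => p.1.2).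
Proof. exact: (measurableT_comp measurable_snd measurable_fst). Qed.
Lemma measurable_3 : measurable_fun setT (fun p : heis R => p.2).
Proof. exact: measurable_snd. Qed.

Lemma preim_measurable d d' (S : measurableType d) (T : measurableType d') (f : S -> T) (A : set T) :
  measurable_fun setT f -> measurable A -> measurable (f @^-1` A).
Proof. by move=> mf mA; rewrite -[X in measurable X]setTI; exact: mf. Qed.

Lemma measurable_scale (c : R) : measurable_fun setT (fun x : R => c * x).
Proof. by apply: measurable_funM; [exact: measurable_cst|exact: measurable_id]. Qed.

Definition shear1 (f : R * R -> R) (p : heis R) : heis R := (p.1.1 + f (p.1.2, p.2), p.1.2, p.2).
Definition shear2 (f : R * R -> R) (p : heis R) : heis R := (p.1.1, p.1.2 + f (p.1.1, p.2), p.2).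
Definition shear3 (f : R * R -> R) (p : heis R) : heis R := (p.1, p.2 + f p.1).

Lemma measurable_shear1 f : measurable_fun setT f -> measurable_fun setT (shear1 f).
Proof.
move=> mf; apply: measurable_fun_pair; last exact: measurable_3.
apply: measurable_fun_pair; last exact: measurable_12.
apply: measurable_funD; first exact: measurable_11.
apply: (measurableT_comp mf); apply: measurable_fun_pair; [exact: measurable_12|exact: measurable_3].
Qed.

Lemma measurable_shear2 f : measurable_fun setT f -> measurable_fun setT (shear2 f).
Proof.
move=> mf; apply: measurable_fun_pair; last exact: measurable_3.
apply: measurable_fun_pair; first exact: measurable_11.
apply: measurable_funD; first exact: measurable_12.
apply: (measurableT_comp mf); apply: measurable_fun_pair; [exact: measurable_11|exact: measurable_3].
Qed.

Lemma measurable_shear3 f : measurable_fun setT f -> measurable_fun setT (shear3 f).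
Proof.
move=> mf; apply: measurable_fun_pair; first exact: measurable_fst.
apply: measurable_funD; first exact: measurable_3.
exact: (measurableT_comp mf measurable_fst).
Qed.

Lemma lebesgue3_shear3 f (A : set (heis R)) : measurable A ->
  lebesgue3 (shear3 f @^-1` A) = lebesgue3 A.
Proof. by move=> mA; exact: (@shear_snd _ _ _ plane f A mA). Qed.

Lemma lebesgue3_shear2 f (A : set (heis R)) : measurable_fun setT f -> measurable A ->
  lebesgue3 (shear2 f @^-1` A) = lebesgue3 A.
Proof.
move=> mf mA.
apply: (@shear_fst _ _ _ plane (fun v z => (v.1, v.2 + f (v.1, z))) A) => //.
  exact: measurable_shear2.
by move=> z B mB; exact: (@shear_snd _ _ _ mu (fun x => f (x, z)) B mB).
Qed.

Lemma lebesgue3_shear1 f (A : set (heis R)) : measurable_fun setT f -> measurable A ->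
  lebesgue3 (shear1 f @^-1` A) = lebesgue3 A.
Proof.
move=> mf mA.
apply: (@shear_fst _ _ _ plane (fun v z => (v.1 + f (v.2, z), v.2)) A) => //.
  exact: measurable_shear1.
move=> z B mB.
apply: (@shear_fst _ _ _ mu (fun x y => x + f (y, z)) B) => //.
  apply: measurable_fun_pair; last exact: measurable_snd.
  apply: measurable_funD; first exact: measurable_fst.
  apply: (measurableT_comp mf); apply: measurable_fun_pair; first exact: measurable_snd.
  exact: measurable_cst.
by move=> y C mC; exact: lebesgue_measure_shift.
Qed.

(* A matrix of determinant 1 with nonzero lower left entry is a product of three shears. *)
Lemma lebesgue3_box (e k : R * R) (a b c : R) (I1 I2 I3 : set R) :
  e.1 * k.2 - e.2 * k.1 = 1 -> e.2 != 0 ->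
  measurable I1 -> measurable I2 -> measurable I3 ->
  let S := [set p : heis R | [/\ I1 (cx k p.1), I2 (cy e p.1 + a * cw e k p)
     & I3 (cw e k p + b * (cy e p.1 + a * cw e k p) + c * cx k p.1)]] in
  measurable S /\ lebesgue3 S = (mu I1 * mu I2 * mu I3)%E.
Proof.
move=> ek e2 m1 m2 m3 S.
(* [f1], [f2], [f3] factor the map to [(cx, cy)], whose matrix has lower left entry [- e.2]; [f4]
   passes from the third coordinate to [cw]; [f5] and [f6] tilt the box. *)
pose f1 (q : R * R) := (e.1 - 1) / (- e.2) * q.1.
pose f2 (q : R * R) := (- e.2) * q.1.
pose f3 (q : R * R) := (k.2 - 1) / (- e.2) * q.1.
pose f4 (q : R * R) := - (1 / 2) * (q.1 * q.2).
pose f5 (q : R * R) := a * q.2.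
pose f6 (q : R * R) := b * q.2 + c * q.1.
pose B : set (heis R) := (I1 `*` I2) `*` I3.
have mB : measurable B by do 2 ! (apply: measurableX => //).
have mfst (r : R) : measurable_fun setT (fun q : R * R => r * q.1).
  exact: (measurableT_comp (measurable_scale r) measurable_fst).
have msnd (r : R) : measurable_fun setT (fun q : R * R => r * q.2).
  exact: (measurableT_comp (measurable_scale r) measurable_snd).
have mf4 : measurable_fun setT f4.
  apply: (measurableT_comp (measurable_scale _)).
  by apply: measurable_funM; [exact: measurable_fst|exact: measurable_snd].
have mf6 : measurable_fun setT f6 by apply: measurable_funD.
have mf1 : measurable_fun setT f1 := mfst _.
have mf2 : measurable_fun setT f2 := mfst _.
have mf3 : measurable_fun setT f3 := mfst _.
have mf5 : measurable_fun setT f5 := msnd _.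
pose B6 := shear3 f6 @^-1` B.
have mB6 : measurable B6 by apply: preim_measurable => //; exact: measurable_shear3.
pose B5 := shear2 f5 @^-1` B6.
have mB5 : measurable B5 by apply: preim_measurable => //; exact: measurable_shear2.
pose B4 := shear3 f4 @^-1` B5.
have mB4 : measurable B4 by apply: preim_measurable => //; exact: measurable_shear3.
pose B3 := shear1 f3 @^-1` B4.
have mB3 : measurable B3 by apply: preim_measurable => //; exact: measurable_shear1.
pose B2 := shear2 f2 @^-1` B3.
have mB2 : measurable B2 by apply: preim_measurable => //; exact: measurable_shear2.
pose B1 := shear1 f1 @^-1` B2.
have mB1 : measurable B1 by apply: preim_measurable => //; exact: measurable_shear1.
have SE : S = B1.
  have eq1 (p : heis R) : shear1 f3 (shear2 f2 (shear1 f1 p)) = (cx k p.1, cy e p.1, p.2).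
    case: p => [[x y] z]; rewrite /shear1 /shear2 /f1 /f2 /f3 /cx /cy /=.
    have -> : k.1 = (e.1 * k.2 - 1) / e.2 by rewrite -ek; field.
    congr (_, _, _).
    by field. by field.
  have eq2 (p : heis R) : shear3 f6 (shear2 f5 (shear3 f4 (shear1 f3 (shear2 f2 (shear1 f1 p))))) =
     (cx k p.1, cy e p.1 + a * cw e k p,
      cw e k p + b * (cy e p.1 + a * cw e k p) + c * cx k p.1).
    rewrite eq1 /shear3 /shear2 /f4 /f5 /f6 /=.
    have -> : p.2 + - (1 / 2) * (cx k p.1 * cy e p.1) = cw e k p by rewrite /cw; field.
    by congr (_, _, _); ring.
  apply/seteqP; split => p.
    by move=> [h1 h2 h3]; rewrite /B1 /B2 /B3 /B4 /B5 /B6 /preimage /= eq2.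
  by rewrite /B1 /B2 /B3 /B4 /B5 /B6 /preimage /= eq2 => -[[h1 h2] h3].
split; first by rewrite SE.
rewrite SE lebesgue3_shear1// lebesgue3_shear2// lebesgue3_shear1// lebesgue3_shear3//.
rewrite lebesgue3_shear2// lebesgue3_shear3//.
rewrite /lebesgue3 product_measure1E//; last exact: measurableX.
by congr (_ * _)%E; exact: product_measure1E.
Qed.

End lebesgue3.

(** * Distortion coefficients at small distances *)

Section tau.
Context {R : realType}.

(** By the doubling formulas the coefficient is [1 / (2 cos x)] or [1 / (2 cosh x)] with
    [x = r sqrt (|K| / M) / 2]: at least [1 / 2] for positive [K], and at least [c / 2] for negative
    [K] once [exp x <= 1 / c]. *)
Lemma sigma_half_ge (K M c : R) : 0 < M -> 0 < c < 1 ->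
  exists2 th0 : R, 0 < th0 & forall r : R, 0 <= r <= th0 ->
    ((c / 2)%:E <= sigma K M (1 / 2) r%:E)%E.
Proof.
move=> M0 /andP[c0 c1].
have lc : 0 < - ln c by rewrite oppr_gt0 ln_lt0// c0.
have s1 : 0 < Num.sqrt (- K / M) + 1 by rewrite ltr_wpDl// sqrtr_ge0.
(* This makes [x <= - ln c]; the [+ 1] keeps the denominator positive, as [Num.sqrt] is 0 at
   nonpositive numbers. *)
exists (2 * - ln c / (Num.sqrt (- K / M) + 1)); first by rewrite divr_gt0// mulr_gt0.
move=> r /andP[r0 rt]; rewrite /sigma.
case: ifPn => [_|]; first exact: leey.
rewrite -ltNge => Kpi.
case: ifPn => [_|K0]; first by rewrite lee_fin ler_pM2r// ltW.
have r_neq0 : r != 0 by apply: contraNneq K0 => ->; rewrite expr0n mulr0.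
have r_gt0 : 0 < r by rewrite lt_neqAle eq_sym r_neq0.
have r2 : 0 < r ^+ 2 by rewrite exprn_gt0.
case: ifPn => [|Kn]; rewrite lee_fin.
  rewrite pmulr_lgt0// => Kp.
  have KM : 0 < K / M by rewrite divr_gt0.
  set t := Num.sqrt (K / M); have t0 : 0 < t by rewrite sqrtr_gt0.
  have rt0 : 0 < r * t by rewrite mulr_gt0.
  have rtpi : r * t < pi.
    rewrite -(ltr_pXn2r (n := 2))// ?nnegrE ?pi_ge0// ?(ltW rt0)//.
    by rewrite exprMn sqr_sqrtr ?(ltW KM)// mulrCA mulrA ltr_pdivrMr// [ltRHS]mulrC.
  pose x := 1 / 2 * r * t.
  have x2 : r * t = x *+ 2 by rewrite /x mulr2n; field.
  have x0 : 0 < x < pi / 2.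
    by move: rt0 rtpi; rewrite /x; move: (pi) => p; rewrite -mulrA; move: (r * t) => z; clear => ? ?; apply/andP; split; lra.
  rewrite -/x x2 sin_mulr2n.
  have S0 : 0 < sin x by exact: sin_gt0_pihalf.
  have C0 : 0 < cos x.
    apply: cos_gt0_pihalf; case/andP: x0 => x0 ->; rewrite andbT (lt_trans _ x0)//.
    by rewrite oppr_lt0 divr_gt0// pi_gt0.
  have C1 := cos_le1 x.
  rewrite ler_pdivlMr; last by rewrite mulrn_wgt0// mulr_gt0.
  have -> : c / 2 * (cos x * sin x *+ 2) = c * cos x * sin x by rewrite mulr2n; field.
  by rewrite ler_piMl ?(ltW S0)// mulr_ile1// ltW.
have K_lt0 : K < 0.
  by rewrite ltNge; apply: contra Kn => K1; rewrite lt_neqAle eq_sym K0 mulr_ge0 ?sqr_ge0.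
have KM : 0 < - K / M by rewrite divr_gt0// oppr_gt0.
set t := Num.sqrt (- K / M); have t0 : 0 < t by rewrite sqrtr_gt0.
pose x := 1 / 2 * r * t.
have x0 : 0 < x by rewrite /x !mulr_gt0.
have x2 : r * t = x + x by rewrite /x; field.
have xc : x <= - ln c.
  have : r * (t + 1) <= 2 * - ln c by rewrite -ler_pdivlMr.
  by move: r_gt0; rewrite /x -mulrA mulrDr mulr1; move: (r * t) (ln c) => z L; clear; lra.
rewrite -/x x2 /sinh opprD !expRD expRN.
have a0 : 0 < expR x by exact: expR_gt0.
have ac : expR x <= c^-1.
  apply: le_trans (_ : expR (- ln c) <= _); first by rewrite ler_expR.
  by rewrite expRN lnK.
have a1 : 1 < expR x by rewrite expR_gt1.
move: (expR x) a0 ac a1 => a a0 ac a1.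
have b1 : a^-1 < a.
  by apply: (lt_trans _ a1); rewrite invf_lt1.
have b0 : 0 < a^-1 by rewrite invr_gt0.
have -> : (a - a^-1) / 2 / ((a * a - a^-1 * a^-1) / 2) = (a + a^-1)^-1.
  have h1 : a - a^-1 != 0 by rewrite subr_eq0 gt_eqF.
  have h2 : a + a^-1 != 0 by rewrite gt_eqF// addr_gt0.
  move: (a^-1) h1 h2 => b h1 h2; rewrite (_ : a * a - b * b = (a - b) * (a + b)); last by ring.
  by field; rewrite h1 h2.
rewrite -[leLHS]invrK lef_pV2 ?posrE ?addr_gt0 ?invr_gt0 ?divr_gt0//.
rewrite invf_div; apply: le_trans (_ : a + a <= _); first by rewrite lerD2l ltW.
have : a * c <= 1 by rewrite -ler_pdivlMr// mul1r.
by rewrite ler_pdivlMr//; clear; lra.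
Qed.

(** A geometric mean of [1 / 2] and [sigma], with weights [1 / N] and [1 - 1 / N]. *)
Lemma tau_half_ge (K N c : R) : 1 < N -> 0 < c < 1 ->
  exists2 th0 : R, 0 < th0 & forall r : R, 0 <= r <= th0 ->
    ((c / 2)%:E <= tau K N (1 / 2) r%:E)%E.
Proof.
move=> N1 c01; have N0 : 0 < N by apply: lt_trans N1.
have M0 : 0 < N - 1 by rewrite subr_gt0.
have [th0 th00 h] := sigma_half_ge K M0 c01; exists th0 => // r rt.
have [c0 c1] := andP c01; have c20 : 0 < c / 2 by rewrite divr_gt0.
have iN : 0 < N^-1 < 1 by rewrite invr_gt0 N0 invf_lt1.
have [iN0 iN1] := andP iN.
have := h _ rt; rewrite /tau; move: (sigma _ _ _ _) => s hs.
have s1 : 0 <= 1 - N^-1 by rewrite subr_ge0 ltW.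
have hs2 : ((c / 2)%:E `^ (1 - N^-1) <= s `^ (1 - N^-1))%E.
  apply: gt0_ler_poweR => //; rewrite in_itv/= leey andbT ?lee_fin ?(ltW c20)//.
  by apply: le_trans hs; rewrite lee_fin ltW.
have hp : (((c / 2) `^ N^-1)%:E <= ((1 / 2) `^ N^-1)%:E)%E.
  rewrite lee_fin ge0_ler_powR// ?nnegrE ?(ltW iN0) ?(ltW c20)//.
  by rewrite ler_pM2r// ltW.
have -> : (c / 2)%:E = (((c / 2) `^ N^-1)%:E * (c / 2)%:E `^ (1 - N^-1))%E.
  rewrite poweR_EFin -EFinM -powRD ?subrKC ?powRr1 ?(ltW c20)//.
  by rewrite oner_eq0.
by apply: lee_pmul => //; [rewrite lee_fin powR_ge0 | exact: poweR_ge0].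
Qed.

End tau.

(** * Dilations *)

Section dilation.
Context {R : realType}.
Notation mu := (@lebesgue_measure R).
Implicit Types (N : R * R -> R) (e k : R * R) (a b p q : heis R) (l : R).

Definition dil l p : heis R := (l * p.1.1, l * p.1.2, l ^+ 2 * p.2).

Lemma dilK l p : l != 0 -> dil l (dil l^-1 p) = p.
Proof.
move=> l0; case: p => [[x y] z]; rewrite /dil /=.
by congr (_, _, _); field.
Qed.

Lemma cx_dil k l p : cx k (dil l p).1 = l * cx k p.1.
Proof. by rewrite /cx /=; ring. Qed.
Lemma cy_dil e l p : cy e (dil l p).1 = l * cy e p.1.
Proof. by rewrite /cy /=; ring. Qed.
Lemma cw_dil e k l p : cw e k (dil l p) = l ^+ 2 * cw e k p.
Proof. by rewrite /cw /cx /cy /=; field. Qed.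

Lemma sf_dist_dil_le N l p q : is_norm N -> 0 < l ->
  (sf_dist N (dil l p) (dil l q) <= l%:E * sf_dist N p q)%E.
Proof.
move=> hN l0; rewrite -lee_pdivrMl//.
apply: le_ereal_inf_tmp => _ [g [u [[acg mu' u2 dg] g0 g1 ->]]].
rewrite lee_pdivrMl//.
apply: ereal_inf_lbound; exists (fun t => dil l (g t)), (fun t => l *: u t).
have ml (v : R * R -> R) : measurable_fun setT v -> measurable_fun setT (fun z : R * R => l * v z).
  by move=> mv; apply: measurable_funM => //; exact: measurable_cst.
split; last 1 first.
- rewrite /sf_length -ge0_integralZl_EFin//; last 3 first.
  + by move=> t _; rewrite lee_fin nrm_ge0.
  + by apply/measurable_EFinP; exact: (measurableT_comp (measurable_nrm hN)).
  + exact: ltW.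
  by apply: eq_integral => t _; rewrite nrmZ// gtr0_norm// EFinM.
- split.
  + move=> a a0; have C0 : 0 < l + l ^+ 2 by rewrite addr_gt0// exprn_gt0.
    have [d d0 hd] := acg _ (divr_gt0 a0 C0); exists d => // n s t st tri len.
    have := hd n s t st tri len; rewrite ltr_pdivlMr// mulr_suml; apply: le_lt_trans.
    apply: ler_sum => i _; move: (g (t i)) (g (s i)) => p1 p2.
    rewrite /dil expr2 !prod_normE /= -!mulrBr !normrM !(gtr0_norm l0) mulrDr !ge_max -!andbA.
    set M := Num.max _ _.
    have [h1 h2 h3] : [/\ `|p1.1.1 - p2.1.1| <= M, `|p1.1.2 - p2.1.2| <= M & `|p1.2 - p2.2| <= M].
      by rewrite /M !le_max !lexx !orbT.
    have l20 : 0 <= l * l by rewrite mulr_ge0// ltW.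
    have M0 : 0 <= M by apply: le_trans h1.
    apply/and3P; split.
    * apply: le_trans (ler_wpM2l (ltW l0) h1) _; by rewrite [leLHS]mulrC lerDl mulr_ge0.
    * apply: le_trans (ler_wpM2l (ltW l0) h2) _; by rewrite [leLHS]mulrC lerDl mulr_ge0.
    * apply: le_trans (ler_wpM2l l20 h3) _; by rewrite [leLHS]mulrC lerDr mulr_ge0// ltW.
  + apply: (measurableT_comp _ mu') => //.
    exact: (measurable_fun_pair (ml _ measurable_fst) (ml _ measurable_snd)).
  + have -> : (\int[mu]_(t in `[0%R, 1%R]) ((l *: u t).1 ^+ 2 + (l *: u t).2 ^+ 2)%:E =
      (l ^+ 2)%:E * \int[mu]_(t in `[0%R, 1%R]) ((u t).1 ^+ 2 + (u t).2 ^+ 2)%:E)%E.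
      rewrite -ge0_integralZl_EFin//; last 3 first.
      - by move=> t _; rewrite lee_fin addr_ge0// sqr_ge0.
      - apply/measurable_EFinP; apply: measurable_funD; apply: measurable_funX.
          exact: (measurableT_comp measurable_fst).
        exact: (measurableT_comp measurable_snd).
      - by rewrite sqr_ge0.
      apply: eq_integral => t _; rewrite -EFinM; congr EFin.
      by rewrite /= /GRing.scale/=; ring.
    by apply: lte_mul_pinfty => //; rewrite ?lee_fin ?sqr_ge0.
  + move: dg; apply: filterS; first exact: (ae_filter_ringOfSetsType mu).
    move=> t h t01; have dgt := h t01.
    have d1 := is_derive_fst1 (is_derive_fst1 dgt).
    have d2 := is_derive_snd1 (is_derive_fst1 dgt).
    have d3 := is_derive_snd1 dgt.
    have E : (l *: u t).1 *: X1 (dil l (g t)) + (l *: u t).2 *: X2 (dil l (g t)) =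
      (l * ((u t).1 *: X1 (g t) + (u t).2 *: X2 (g t)).1.1,
       l * ((u t).1 *: X1 (g t) + (u t).2 *: X2 (g t)).1.2,
       l ^+ 2 * ((u t).1 *: X1 (g t) + (u t).2 *: X2 (g t)).2).
      by rewrite /X1 /X2 /dil /=; congr (_, _, _); rewrite /= /GRing.scale/=; field.
    have D1 := @is_deriveZ _ _ _ (fun s => (g s).1.1) l t 1 _ d1.
    have D2 := @is_deriveZ _ _ _ (fun s => (g s).1.2) l t 1 _ d2.
    have D3 := @is_deriveZ _ _ _ (fun s => (g s).2) (l ^+ 2) t 1 _ d3.
    by rewrite E; exact: (is_derive_pair1 (is_derive_pair1 D1 D2) D3).
- by rewrite g0.
- by rewrite g1.
Qed.

Lemma sf_dist_dil N l p q : is_norm N -> 0 < l ->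
  (sf_dist N (dil l p) (dil l q) = l%:E * sf_dist N p q)%E.
Proof.
move=> hN l0; apply/eqP; rewrite eq_le sf_dist_dil_le//=.
have l0' : 0 < l^-1 by rewrite invr_gt0.
have l_neq0 : l != 0 by rewrite gt_eqF.
have := sf_dist_dil_le (dil l p) (dil l q) hN l0'.
have K r : dil l^-1 (dil l r) = r by rewrite -[l in dil l r]invrK dilK// invr_eq0.
by rewrite !K -lee_pdivrMl ?invr_gt0// invrK.
Qed.

End dilation.

(** * Smooth measures near a point *)

Section density.
Context {R : realType}.
Notation mu := (@lebesgue_measure R).

Definition leb3 :=
  lebesgue_integral_fubini_product_measure1__canonical__measure_function_Measure (@plane R) mu.

Lemma lebesgue3_set0 : @lebesgue3 R set0 = 0%E. Proof. exact: (measure0 leb3). Qed.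
Lemma lebesgue3_ge0 (A : set (heis R)) : (0 <= lebesgue3 A)%E.
Proof. exact: (measure_ge0 leb3). Qed.
Lemma lebesgue3_additive : semi_sigma_additive (@lebesgue3 R).
Proof. exact: (@measure_semi_sigma_additive _ _ _ leb3). Qed.
HB.instance Definition _ := isMeasure.Build _ (heis R) R (@lebesgue3 R)
  lebesgue3_set0 lebesgue3_ge0 lebesgue3_additive.

(** Read off the definition of the integral as a supremum over the simple functions below the
    integrand. *)
Lemma ge0_le_integral_any d (T : measurableType d) (nu : {measure set T -> \bar R}) (D : set T)
    (f g : T -> \bar R) :
  (forall x, D x -> (0 <= f x)%E) -> (forall x, D x -> (f x <= g x)%E) ->
  (\int[nu]_(x in D) f x <= \int[nu]_(x in D) g x)%E.
Proof.
move=> f0 fg; have g0 x : D x -> (0 <= g x)%E by move=> Dx; exact: le_trans (f0 _ Dx) (fg _ Dx).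
rewrite !ge0_integralE//; apply: ge_ereal_sup => _ [h hf <-].
apply: ereal_sup_ubound; exists h => // x; apply: le_trans (hf x) _.
rewrite !patchE; case: ifPn => // /set_mem Dx; exact: fg.
Qed.

(** [d] is the density at [a]; a relative variation of one quarter is what the final comparison of
    volumes affords. *)
Lemma smooth_measure_density (m : {measure set (heis R) -> \bar R}) (a : heis R) :
  smooth_measure m -> exists d delta : R, [/\ 0 < d, 0 < delta &
    forall S : set (heis R), measurable S -> (forall p, S p -> `|p - a| < delta) ->
      ((3 / 4 * d)%:E * lebesgue3 S <= m S)%E /\ (m S <= (5 / 4 * d)%:E * lebesgue3 S)%E].
Proof.
move=> [rho [srho rho0 hm]].
have crho : {for a, continuous rho} by apply: differentiable_continuous; exact: (srho [::] a).
have e0 : 0 < rho a / 4 by rewrite divr_gt0.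
have /cvgrPdist_lt/(_ _ e0)/nbhs_ballP[delta /= delta0 hd] := crho.
exists (rho a), delta; split => // S mS Sa.
have mE : m S = (\int[lebesgue3]_(x in S) (rho x)%:E)%E := hm S mS.
have near x : S x -> 3 / 4 * rho a <= rho x <= 5 / 4 * rho a.
  move=> /Sa xa; have := hd x; rewrite -ball_normE /ball_/= distrC => /(_ xa).
  by rewrite ltr_norml; move: (rho a) (rho x) => A B; clear => /andP[? ?]; apply/andP; split; lra.
have cstE c : (c%:E * lebesgue3 S = \int[lebesgue3]_(x in S) c%:E)%E.
  by rewrite integral_cst.
rewrite mE !cstE; split; apply: (@ge0_le_integral_any _ _ (@lebesgue3 R)) => x Sx; rewrite lee_fin.
- by rewrite mulr_ge0// ltW.
- by case/andP: (near _ Sx).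
- by rewrite ltW.
- by case/andP: (near _ Sx).
Qed.

Lemma near_coords (e k : R * R) (a : heis R) : e.1 * k.2 - e.2 * k.1 = 1 ->
  exists2 C : R, 0 < C & forall (eta : R) p, 0 <= eta <= 1 ->
    `|cx k p.1 - cx k a.1| <= eta -> `|cy e p.1 - cy e a.1| <= eta ->
    `|cw e k p - cw e k a| <= eta -> `|p - a| <= C * eta.
Proof.
move=> ek.
exists (`|e.1| + `|e.2| + `|k.1| + `|k.2| + (2 + `|cx k a.1| + `|cy e a.1|)).
  by rewrite ltr_wpDl ?addr_ge0// -addrA ltr_pwDl// addr_ge0.
move=> eta p /andP[eta0 eta1] hx hy hw.
have E1 : p.1.1 - a.1.1 = (cx k p.1 - cx k a.1) * e.1 + (cy e p.1 - cy e a.1) * k.1.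
  by rewrite -[LHS]mulr1 -ek /cx /cy; ring.
have E2 : p.1.2 - a.1.2 = (cx k p.1 - cx k a.1) * e.2 + (cy e p.1 - cy e a.1) * k.2.
  by rewrite -[LHS]mulr1 -ek /cx /cy; ring.
have E3 : p.2 - a.2 = (cw e k p - cw e k a) + ((cx k p.1 - cx k a.1) * (cy e p.1 - cy e a.1)
   + cx k a.1 * (cy e p.1 - cy e a.1) + cy e a.1 * (cx k p.1 - cx k a.1)) / 2.
  by rewrite /cw; field.
move: hx hy hw E1 E2 E3.
set x := cx k p.1 - cx k a.1; set y := cy e p.1 - cy e a.1; set w := cw e k p - cw e k a.
set xa := cx k a.1; set ya := cy e a.1.
move=> hx hy hw E1 E2 E3.
have a1 : `|e.1| * eta >= 0 by rewrite mulr_ge0.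
have a2 : `|e.2| * eta >= 0 by rewrite mulr_ge0.
have a3 : `|k.1| * eta >= 0 by rewrite mulr_ge0.
have a4 : `|k.2| * eta >= 0 by rewrite mulr_ge0.
have a5 : `|xa| * eta >= 0 by rewrite mulr_ge0.
have a6 : `|ya| * eta >= 0 by rewrite mulr_ge0.
rewrite !prod_normE/= E1 E2 E3 !ge_max -andbA; apply/and3P; split.
- have := normD_le (normM_le hx (lexx `|e.1|)) (normM_le hy (lexx `|k.1|)).
  move/le_trans; apply; move: a1 a2 a3 a4 a5 a6 eta0; rewrite !(mulrC eta) !mulrDl.
  by clear; move: (`|e.1|) (`|e.2|) (`|k.1|) (`|k.2|) (`|xa|) (`|ya|) => A B C D F G; lra.
- have := normD_le (normM_le hx (lexx `|e.2|)) (normM_le hy (lexx `|k.2|)).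
  move/le_trans; apply; move: a1 a2 a3 a4 a5 a6 eta0; rewrite !(mulrC eta) !mulrDl.
  by clear; move: (`|e.1|) (`|e.2|) (`|k.1|) (`|k.2|) (`|xa|) (`|ya|) => A B C D F G; lra.
have ee : eta * eta <= eta by rewrite ler_piMl.
have b1 := normD_le (normD_le (normM_le hx hy) (normM_le (lexx `|xa|) hy)) (normM_le (lexx `|ya|) hx).
have h2 : `|2^-1 : R| <= 1 by rewrite ger0_norm ?invr_ge0// invf_le1// ler1n.
have := normD_le hw (normM_le b1 h2); move/le_trans; apply.
move: a1 a2 a3 a4 a5 a6 eta0 ee; rewrite !mulrDl mulr1.
clear; move: (`|e.1|) (`|e.2|) (`|k.1|) (`|k.2|) (`|xa|) (`|ya|) => A B C D F G.
by lra.
Qed.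

End density.

(** * Midpoints between neighbourhoods of the two ends *)

Section localisation.
Context {R : realType}.
Implicit Types (N : R * R -> R) (e k : R * R) (a b p q : heis R).

Lemma endpoint_bounds_scaled (r ya wa yb wb : R) : 0 < r ->
  `|ya - 3 * wa| <= 2 * r -> `|ya - 2 * wa| <= 2 * r ->
  `|yb + 3 * wb| <= 2 * r -> `|yb + 2 * wb| <= 2 * r ->
  [/\ `|yb - ya| <= 20 * r, `|ya + yb| <= 20 * r, `|wb - wa| <= 8 * r
    & `|ya + yb + (wb - wa)| <= 12 * r].
Proof.
move=> r0; rewrite !ler_norml => /andP[? ?] /andP[? ?] /andP[? ?] /andP[? ?].
by split; apply/andP; split; lra.
Qed.

Lemma kinetic_bound (r xa ya wa xb yb wb : R) : 0 < r <= 1 / 1000 / 100 ->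
  `|xa + 1| <= r -> `|ya - 3 * wa| <= 2 * r -> `|ya - 2 * wa| <= 2 * r ->
  `|xb - 1| <= r -> `|yb + 3 * wb| <= 2 * r -> `|yb + 2 * wb| <= 2 * r ->
  kinetic ya wa yb wb (xb - xa) <= r.
Proof.
move=> /andP[r0 r1] hxa ha3 ha2 hxb hb3 hb2.
have [h1 h2 h3 _] := endpoint_bounds_scaled r0 ha3 ha2 hb3 hb2.
set X := xb - xa; have X1 : 1 <= X.
  by move: hxa hxb r1; rewrite /X !ler_norml; clear => /andP[? ?] /andP[? ?] ?; lra.
have X0 : 0 < X by apply: lt_le_trans X1.
rewrite /kinetic ler_pdivrMr ?mulr_gt0//.
have h4 : `|6 * (wb - wa) / X| <= 48 * r.
  rewrite 2!normrM normfV (gtr0_norm X0) ler_pdivrMr// normr_nat.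
  have : 48 * r * 1 <= 48 * r * X by rewrite ler_wpM2l// mulr_ge0// ltW.
  by move: h3; move: (`|_|) => A; clear; lra.
have h5 : `|3 * (ya + yb) + 6 * (wb - wa) / X| <= 60 * r + 48 * r.
  apply: normD_le h4; rewrite normrM normr_nat.
  by move: h2; move: (`|_|) => A; clear; lra.
have b1 := normM_le h1 h1; have b2 := normM_le h5 h5.
have rr : r * r <= r * (1 / 1000 / 100) by rewrite ler_pM2l.
have rX : r * 1 <= r * X by rewrite ler_pM2l.
rewrite !expr2; move: b1 b2 r0; rewrite !ler_norml.
move: (_ * (yb - ya)) (_ * (_ + _ / X)) => A B.
move: rr rX; clear.
by move=> ? ? /andP[? ?] /andP[? ?] ?; lra.
Qed.

(** The scale [600 r] covers the slopes of the parabolas, at most [20 r + 3 * 108 r = 344 r], and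
    those of the calibrations, as [11 r + 3 * 19 r = 68 r <= 600 r / 8]. At this scale the relative
    error of one in [10^8] gives [E = 9 / 2500 kap r^2], just below the [kap r^2 / 250] allowed by
    [midpoint_box]. *)
Lemma midpoint_localisation N e k (kap r : R) a b p : is_norm N ->
  0 < r <= 1 / 1000 / 100 -> kap * r <= 1 / 1000 / 100 ->
  osculates N e k kap (600 * r) (1 / 1000 / 1000 / 100) ->
  `|cx k a.1 + 1| <= r -> `|cy e a.1 - 3 * cw e k a| <= 2 * r ->
  `|cy e a.1 - 2 * cw e k a| <= 2 * r ->
  `|cx k b.1 - 1| <= r -> `|cy e b.1 + 3 * cw e k b| <= 2 * r ->
  `|cy e b.1 + 2 * cw e k b| <= 2 * r ->
  (sf_dist N a b <= 3%:E)%E /\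
  (sf_dist N a p = ((1 / 2)%:E * sf_dist N a b)%E ->
   sf_dist N p b = ((1 / 2)%:E * sf_dist N a b)%E ->
   [/\ `|cx k p.1| <= 5 / 4 * r, `|cy e p.1| <= 5 / 4 * r & `|cw e k p| <= 5 / 4 * r]).
Proof.
move=> hN r01 kr hO hxa ha3 ha2 hxb hb3 hb2.
have [r0 r1] := andP r01.
have [ek kap0 _ _ _] := hO.
set E := 1 / 1000 / 1000 / 100 * kap * (600 * r) ^+ 2.
pose X := cx k b.1 - cx k a.1.
have X12 : 1 <= X <= 201 / 100.
  move: hxa hxb r1; rewrite /X !ler_norml; clear => /andP[? ?] /andP[? ?] ?.
  by apply/andP; split; lra.
have [X1 X2] := andP X12; have X0 : 0 < X by apply: lt_le_trans X1.
have [h1 h2 h3 _] := endpoint_bounds_scaled r0 ha3 ha2 hb3 hb2.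
have kin := kinetic_bound r01 hxa ha3 ha2 hxb hb3 hb2.
have kr0 : 0 <= kap * r ^+ 2 by rewrite mulr_ge0 ?sqr_ge0 ?ltW.
have EE : E = kap * r ^+ 2 * (9 / 2500) by rewrite /E; field.
have E01 : 0 <= E <= kap * r ^+ 2 / 250.
  by rewrite EE; move: kr0; move: (kap * _) => z; clear => ?; apply/andP; split; lra.
pose U := X * (1 + E) + kap * kinetic (cy e a.1) (cw e k a) (cy e b.1) (cw e k b) X.
have hU : (sf_dist N a b <= U%:E)%E.
  apply: (sf_dist_le_quad hN hO) => //; rewrite -/X.
  have h4 : `|6 * (cw e k b - cw e k a) / X| <= 48 * r.
    rewrite 2!normrM normfV (gtr0_norm X0) ler_pdivrMr// normr_nat.
    have : 48 * r * 1 <= 48 * r * X by rewrite ler_wpM2l// mulr_ge0// ltW.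
    by move: h3; move: (`|_|) => A; clear; lra.
  have h5 : `|3 * (cy e a.1 + cy e b.1) + 6 * (cw e k b - cw e k a) / X| <= 60 * r + 48 * r.
    apply: normD_le h4; rewrite normrM normr_nat.
    by move: h2; move: (`|_|) => A; clear; lra.
  have : r * 1 <= r * X by rewrite ler_pM2l.
  by move: h1 h5 r0; move: (`|_|) (`|_|) => A B; clear; lra.
have U3 : U <= 9 / 4.
  have k1 : kap * kinetic (cy e a.1) (cw e k a) (cy e b.1) (cw e k b) X <= 1 / 1000.
    apply: le_trans (ler_wpM2l (ltW kap0) kin) _; apply: le_trans kr _; clear; lra.
  have E1 : E <= 1 / 1000.
    have : kap * r ^+ 2 <= 1 / 1000 / 100 * r by rewrite expr2 mulrA ler_wpM2r// ltW.
    by rewrite EE; move: r1; move: (kap * _) => z; clear; lra.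
  have XE : X * (1 + E) <= 201 / 100 * (1 + 1 / 1000).
    by apply: ler_pM => //; [exact: ltW|rewrite addr_ge0//; case/andP: E01|rewrite lerD2l].
  by move: k1 XE; rewrite /U; move: (X * _) (kap * _) => A B; clear; lra.
split; first by apply: le_trans hU _; rewrite lee_fin; apply: le_trans U3 _; clear; lra.
have D0 : (0 <= sf_dist N a b)%E.
  by apply: le_trans (cx_le_sf_dist a b hN hO); rewrite lee_fin.
have [x xE] : exists x : R, sf_dist N a b = x%:E.
  exists (fine (sf_dist N a b)); rewrite fineK// ge0_fin_numE//.
  by apply: le_lt_trans hU _; rewrite ltry.
rewrite xE -EFinM => da db.
have xU : 1 / 2 * x <= U / 2 by move: hU; rewrite xE lee_fin; clear; lra.
have x32 : 1 / 2 * x < 3 / 2 by move: xU U3; clear; lra.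
have d1 := cx_le_sf_dist a p hN hO; have d2 := cx_le_sf_dist p b hN hO.
move: d1 d2; rewrite da db !lee_fin => d1 d2.
apply: (@midpoint_box _ r kap E (cx k a.1) (cy e a.1) (cw e k a) (cx k b.1) (cy e b.1)
  (cw e k b)) => //; rewrite -/X -/U.
- exact: le_trans (ler_norm _) (le_trans d1 xU).
- exact: le_trans (ler_norm _) (le_trans d2 xU).
move=> hxp H L hH hL.
have HL : `|H| + 3 * `|L| <= 600 * r / 8.
  by move: hH hL r0; move: (`|H|) (`|L|) => A B; clear; lra.
have ca : `|cx k a.1| <= 6 / 5.
  by move: hxa r1; rewrite !ler_norml; clear => /andP[? ?] ?; apply/andP; split; lra.
have cp : `|cx k p.1| <= 6 / 5 by move: hxp r1; clear; lra.
have := sf_dist_calibration (q := p) hN hO HL ca.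
have := sf_dist_calibration (q := b) hN hO HL cp.
rewrite da db !lte_fin !lee_fin -/E => /(_ x32) e1 /(_ x32) e2.
by split; [exact: le_trans e2 xU|exact: le_trans e1 xU].
Qed.

End localisation.

(** * Boxes, and the support of the measure *)

Section boxes.
Context {R : realType}.
Notation mu := (@lebesgue_measure R).
Implicit Types (N : R * R -> R) (e k : R * R) (a b p q : heis R).

(** The three forms arise from [(cx, cy, cw)] by shears, so the volume is the product of the sides
    for all [s], [t], [c]. *)
Definition box e k (s t c x0 y0 w0 hx hy hw : R) : set (heis R) :=
  [set p | [/\ `|cx k p.1 - x0| <= hx, `|cy e p.1 + s * cw e k p - y0| <= hy
     & `|cw e k p + t * (cy e p.1 + s * cw e k p) + c * cx k p.1 - w0| <= hw]].

Lemma lebesgue3_symmetric_box e k (s t c x0 y0 w0 hx hy hw : R) :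
  e.1 * k.2 - e.2 * k.1 = 1 -> e.2 != 0 -> 0 < hx -> 0 < hy -> 0 < hw ->
  measurable (box e k s t c x0 y0 w0 hx hy hw) /\
  lebesgue3 (box e k s t c x0 y0 w0 hx hy hw) = (8 * (hx * hy * hw))%:E.
Proof.
move=> ek e2 x_gt0 y_gt0 w_gt0.
pose I (z h : R) : set R := `[z - h, z + h]%classic.
have muI (z h : R) : 0 < h -> mu (I z h) = (2 * h)%:E.
  move=> h0; rewrite lebesgue_measure_itv/= lte_fin ifT; last by move: h0; clear; lra.
  by rewrite -EFinB; congr EFin; ring.
have mI (z h : R) : measurable (I z h) by exact: measurable_itv.
have [mS lS] := lebesgue3_box s t c ek e2 (mI x0 hx) (mI y0 hy) (mI w0 hw).
have BE : box e k s t c x0 y0 w0 hx hy hw = [set p : heis R | [/\ I x0 hx (cx k p.1),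
    I y0 hy (cy e p.1 + s * cw e k p)
   & I w0 hw (cw e k p + t * (cy e p.1 + s * cw e k p) + c * cx k p.1)]].
  by apply/seteqP; split => p; rewrite /box /I /= !in_itv/= !ler_distl.
rewrite BE; split => //; rewrite lS !muI// -!EFinM; congr EFin; ring.
Qed.

(** Each ball contains a small box at [s / 2 <= x - xa <= s], since [sf_dist_le_crude] asks for a
    positive increment of [x]. The box follows the horizontal plane at [a]: [w - wa + ya (x - xa)]
    is of order [s^2], so that the curvature coefficient of the parabola is of order [s]. *)
Lemma spt_sf_dist N (m : {measure set (heis R) -> \bar R}) e k a : is_norm N ->
  e.1 * k.2 - e.2 * k.1 = 1 -> e.2 != 0 -> N e = 1 -> smooth_measure m ->
  spt (sf_dist N) m a.
Proof.
move=> hN ek e2 Ne sm r r0.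
have [d [delta [d0 delta0 hd]]] := smooth_measure_density a sm.
have [C C0 hC] := near_coords a ek.
set ya := cy e a.1.
have Nk := nrm_ge0 hN k.
(* [B] gathers the two demands on [s]: length below [r], and a box inside the zone where the density
   is controlled. *)
pose B := (1 + 48 * N k) / r + (1 + `|ya|) * (1 + C / delta) + 1.
have p1 : 0 <= (1 + 48 * N k) / r by rewrite divr_ge0 ?(ltW r0)// addr_ge0// mulr_ge0.
have p2 : 0 <= C / delta by rewrite divr_ge0// ltW.
have p3 : 0 <= (1 + `|ya|) * (1 + C / delta) by rewrite mulr_ge0// addr_ge0.
have B1 : 1 <= B by rewrite /B lerDr addr_ge0.
have B0 : 0 < B by apply: lt_le_trans B1.
pose s := (2 * B)^-1.
have s0 : 0 < s by rewrite invr_gt0 mulr_gt0.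
have sB x : 0 <= x -> x <= B -> x * s <= 1 / 2.
  move=> x0 xB; apply: le_trans (ler_wpM2r (ltW s0) xB) _.
  by rewrite /s le_eqVlt; apply/orP; left; apply/eqP; field; rewrite gt_eqF.
have s12 : s <= 1 / 2 by rewrite -[s]mul1r sB.
have s1 : (1 + 48 * N k) * s < r.
  have : (1 + 48 * N k) / r * s <= 1 / 2.
    by apply: sB => //; rewrite /B -addrA lerDl addr_ge0.
  rewrite mulrAC ler_pdivrMr// => /le_lt_trans; apply.
  by rewrite gtr_pMl//; clear; lra.
have s2 : (1 + `|ya|) * (1 + C / delta) * s <= 1 / 2.
  by apply: sB => //; rewrite /B addrAC lerDr addr_ge0.
pose eta := (1 + `|ya|) * s.
have ya1 : 0 < 1 + `|ya| by rewrite ltr_pwDl.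
have eta0 : 0 < eta by rewrite mulr_gt0.
have [eta1 etaC] : eta <= 1 /\ C * eta < delta.
  have -> : C * eta = C / delta * eta * delta by field; rewrite gt_eqF.
  have h : eta + C / delta * eta <= 1 / 2.
    by apply: le_trans s2; rewrite /eta le_eqVlt; apply/orP; left; apply/eqP; ring.
  have h2 : 0 <= C / delta * eta by rewrite mulr_ge0// ltW.
  split; first by move: h h2; move: (_ * eta) => z; clear; lra.
  rewrite gtr_pMl//; move: h eta0; move: (_ * eta) => z; clear; lra.
have seta : s <= eta by rewrite /eta ler_peMl ?(ltW s0)// lerDl.
have ss : s ^+ 2 <= s by rewrite expr2 ler_piMl ?(ltW s0)//; move: s12; clear; lra.
have s20 : 0 < s ^+ 2 by rewrite exprn_gt0.
have s40 : 0 < s / 4 by rewrite divr_gt0.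
have [mS lS] := lebesgue3_symmetric_box 0 0 ya (cx k a.1 + 3 / 4 * s) ya
  (cw e k a + ya * cx k a.1) ek e2 s40 s0 s20.
set S := box _ _ _ _ _ _ _ _ _ _ _ in mS lS.
have Sc p : S p -> [/\ s / 2 <= cx k p.1 - cx k a.1 <= s, `|cy e p.1 - ya| <= s
   & `|cw e k p - cw e k a + ya * (cx k p.1 - cx k a.1)| <= s ^+ 2].
  move=> [h1 h2 h3]; split.
  - move: h1; rewrite ler_norml; move: (cx k p.1) (cx k a.1) => x y; clear.
    by move=> /andP[? ?]; apply/andP; split; lra.
  - by move: h2; rewrite mul0r addr0.
  - move: h3; rewrite !mul0r addr0 => h3; apply: le_trans h3.
    by rewrite le_eqVlt; apply/orP; left; apply/eqP; congr `|_|; ring.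
have Sball p : S p -> `|p - a| < delta.
  move=> /Sc[h1 h2 h3]; apply: le_lt_trans etaC; apply: hC.
  - by rewrite (ltW eta0).
  - apply: le_trans seta; rewrite ger0_norm; first by case/andP: h1.
    by case/andP: h1 => h1 _; apply: le_trans h1; rewrite divr_ge0// ltW.
  - exact: le_trans seta.
  - have h4 : `|cx k p.1 - cx k a.1| <= s.
      rewrite ger0_norm; first by case/andP: h1.
      by case/andP: h1 => h1 _; apply: le_trans h1; rewrite divr_ge0// ltW.
    have -> : cw e k p - cw e k a = (cw e k p - cw e k a + ya * (cx k p.1 - cx k a.1))
        - ya * (cx k p.1 - cx k a.1) by rewrite addrK.
    have -> : eta = s + `|ya| * s by rewrite /eta; ring.
    apply: le_trans (ler_normB _ _) _; rewrite normrM lerD//.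
      exact: le_trans h3 ss.
    by rewrite ler_wpM2l.
have SB : S `<=` [set y | (sf_dist N a y < r%:E)%E].
  move=> p /Sc[h1 h2 h3] /=.
  have [h11 h12] := andP h1.
  have X0 : 0 < cx k p.1 - cx k a.1 by apply: lt_le_trans h11; rewrite divr_gt0.
  apply: le_lt_trans (sf_dist_le_crude hN ek Ne X0) _; rewrite lte_fin -/ya.
  set X := cx k p.1 - cx k a.1 in h11 h12 h3 X0 *.
  have -> : 3 * (ya + cy e p.1) + 6 * (cw e k p - cw e k a) / X =
     3 * (cy e p.1 - ya) + 6 * ((cw e k p - cw e k a + ya * X) / X).
    by move: (cw e k p) (cw e k a) => w1 w2; field; rewrite gt_eqF.
  have h4 : `|(cw e k p - cw e k a + ya * X) / X| <= 2 * s.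
    rewrite normrM normfV (gtr0_norm X0) ler_pdivrMr//; apply: le_trans h3 _.
    have := ler_wpM2l (ltW s0) h11; rewrite expr2 -mulrA; move: (s * X) => z; clear; lra.
  have h5 : `|3 * (cy e p.1 - ya) + 6 * ((cw e k p - cw e k a + ya * X) / X)| <= 3 * s + 6 * (2 * s).
    apply: normD_le; rewrite normrM normr_nat ler_pM2l//.
  have h6 : (`|cy e p.1 - ya| + 3 * `|3 * (cy e p.1 - ya) + 6 * ((cw e k p - cw e k a + ya * X) / X)|) * N k
     <= 46 * s * N k.
    by rewrite ler_wpM2r//; move: h2 h5; move: (`|_|) (`|_|) => A D; clear; lra.
  apply: le_lt_trans s1; apply: le_trans (lerD h12 h6) _.
  have : 0 <= s * N k by rewrite mulr_ge0// ltW.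
  by clear; lra.
apply: (@lt_le_trans _ _ (m S)).
  have [h _] := hd S mS Sball; apply: lt_le_trans h; rewrite lS -EFinM lte_fin.
  by rewrite !mulr_gt0.
by rewrite -(measurable_mu_extE m mS); exact: le_mu_ext.
Qed.

End boxes.

(** * The configuration dilated by [l] *)

Section dilated_boxes.
Context {R : realType}.
Implicit Types (N : R * R -> R) (e k : R * R) (a b p q : heis R) (l r : R).

(* [sg = -1] is the source and [sg = 1] the target. They are the parallelepipeds whose
   geodesic midpoints concentrate best: each has volume [32 l^4 r^3]. *)
Definition end_box e k l r (sg : R) : set (heis R) :=
  box e k (2 * sg / l) (sg * l) 0 (sg * l) 0 0 (l * r) (2 * (l * r)) (2 * (l ^+ 2 * r)).

Definition mid_box e k l r : set (heis R) :=
  box e k 0 0 0 0 0 0 (5 / 4 * (l * r)) (5 / 4 * (l * r)) (5 / 4 * (l ^+ 2 * r)).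

(** As [sg^2 = 1], [w + sg (y + 2 sg w) = sg (y + 3 sg w)]: the third side of the box bounds the
    second linear form of the midpoint formula, written so as to come from a shear. *)
Lemma end_box_dil e k l r sg a : 0 < l -> sg ^+ 2 = 1 ->
  end_box e k l r sg (dil l a) <->
  [/\ `|cx k a.1 - sg| <= r, `|cy e a.1 + 2 * sg * cw e k a| <= 2 * r
    & `|cy e a.1 + 3 * sg * cw e k a| <= 2 * r].
Proof.
move=> l0 sg2; have l2 : 0 < l ^+ 2 by rewrite exprn_gt0.
have l_neq0 : l != 0 by rewrite gt_eqF.
have sg1 : `|sg| = 1 by apply/eqP; rewrite -sqr_norm_eq1 sg2.
rewrite /end_box /box /= cx_dil cy_dil cw_dil mul0r addr0 !subr0.
have -> : l * cx k a.1 - sg * l = l * (cx k a.1 - sg) by ring.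
have -> : l * cy e a.1 + 2 * sg / l * (l ^+ 2 * cw e k a) = l * (cy e a.1 + 2 * sg * cw e k a).
  by field.
have -> : l ^+ 2 * cw e k a + sg * l * (l * (cy e a.1 + 2 * sg * cw e k a)) =
   l ^+ 2 * (sg * (cy e a.1 + 3 * sg * cw e k a)).
  have -> : sg * (cy e a.1 + 3 * sg * cw e k a) = sg * cy e a.1 + 3 * sg ^+ 2 * cw e k a by ring.
  have -> : sg * l * (l * (cy e a.1 + 2 * sg * cw e k a)) =
    l ^+ 2 * (sg * cy e a.1 + 2 * sg ^+ 2 * cw e k a) by ring.
  by rewrite sg2; ring.
rewrite !normrM sg1 mul1r !(gtr0_norm l0) -[l * l]/(l ^+ 2).
rewrite (mulrCA 2 l) (mulrCA 2 (l ^+ 2)) !ler_pM2l//.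
Qed.

Lemma mid_box_dil e k l r p : 0 < l ->
  mid_box e k l r (dil l p) <->
  [/\ `|cx k p.1| <= 5 / 4 * r, `|cy e p.1| <= 5 / 4 * r & `|cw e k p| <= 5 / 4 * r].
Proof.
move=> l0; have l2 : 0 < l ^+ 2 by rewrite exprn_gt0.
rewrite /mid_box /box /= cx_dil cy_dil cw_dil !mul0r !addr0 !subr0 !normrM.
rewrite !(gtr0_norm l0) -[l * l]/(l ^+ 2).
by rewrite (mulrCA _ l) (mulrCA _ (l ^+ 2)) !ler_pM2l.
Qed.

Lemma measure_end_box e k l r sg : e.1 * k.2 - e.2 * k.1 = 1 -> e.2 != 0 -> 0 < l -> 0 < r ->
  measurable (end_box e k l r sg) /\ lebesgue3 (end_box e k l r sg) = (32 * (l ^+ 4 * r ^+ 3))%:E.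
Proof.
move=> ek e2 l0 r0.
have h1 : 0 < l * r by rewrite mulr_gt0.
have h2 : 0 < 2 * (l * r) by rewrite mulr_gt0.
have h3 : 0 < 2 * (l ^+ 2 * r) by rewrite mulr_gt0// mulr_gt0// exprn_gt0.
have [mS lS] := lebesgue3_symmetric_box (2 * sg / l) (sg * l) 0 (sg * l) 0 0 ek e2 h1 h2 h3.
by split => //; rewrite lS; congr EFin; ring.
Qed.

Lemma measure_mid_box e k l r : e.1 * k.2 - e.2 * k.1 = 1 -> e.2 != 0 -> 0 < l -> 0 < r ->
  measurable (mid_box e k l r) /\
  lebesgue3 (mid_box e k l r) = (125 / 8 * (l ^+ 4 * r ^+ 3))%:E.
Proof.
move=> ek e2 l0 r0.
have h1 : 0 < 5 / 4 * (l * r) by rewrite mulr_gt0// mulr_gt0.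
have h3 : 0 < 5 / 4 * (l ^+ 2 * r) by rewrite mulr_gt0// mulr_gt0// exprn_gt0.
have [mS lS] := lebesgue3_symmetric_box 0 0 0 0 0 0 ek e2 h1 h1 h3.
by split => //; rewrite lS; congr EFin; field.
Qed.

(* Every point of the three boxes has coordinates of size at most [2 l]. *)
Lemma boxes_small e k l r (C delta : R) p : 0 < l <= 1 -> 0 < r <= 1 / 1000 / 100 ->
  (forall (eta : R) q, 0 <= eta <= 1 -> `|cx k q.1 - cx k (0 : heis R).1| <= eta ->
     `|cy e q.1 - cy e (0 : heis R).1| <= eta ->
     `|cw e k q - cw e k 0| <= eta -> `|q - 0| <= C * eta) ->
  2 * l <= 1 -> C * (2 * l) < delta ->
  end_box e k l r (-1) p \/ end_box e k l r 1 p \/ mid_box e k l r p -> `|p - 0| < delta.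
Proof.
move=> /andP[l0 l1] /andP[r0 r1] hC l21 Cl hp.
have cx0 : cx k (0 : heis R).1 = 0 by rewrite /cx /=; ring.
have cy0 : cy e (0 : heis R).1 = 0 by rewrite /cy /=; ring.
have cw0 : cw e k 0 = 0 by rewrite /cw cx0 cy0 /=; ring.
have pE : p = dil l (dil l^-1 p) by rewrite dilK// gt_eqF.
set q := dil l^-1 p in pE.
have [h1 h2 h3] : [/\ `|cx k q.1| <= 2, `|cy e q.1| <= 2 & `|cw e k q| <= 2].
  have m1 : (-1 : R) ^+ 2 = 1 by rewrite sqrrN expr1n.
  have m2 : (1 : R) ^+ 2 = 1 by rewrite expr1n.
  move: hp; rewrite pE => -[|[]].
  - move=> /(end_box_dil _ _ _ _ l0 m1)[]; rewrite !mulrN1.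
    move: (cx _ _) (cy _ _) (cw _ _ _) => x y w; rewrite !ler_norml; move: r0 r1; clear.
    by move=> ? ? /andP[? ?] /andP[? ?] /andP[? ?]; split; apply/andP; split; lra.
  - move=> /(end_box_dil _ _ _ _ l0 m2)[]; rewrite !mulr1.
    move: (cx _ _) (cy _ _) (cw _ _ _) => x y w; rewrite !ler_norml; move: r0 r1; clear.
    by move=> ? ? /andP[? ?] /andP[? ?] /andP[? ?]; split; apply/andP; split; lra.
  - move=> /(mid_box_dil _ _ _ _ l0)[].
    by move: r0 r1; move: (`|_|) (`|_|) (`|_|) => x y w; clear => ? ? ? ? ?; split; lra.
apply: le_lt_trans Cl; apply: hC; first by rewrite l21 mulr_ge0// ltW.
- by rewrite cx0 subr0 pE cx_dil normrM (gtr0_norm l0) mulrC ler_wpM2r// ltW.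
- by rewrite cy0 subr0 pE cy_dil normrM (gtr0_norm l0) mulrC ler_wpM2r// ltW.
rewrite cw0 subr0 pE cw_dil normrM ger0_norm ?sqr_ge0// mulrC.
apply: ler_pM => //; first by rewrite sqr_ge0.
by rewrite expr2 ler_piMl// ltW.
Qed.

Lemma dilated_localisation N e k (kap l r : R) a b : is_norm N -> 0 < l ->
  0 < r <= 1 / 1000 / 100 -> kap * r <= 1 / 1000 / 100 ->
  osculates N e k kap (600 * r) (1 / 1000 / 1000 / 100) ->
  end_box e k l r (-1) a -> end_box e k l r 1 b ->
  (0%:E <= sf_dist N a b)%E /\ (sf_dist N a b <= (3 * l)%:E)%E /\
  (forall p, sf_dist N a p = ((1 / 2)%:E * sf_dist N a b)%E ->
     sf_dist N p b = ((1 / 2)%:E * sf_dist N a b)%E -> mid_box e k l r p).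
Proof.
move=> hN l0 r01 kr hO ha hb; have l_neq0 : l != 0 by rewrite gt_eqF.
split; first by apply: le_trans (cx_le_sf_dist a b hN hO); rewrite lee_fin.
have m1 : (-1 : R) ^+ 2 = 1 by rewrite sqrrN expr1n.
have m2 : (1 : R) ^+ 2 = 1 by rewrite expr1n.
move: ha hb; rewrite -(dilK a l_neq0) -(dilK b l_neq0).
move: (dil l^-1 a) (dil l^-1 b) => a' b'.
move=> /(end_box_dil _ _ _ _ l0 m1)[]; rewrite opprK !mulrN1 !mulNr => a1 a2 a3.
move=> /(end_box_dil _ _ _ _ l0 m2)[]; rewrite !mulr1 => b1 b2 b3.
have loc p := midpoint_localisation p hN r01 kr hO a1 a3 a2 b1 b3 b2.
rewrite sf_dist_dil//; split.
  have [h _] := loc 0; rewrite mulrC EFinM; apply: lee_pmul => //; first by rewrite lee_fin ltW.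
  by apply: le_trans (cx_le_sf_dist a' b' hN hO); rewrite lee_fin.
move=> p; rewrite -(dilK p l_neq0); move: (dil l^-1 p) => p'.
rewrite !sf_dist_dil// !(muleCA _ l%:E).
have inj (x y : \bar R) : (l%:E * x = l%:E * y)%E -> x = y.
  move=> h; have := congr1 (fun z => (l^-1)%:E * z)%E h.
  by rewrite !muleA -EFinM mulVf// !mul1e.
move=> /inj da /inj db; apply/mid_box_dil => //.
by have [_ h] := loc p'; exact: h.
Qed.

Lemma Theta_fin N (K L : R) (A B : set (heis R)) : A !=set0 -> B !=set0 ->
  (forall a b, A a -> B b -> (0%:E <= sf_dist N a b)%E /\ (sf_dist N a b <= L%:E)%E) ->
  exists2 th : R, 0 <= th <= L & Theta (sf_dist N) K A B = th%:E.
Proof.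
move=> [a0 Aa] [b0 Bb] h.
have fin (x : \bar R) : (0%:E <= x)%E -> (x <= L%:E)%E -> exists2 th : R, 0 <= th <= L & x = th%:E.
  by case: x => [y||]//=; rewrite !lee_fin => y0 yL; exists y => //; rewrite y0.
have [h1 h2] := h _ _ Aa Bb.
apply: fin; rewrite /Theta; case: ifPn => _.
- by apply: le_ereal_inf_tmp => _ [a Aa' [b Bb' <-]]; case: (h _ _ Aa' Bb').
- by apply: le_trans h1 _; apply: ereal_sup_ubound; exists a0 => //; exists b0.
- by apply: le_trans h2; apply: ereal_inf_lbound; exists a0 => //; exists b0.
- by apply: ge_ereal_sup => _ [a Aa' [b Bb' <-]]; case: (h _ _ Aa' Bb').
Qed.

End dilated_boxes.

(** * The contradiction with the Brunn-Minkowski inequality *)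

Unset Implicit Arguments.
Set Strict Implicit.

Theorem theorem5p22 (R : realType) (nrm : R * R -> R)
    (m : {measure set (heis R) -> \bar R}) :
  is_norm nrm -> strictly_convex_norm nrm -> C11_norm nrm ->
  smooth_measure m ->
  forall K N : R, 1 < N -> ~ BM (sf_dist nrm) m K N.
Proof.
move=> hN sc c11 sm K N N1 hBM.
have e8 : 0 < 1 / 1000 / 1000 / 100 :> R by clear; lra.
have e5 : 0 < 1 / 1000 / 100 :> R by clear; lra.
have [e [k [kap [rho [[ek e2] kap0 [/andP[rho0 rho1] kr] [Ne F1] F2]]]]] :=
  norm_osculation hN sc c11 e8 e5.
pose r := rho / 600.
have rE : rho = 600 * r by rewrite /r; field.
have r0 : 0 < r by apply: divr_gt0; rewrite ?ltr0n.
have r01 : 0 < r <= 1 / 1000 / 100.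
  by rewrite r0; move: rho1 r0; rewrite rE; clear; lra.
have kr1 : kap * r <= 1 / 1000 / 100.
  have : 0 < kap * r by rewrite mulr_gt0.
  by move: kr; rewrite rE mulrCA; move: (kap * r) => z; clear; lra.
have hO : osculates nrm e k kap (600 * r) (1 / 1000 / 1000 / 100).
  rewrite -rE; split => //.
  - split; first by rewrite rho0; move: rho1; clear; lra.
    by move: kr; clear; lra.
  - by clear; apply/andP; split; lra.
clear F1 F2 e8 e5.
have N0 : 0 < N by apply: lt_trans N1.
have iN0 : 0 < N^-1 by rewrite invr_gt0.
(* In units of [d l^4 r^3] each end box has measure at least [3/4 * 32 = 24], and the midpoints at
   most [5/4 * 125/8 = 625/32 < 20], which is [5/6] of 24. *)
pose c0 := (5 / 6 : R) `^ N^-1.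
have c00 : 0 < c0 by apply: powR_gt0; rewrite divr_gt0.
have c01 : c0 < 1.
  have h56 : (5 / 6 : R) < 1 by clear; lra.
  have -> : (1 : R) = 1 `^ N^-1 by rewrite powR1.
  by apply: gt0_ltr_powR; rewrite ?nnegrE// divr_ge0.
(* Strictly between [c0] and 1: two coefficients at least [c / 2] then demand more than the factor
   [c0]. *)
pose c := (1 + c0) / 2.
have c_lt1 : 0 < c < 1 by move: c00 c01; rewrite /c; clear => ? ?; apply/andP; split; lra.
have c0c : c0 < c by move: c01; rewrite /c; clear; lra.
have [th0 th00 htau] := tau_half_ge K N1 c_lt1.
have [d [delta [d0 delta0 hd]]] := smooth_measure_density 0 sm.
have [C C0 hC] := near_coords 0 ek.
(* The first two bounds put the boxes where the density is controlled; the third brings [3 l], which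
   bounds the distances between the end boxes, below [th0]. *)
pose l := Num.min (1 / 2) (Num.min (delta / (4 * C)) (th0 / 3)).
have l0 : 0 < l by rewrite !lt_min !divr_gt0// mulr_gt0.
have [l2 lC lth] : [/\ l <= 1 / 2, l <= delta / (4 * C) & l <= th0 / 3].
  by rewrite /l !ge_min !lexx !orbT.
clearbody l.
have l21 : 2 * l <= 1 by move: l2; clear; lra.
have l01 : 0 < l <= 1 by rewrite l0; move: l2; clear; lra.
have Cl : C * (2 * l) < delta.
  move: lC; rewrite ler_pdivlMr ?mulr_gt0// mulrCA; move: delta0.
  by rewrite (mulrCA C) (mulrC C); move: (l * C) => z; clear; lra.
have [mA lA] := measure_end_box (-1) ek e2 l0 r0.
have [mB lB] := measure_end_box 1 ek e2 l0 r0.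
have [mM lM] := measure_mid_box ek e2 l0 r0.
have small := boxes_small l01 r01 hC l21 Cl.
set A := end_box e k l r (-1) in mA lA small *.
set B := end_box e k l r 1 in mB lB small *.
set M := mid_box e k l r in mM lM small *.
have [dA _] := hd A mA (fun p Ap => small p (or_introl Ap)).
have [dB _] := hd B mB (fun p Bp => small p (or_intror (or_introl Bp))).
have [_ dM] := hd M mM (fun p Mp => small p (or_intror (or_intror Mp))).
have m1 : (-1 : R) ^+ 2 = 1 by rewrite sqrrN expr1n.
have m2 : (1 : R) ^+ 2 = 1 by rewrite expr1n.
have center (sg : R) : sg ^+ 2 = 1 -> end_box e k l r sg !=set0.
  move=> sg2; exists (dil l (sg *: e + 0 *: k, 0)); apply/end_box_dil => //=.
  rewrite /cw /= cx_comb// cy_comb// !mulr0 mul0r subr0 mulr0 addr0 subrr normr0.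
  have r20 : 0 <= 2 * r by apply: mulr_ge0 => //; exact: ltW.
  by rewrite mulr0 addr0 normr0; split=> //; exact: ltW.
have A0 : A !=set0 := center _ m1.
have B0 : B !=set0 := center _ m2.
have loc a b (Aa : A a) (Bb : B b) := dilated_localisation hN l0 r01 kr1 hO Aa Bb.
have [th /andP[th1 th2] thE] : exists2 th : R, 0 <= th <= 3 * l & Theta (sf_dist nrm) K A B = th%:E.
  by apply: Theta_fin => // a b Aa Bb; have [h1 [h2 _]] := loc a b Aa Bb.
have t12 : 0 < (1 / 2 : R) < 1 by apply/andP; split; clear; lra.
have sA : A `<=` spt (sf_dist nrm) m by move=> a _; exact: (spt_sf_dist a hN ek e2 Ne sm).
have sB : B `<=` spt (sf_dist nrm) m by move=> a _; exact: (spt_sf_dist a hN ek e2 Ne sm).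
have := hBM A B (1 / 2) mA mB A0 B0 sA sB t12.
have -> : 1 - 1 / 2 = 1 / 2 :> R by field.
rewrite thE; apply/negP; rewrite -ltNge.
have midM : midpoints (sf_dist nrm) (1 / 2) A B `<=` M.
  move=> p [g [geo Aa Bb ->]]; have [_ [_ h]] := loc _ _ Aa Bb.
  have z01 : 0 <= (0 : R) <= 1 by rewrite lexx ler01.
  have o01 : 0 <= (1 : R) <= 1 by rewrite lexx ler01.
  have h01 : 0 <= (1 / 2 : R) <= 1 by apply/andP; split; clear; lra.
  have h12 : `|1 / 2 : R| = 1 / 2 by rewrite ger0_norm// divr_ge0.
  apply: h; rewrite geo//; congr (_%:E * _)%E; first by rewrite subr0.
  by rewrite (_ : 1 - 1 / 2 = 1 / 2)//; field.
pose V := l ^+ 4 * r ^+ 3.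
have V0 : 0 < V by rewrite mulr_gt0 ?exprn_gt0.
pose al := 24 * (d * V).
have al0 : 0 < al by rewrite mulr_gt0// mulr_gt0.
have mAal (S : set (heis R)) : lebesgue3 S = (32 * (l ^+ 4 * r ^+ 3))%:E ->
    ((3 / 4 * d)%:E * lebesgue3 S <= m S)%E -> ((al `^ N^-1)%:E <= m S `^ N^-1)%E.
  move=> -> hS; rewrite -poweR_EFin; apply: gt0_ler_poweR; rewrite ?(ltW iN0)//.
  - by rewrite in_itv/= leey andbT lee_fin ltW.
  - by rewrite in_itv/= leey andbT measure_ge0.
  apply: le_trans hS; rewrite -EFinM lee_fin le_eqVlt; apply/orP; left; apply/eqP.
  by rewrite /al /V; field.
have mMal : (m^*%mu (midpoints (sf_dist nrm) (1 / 2) A B) `^ N^-1 <= (al `^ N^-1 * c0)%:E)%E.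
  rewrite -powRM ?(ltW al0)// -poweR_EFin; apply: gt0_ler_poweR; rewrite ?(ltW iN0)//.
  - by rewrite in_itv/= leey andbT mu_ext_ge0.
  - by rewrite in_itv/= leey andbT lee_fin mulr_ge0 ?(ltW al0)// divr_ge0.
  apply: le_trans (le_mu_ext m midM) _; rewrite measurable_mu_extE//.
  apply: le_trans dM _; rewrite lM -EFinM lee_fin -/V /al.
  have : 0 <= d * V by rewrite mulr_ge0// ltW.
  by rewrite mulrACA [d * _]mulrC -mulrA -/V; move: (d * V) => z; clear; lra.
apply: le_lt_trans mMal _.
have tau0 := htau th; have thth : 0 <= th <= th0.
  by rewrite th1; apply: le_trans th2 _; move: lth; clear; lra.
have c20 : 0 <= c / 2 by move: c_lt1; clear => /andP[? ?]; lra.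
have pal : 0 < al `^ N^-1 by exact: powR_gt0.
have term (S : set (heis R)) : ((al `^ N^-1)%:E <= m S `^ N^-1)%E ->
    ((c / 2 * al `^ N^-1)%:E <= tau K N (1 / 2) th%:E * m S `^ N^-1)%E.
  by move=> hS; rewrite EFinM; apply: lee_pmul; rewrite ?lee_fin ?(ltW pal)//; exact: tau0.
apply: lt_le_trans (leeD (term _ (mAal _ lA dA)) (term _ (mAal _ lB dB))).
rewrite -EFinD lte_fin -mulrDl -splitr mulrC ltr_pM2r//.
Qed.
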